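(* Let $N\ge1$, $\chi$ a Dirichlet character mod $N$, and $f$ a Maass form of level $N$ and character $\chi$ with $W_f(g)=\prod_vW_v(g_v)$ for all $g\in GL(2,\mathbb A)$. Fix $\gamma=\begin{pmatrix}a&b\\c&d\end{pmatrix}\in SL(2,\mathbb Z)$, set $M=\gcd(N,2cd)$, and assume that $\alpha\mapsto B_{f,N_1}(\gamma,\alpha)$ is multiplicative on $\mathbb Q^\times$. Then for each prime $q$: $v_q(N/M)=0$ if $q>3$ or $v_q(M)=0$; $0\le v_q(N/M)\le1$ if $q=3$ and $v_q(M)>0$; $0\le v_q(N/M)\le2$ if $q=2$ and $v_q(M)=1$; $0\le v_q(N/M)\le3$ if $q=2$ and $v_q(M)\ge2$.
   Context: With $(F|_k\gamma)(z)=(\frac{cz+d}{|cz+d|})^{-k}F(\frac{az+b}{cz+d})$, $f$ satisfies $f|_k\gamma=\chi(d)f$ for $\gamma\in\Gamma_0(N)$ and is an eigenfunction of the weight-$k$ Laplacian; level $N$ means $N$ is the smallest positive integer such that $f|_k\gamma_1=\xi(\gamma_1)f$ for all $\gamma_1\in\Gamma_0(N)$ with $\xi$ a character trivial on $\Gamma_1(N)$. $W_f$ is the Whittaker function of the adelic lift of $f$, assumed to factor into local functions $W_v$ on $GL(2,\mathbb Q_v)$. $N_1=\prod q^{v_q(N)-v_q(c)}$ over primes $q\mid N$ satisfying none of: $v_q(c)=v_q(N)$; $v_q(d)=v_q(N)$; $q=2$ and $v_2(c)=v_2(N)-1$ ($v_q$ the $q$-adic valuation). $B_{f,N_1}(\gamma,\alpha)=\prod_{q\mid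 N_1}W_q\!\left(\begin{pmatrix}\alpha&0\\0&1\end{pmatrix}\gamma^{-1}\right)$. Multiplicative: $h(\epsilon\prod_pp^{e_p})=h_\infty(\epsilon)\prod_ph_p(e_p)$ for some $h_\infty:\{\pm1\}\to\mathbb C$, $h_p:\mathbb Z\to\mathbb C$ with $h_p(0)=1$ for almost all $p$. *)

(* Defs.v *)
From HB Require Import structures.
From mathcomp Require Import all_boot all_order all_algebra.
From mathcomp Require Import complex.
From mathcomp Require Import all_classical all_reals all_analysis.
Import Order.TTheory GRing.Theory Num.Theory.
Import numFieldNormedType.Exports.

Set Implicit Arguments.
Unset Strict Implicit.
Unset Printing Implicit Defensive.

Local Open Scope ring_scope.
Local Open Scope complex_scope.

Definition primeT : Type := {p : nat | prime p}.

(* Z_p is the inverse limit of the Z/p^n; residues are represented in [0, p^n[,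
   which makes equality of elements the Leibniz equality. *)
Record padic_int (p : primeT) : Type := PadicInt {
  residue :> nat -> int;
  residueP : forall n, residue n = (residue n.+1 %% (val p ^ n)%N)%Z }.

Section PadicInt.
Variable p : primeT.
Local Notation pn n := ((val p ^ n)%N%:Z).
Local Notation Z_p := (padic_int p).

HB.instance Definition _ := gen_eqMixin Z_p.
HB.instance Definition _ := gen_choiceMixin Z_p.

Lemma padic_int_ext (x y : Z_p) : (forall n, x n = y n) -> x = y.
Proof.
case: x y => [x xP] [y yP] /= xy.
have {}xy : x = y by apply: funext.
by case: y / xy yP => yP; congr PadicInt; apply: Prop_irrelevance.
Qed.

Lemma modz_pnS (m : int) n : ((m %% pn n.+1)%Z %% pn n)%Z = (m %% pn n)%Z.
Proof.
apply/eqP; rewrite eqz_mod_dvd {2}(divz_eq m (pn n.+1)) opprD addrCA subrr addr0.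
by rewrite dvdzE abszN abszM dvdn_mull //= expnS dvdn_mull.
Qed.

Lemma residue_mod (x : Z_p) n : (x n %% pn n)%Z = x n.
Proof. by rewrite residueP modz_mod. Qed.

Lemma residue_coherent (x : Z_p) n : (x n.+1 = x n %[mod pn n])%Z.
Proof. by rewrite residue_mod -residueP. Qed.

Fact mk_padicP (u : nat -> int)
    (uP : forall n, (u n.+1 = u n %[mod pn n])%Z) n :
  (u n %% pn n)%Z = ((u n.+1 %% pn n.+1)%Z %% pn n)%Z.
Proof. by rewrite modz_pnS uP. Qed.

Definition mk_padic u uP : Z_p := PadicInt (@mk_padicP u uP).

Fact padic_opp_subproof (x : Z_p) n : (- x n.+1 = - x n %[mod pn n])%Z.
Proof. by rewrite -modzNm residue_coherent modzNm. Qed.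

Fact padic_add_subproof (x y : Z_p) n :
  (x n.+1 + y n.+1 = x n + y n %[mod pn n])%Z.
Proof. by rewrite -modzDm !residue_coherent modzDm. Qed.

Fact padic_mul_subproof (x y : Z_p) n :
  (x n.+1 * y n.+1 = x n * y n %[mod pn n])%Z.
Proof. by rewrite -modzMm !residue_coherent modzMm. Qed.

Definition padic_zero : Z_p := @mk_padic (fun=> 0) (fun=> erefl).
Definition padic_one : Z_p := @mk_padic (fun=> 1) (fun=> erefl).
Definition padic_opp (x : Z_p) := mk_padic (padic_opp_subproof x).
Definition padic_add (x y : Z_p) := mk_padic (padic_add_subproof x y).
Definition padic_mul (x y : Z_p) := mk_padic (padic_mul_subproof x y).

Fact padic_addA : associative padic_add.
Proof.
by move=> x y z; apply: padic_int_ext => n /=; rewrite modzDmr modzDml addrA.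
Qed.

Fact padic_addC : commutative padic_add.
Proof. by move=> x y; apply: padic_int_ext => n /=; rewrite addrC. Qed.

Fact padic_add0 : left_id padic_zero padic_add.
Proof.
by move=> x; apply: padic_int_ext => n /=; rewrite modzDml add0r residue_mod.
Qed.

Fact padic_addN : left_inverse padic_zero padic_opp padic_add.
Proof.
by move=> x; apply: padic_int_ext => n /=; rewrite modzDml addNr.
Qed.

HB.instance Definition _ :=
  GRing.isZmodule.Build Z_p padic_addA padic_addC padic_add0 padic_addN.

Fact padic_mulA : associative padic_mul.
Proof.
by move=> x y z; apply: padic_int_ext => n /=; rewrite modzMmr modzMml mulrA.
Qed.

Fact padic_mulC : commutative padic_mul.
Proof. by move=> x y; apply: padic_int_ext => n /=; rewrite mulrC. Qed.

Fact padic_mul1 : left_id padic_one padic_mul.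
Proof.
by move=> x; apply: padic_int_ext => n /=; rewrite modzMml mul1r residue_mod.
Qed.

Fact padic_mulDl : left_distributive padic_mul padic_add.
Proof.
by move=> x y z; apply: padic_int_ext => n /=; rewrite modzMml modzDm mulrDl.
Qed.

Fact padic_one_neq0 : padic_one != 0 :> Z_p.
Proof.
apply/eqP => /(congr1 (fun x : Z_p => x 1%N)) /=.
by case: p => q /= pr_q; rewrite expn1 mod0z modz_small //= ltz_nat prime_gt1.
Qed.

HB.instance Definition _ := GRing.Zmodule_isComNzRing.Build Z_p
  padic_mulA padic_mulC padic_mul1 padic_mulDl padic_one_neq0.

Definition padic_unit : {pred Z_p} := [pred x | `[< exists y, y * x = 1 >]].
Definition padic_inv (x : Z_p) := xget x [set y | y * x = 1]%classic.

Fact padic_mulVx : {in padic_unit, left_inverse 1 padic_inv *%R}.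
Proof.
move=> x /asboolP[y yx].
by apply: (@xgetPex _ x [set y | y * x = 1]%classic); exists y.
Qed.

Fact padic_unitPl (x y : Z_p) : y * x = 1 -> padic_unit x.
Proof. by move=> yx; apply/asboolP; exists y. Qed.

Fact padic_inv_out : {in [predC padic_unit], padic_inv =1 id}.
Proof.
move=> x /asboolP nx.
by apply: xgetPN => y yx; apply: nx; exists y.
Qed.

HB.instance Definition _ := GRing.ComNzRing_hasMulInverse.Build Z_p
  padic_mulVx padic_unitPl padic_inv_out.

Lemma residue_le (x : Z_p) m n : (m <= n)%N -> (x n = x m %[mod pn m])%Z.
Proof.
move=> /subnK <-; elim: (n - m)%N => [|k IHk]; first by rewrite add0n.
rewrite -IHk addSn; apply/eqP; rewrite eqz_mod_dvd.
have /eqP := residue_coherent x (k + m); rewrite eqz_mod_dvd.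
by apply: dvdz_trans; rewrite dvdzE /= expnD dvdn_mull.
Qed.

Fact padic_idomain (x y : Z_p) : x * y = 0 -> (x == 0) || (y == 0).
Proof.
move=> xy0; apply/orP; apply: contrapT => /not_orP[/negP/eqP x0 /negP/eqP y0].
have nz (z : Z_p) : z <> 0 -> exists n, ~~ (pn n %| z n)%Z.
  move=> z0; apply: contrapT => nz; apply: z0; apply: padic_int_ext => n /=.
  rewrite mod0z -residue_mod; apply/dvdz_mod0P.
  by apply: contrapT => /negP zn; apply: nz; exists n.
have [m xm] := nz x x0; have [n yn] := nz y y0.
have low (z : Z_p) i j : (i <= j)%N -> ~~ (pn i %| z i)%Z -> ~~ (pn i %| z j)%Z.
  by move=> ij; apply: contraNN => /dvdz_mod0P zj; apply/dvdz_mod0P;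
    rewrite -(residue_le z ij).
have {}xm := low x m (m + n)%N (leq_addr _ _) xm.
have {}yn := low y n (m + n)%N (leq_addl _ _) yn.
have /= := congr1 (fun z : Z_p => z (m + n)%N) xy0.
rewrite mod0z => /dvdz_mod0P.
move: xm yn; rewrite !dvdzE /= abszM.
set a := `|x _|%N; set b := `|y _|%N; case: (p) => q /= pr_q qa qb.
have a0 : (0 < a)%N by case: (a) qa => //; rewrite dvdn0.
have b0 : (0 < b)%N by case: (b) qb => //; rewrite dvdn0.
rewrite !pfactor_dvdn ?muln_gt0 ?a0 // in qa qb *.
rewrite lognM // => ab; rewrite -!ltnNge in qa qb.
by move: ab; rewrite leqNgt -addSn leq_add // ltnW.
Qed.

HB.instance Definition _ :=
  GRing.ComUnitRing_isIntegral.Build Z_p padic_idomain.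

End PadicInt.

Definition padic (p : primeT) : fieldType := {fraction padic_int p}.

Definition in_Zp (p : primeT) (x : padic p) : Prop :=
  exists a : padic_int p, x = tofrac a.

Definition at_prime (T : Type) (x0 : T) (F : primeT -> T) (n : nat) : T :=
  oapp F x0 (insub n).

Definition mx22 (K : Type) (a b c d : K) : 'M[K]_2 :=
  \matrix_(i, j) if i == 0 then (if j == 0 then a else b)
                 else (if j == 0 then c else d).

Definition SL2Z (g : 'M[int]_2) : Prop := \det g = 1.
Definition Gamma0 (N : nat) (g : 'M[int]_2) : Prop :=
  SL2Z g /\ (N%:Z %| g 1%R 0%R)%Z.
Definition Gamma1 (N : nat) (g : 'M[int]_2) : Prop :=
  [/\ Gamma0 N g, (N%:Z %| (g 0 0 - 1)%R)%Z & (N%:Z %| (g 1 1 - 1)%R)%Z].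

Section Maass.
Variable R : realType.
Local Notation C := R[i].

Definition dirichlet_character (N : nat) (chi : int -> C) : Prop :=
  [/\ chi 1 = 1,
      forall m n, chi (m * n) = chi m * chi n,
      forall m, chi (m + N%:Z) = chi m
    & forall m, chi m != 0 <-> coprimez m N%:Z].

(* Functions on the upper half-plane are total functions on C; only their
   values at points of positive imaginary part are ever constrained or used. *)
Definition slash (k : int) (f : C -> C) (g : 'M[R]_2) (z : C) : C :=
  let j := (g 1 0)%:C * z + (g 1 1)%:C in
  (j / `|j|) ^ (- k) * f (((g 0 0)%:C * z + (g 0 1)%:C) / j).

Definition slashZ (k : int) (f : C -> C) (g : 'M[int]_2) : C -> C :=
  slash k f (map_mx intr g).

Definition dx (u : R -> R -> R) : R -> R -> R := fun x y => derive1 (u ^~ y) x.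
Definition dy (u : R -> R -> R) : R -> R -> R := fun x y => derive1 (u x) y.

Fixpoint smooth_upto (n : nat) (u : R -> R -> R) : Prop :=
  (forall x y, 0 < y -> {for (x, y), continuous (fun w : R * R => u w.1 w.2)})
  /\ if n is m.+1 then
       [/\ forall x y, 0 < y -> derivable (u ^~ y) x 1 /\ derivable (u x) y 1,
           smooth_upto m (dx u) & smooth_upto m (dy u)]
     else True.

Definition re_part (f : C -> C) : R -> R -> R := fun x y => complex.Re (f (x +i* y)).
Definition im_part (f : C -> C) : R -> R -> R := fun x y => complex.Im (f (x +i* y)).

Definition smooth (f : C -> C) : Prop :=
  forall n, smooth_upto n (re_part f) /\ smooth_upto n (im_part f).

Definition cdx (f : C -> C) : C -> C :=
  fun z => dx (re_part f) (complex.Re z) (complex.Im z) +i* dx (im_part f) (complex.Re z) (complex.Im z).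
Definition cdy (f : C -> C) : C -> C :=
  fun z => dy (re_part f) (complex.Re z) (complex.Im z) +i* dy (im_part f) (complex.Re z) (complex.Im z).

Definition laplacian (k : int) (f : C -> C) (z : C) : C :=
  let y := (complex.Im z)%:C in
  - y ^+ 2 * (cdx (cdx f) z + cdy (cdy f) z) + (0 +i* 1) * k%:~R * y * cdx f z.

Definition laplace_eigenfunction (k : int) (f : C -> C) : Prop :=
  [/\ smooth f,
      exists z, 0 < complex.Im z /\ f z != 0
    & exists lambda : C, forall z, 0 < complex.Im z -> laplacian k f z = lambda * f z].

Definition automorphic (k : int) (N : nat) (f : C -> C)
    (xi : 'M[int]_2 -> C) : Prop :=
  forall g z, Gamma0 N g -> 0 < complex.Im z -> slashZ k f g z = xi g * f z.

Definition Gamma0_character (N : nat) (xi : 'M[int]_2 -> C) : Prop :=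
  (forall g h, Gamma0 N g -> Gamma0 N h -> xi (g *m h) = xi g * xi h) /\
  (forall g, Gamma1 N g -> xi g = 1).

Definition has_automorphy_at (k : int) (f : C -> C) (N : nat) : Prop :=
  exists2 xi, Gamma0_character N xi & automorphic k N f xi.

Definition is_level (k : int) (f : C -> C) (N : nat) : Prop :=
  [/\ (0 < N)%N, has_automorphy_at k f N
    & forall M, (0 < M)%N -> has_automorphy_at k f M -> (N <= M)%N].

Definition maass_form (k : int) (N : nat) (chi : int -> C) (f : C -> C) : Prop :=
  [/\ automorphic k N f (fun g => chi (g 1 1)),
      laplace_eigenfunction k f
    & is_level k f N].

(* Elements of the full product R * prod_p Q_p, resp. of the product of the
   matrix rings; the restricted-product condition is imposed separately. *)
Definition adele : Type := (R * forall p : primeT, padic p)%type.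
Definition adele_mx : Type := ('M[R]_2 * forall p : primeT, 'M[padic p]_2)%type.

Definition GL2A (g : adele_mx) : Prop :=
  [/\ g.1 \in unitmx,
      forall p, g.2 p \in unitmx
    & exists B : nat, forall p : primeT, (B <= val p)%N ->
        exists2 k : 'M[padic_int p]_2, k \in unitmx & g.2 p = map_mx (@tofrac _) k].

Definition amul (g h : adele_mx) : adele_mx :=
  (g.1 *m h.1, fun p => g.2 p *m h.2 p).

Definition unip (u : adele) : adele_mx :=
  (mx22 1 u.1 0 1, fun p => mx22 1 (u.2 p) 0 1).

Definition diagQ (g : 'M[rat]_2) : adele_mx :=
  (map_mx ratr g, fun p => map_mx ratr g).

Definition K0 (N : nat) (k : forall p : primeT, 'M[padic_int p]_2) : Prop :=
  forall p, k p \in unitmx /\ exists t, k p 1 0 = N%:R * t.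

Definition decomp (g : 'M[R]_2) (k : forall p : primeT, 'M[padic_int p]_2) :
    adele_mx := (g, fun p => map_mx (@tofrac _) (k p)).

(* The function on GL(2, A) = GL(2, Q) GL(2, R)^+ K_0(N) given by
   gamma g_oo k |-> (f |_k g_oo)(i) chi(d mod N)^-1, where d is the lower right
   entry of k and n below is an integer in its class mod N; the inverse is what
   makes the value independent of the decomposition. *)
Definition adelic_lift (k : int) (N : nat) (chi : int -> C) (f : C -> C)
    (g : adele_mx) : C :=
  xget 0 [set w | exists (gam : 'M[rat]_2) (goo : 'M[R]_2)
      (kf : forall p : primeT, 'M[padic_int p]_2) (n : int),
    [/\ \det gam != 0 /\ 0 < \det goo,
        K0 N kf,
        forall p, exists t, kf p 1 1 - n%:~R = N%:R * t,
        g = amul (diagQ gam) (decomp goo kf)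
      & w = slash k f goo (0 +i* 1) * (chi n)^-1]]%classic.

Definition e2pi (x : R) : C := cos (2 * pi * x) +i* sin (2 * pi * x).

(* The standard character of A/Q: e^{2 pi i x} at the real place and
   e^{-2 pi i {x}_p} at p. If r is rational and u_p - r is in Z_p for all p,
   then r is congruent mod Z to the sum of the fractional parts {u_p}_p. *)
Definition psi (u : adele) : C :=
  e2pi (u.1 - ratr (xget (0 : rat)
    [set r : rat | forall p, in_Zp (u.2 p - ratr r)]%classic)).

(* The integral over Q\A for the Haar measure of total mass 1, computed on the
   fundamental domain [0, 1[ x prod_p Z_p; for continuous integrands the Haar
   integral over prod_p Z_p = lim Z/n!Z is the limit of the averages over
   0, ..., n! - 1. *)
Definition avg (Phi : adele -> C) (n : nat) (x : R) : C :=
  (n`!)%:R^-1 * \sum_(j < n`!) Phi (x, fun p => j%:R).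

Definition integral_QA (Phi : adele -> C) : C :=
  let I (part : C -> R) : R :=
    limn (fun n => Rintegral lebesgue_measure `[0, 1]%classic
                     (fun x => part (avg Phi n x))) in
  I (@complex.Re R) +i* I (@complex.Im R).

Definition whittaker (phi : adele_mx -> C) (g : adele_mx) : C :=
  integral_QA (fun u => phi (amul (unip u) g) * psi (- u.1, fun p => - u.2 p)).

(* w = Woo(g_oo) * prod_p W_p(g_p), the infinite product being the limit of the
   products over p < n. *)
Definition euler_product (Woo : 'M[R]_2 -> C)
    (W : forall p : primeT, 'M[padic p]_2 -> C) (g : adele_mx) (w : C) : Prop :=
  forall eps : R, 0 < eps -> exists n0 : nat, forall n, (n0 <= n)%N ->
    `|Woo g.1 * \prod_(i < n) at_prime 1 (fun p => W p (g.2 p)) i - w| < eps%:C.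

Definition vz (q : nat) (m : int) : nat := logn q `|m|%N.

Definition vQ (q : nat) (a : rat) : int := (vz q (numq a))%:Z - (vz q (denq a))%:Z.

(* The test on c is needed because logn q 0 = 0. Primes q with v_q(c) >= v_q(N)
   contribute nothing to the set of primes dividing N1, which is all that
   matters below. In the tests at the primes q dividing N, d = 0 is treated
   correctly as logn q N > 0. *)
Definition level_part (N : nat) (c d : int) : nat :=
  if c == 0 then 1%N else
  (\prod_(q <- primes N | ~~ [|| vz q c == logn q N, vz q d == logn q N
                              | (q == 2) && ((vz q c).+1 == logn q N)])
    q ^ (logn q N - vz q c))%N.

Definition Bfun (W : forall p : primeT, 'M[padic p]_2 -> C) (N1 : nat)
    (gam : 'M[int]_2) (alpha : rat) : C :=
  \prod_(q <- primes N1) at_prime 1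
    (fun p => W p (mx22 (ratr alpha) 0 0 1 *m map_mx intr (invmx gam))) q.

Definition multiplicative_Qstar (h : rat -> C) : Prop :=
  exists (hoo : int -> C) (hp : primeT -> int -> C) (B : nat),
    (forall p : primeT, (B <= val p)%N -> hp p 0 = 1) /\
    forall alpha : rat, alpha != 0 -> forall n : nat,
      (B <= n)%N -> (`|numq alpha| < n)%N -> (`|denq alpha| < n)%N ->
      h alpha = hoo (sgz alpha) *
        \prod_(i < n) at_prime 1 (fun p => hp p (vQ (val p) alpha)) i.

End Maass.

(* Main.v *)
Require Import Defs.
From HB Require Import structures.
From mathcomp Require Import all_boot all_order all_algebra.
From mathcomp Require Import complex.
From mathcomp Require Import all_classical all_reals all_analysis.
From mathcomp Require Import zify ring lra.
Import Order.TTheory GRing.Theory Num.Theory.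
Import numFieldNormedType.Exports.
Local Open Scope ring_scope.

Set Implicit Arguments.
Unset Strict Implicit.
Unset Printing Implicit Defensive.

(* The nonconstant Fourier coefficients of f|gam are values of the global Whittaker
   function, so they factor over the places. Multiplicativity of B, applied to an
   integer that is -1 modulo a power of q and 1 modulo powers of the other primes
   dividing N1, makes them proportional to those of f|del gam, where del in SL2(Z)
   is close to gam diag(-1,1) gam^-1 at q (up to K_0) and lies in Gamma_1 at the
   other primes. A combination h of f|del and f such that h|gam has no nonconstant
   coefficient is invariant under a congruence subgroup and under a conjugate of all
   real translations, hence under SL2(R). So, modulo invariant functions, f is an
   eigenfunction of del, or equivalently of a lower unipotent matrix whose entry
   generates the ideal (2cd) at q. Conjugation by elements of Gamma_0(N), and in the
   boundary cases a relation between upper and lower unipotents, make some bounded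
   power of the eigenvalue trivial; then f is automorphic at a level whose q-part
   exceeds 2cd only by that bound, and minimality of N concludes. *)

(** * Matrices and p-adic numbers *)

(** No cuspidality or growth is assumed, and the Whittaker function says nothing about constant
    terms. Eigenvalue relations are therefore carried modulo [SL2Z_invariant] functions, and an
    eigenvalue 1 is afterwards upgraded to exact invariance. The unit -1 is chosen at q because
    conjugating diag(u, 1) by [gam] gives the lower-left entry (u - 1)cd, and u - 1 = -2 has the
    least valuation that a unit u allows at any prime; the factor 2 in M comes from here.
    Conjugation by an element of Gamma_0(N) with lower-right entry D modulo q^n shows a^(D^2) = a
    for the eigenvalue a, so its order divides D^2 - 1 for every D prime to q: 3 for D = 2, 8 for D
    = 3. The order is also a power of q, which leaves 1 for q > 3, 3 for q = 3 and 8 for q = 2. The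
    boundary cases use the braid relation when v_q(M) = 0 and an element of trace 0 when v_2(M) = 1.
    Local Whittaker values may vanish, so all relations between them are cross-multiplied. *)

Lemma mx22E (K : Type) (a b c d : K) :
  (mx22 a b c d 0 0 = a) * (mx22 a b c d 0 1 = b) *
  (mx22 a b c d 1 0 = c) * (mx22 a b c d 1 1 = d).
Proof. by rewrite /mx22 !mxE. Qed.

Lemma mx22_eta (K : Type) (g : 'M[K]_2) :
  g = mx22 (g 0 0) (g 0 1) (g 1 0) (g 1 1).
Proof.
apply/matrixP => i j; case: i => [[|[|i]] Hi] //; case: j => [[|[|j]] Hj] //;
  rewrite mxE /=; congr (g _ _); exact: val_inj.
Qed.

Lemma ord2P (P : 'I_2 -> Prop) : P 0 -> P 1 -> forall i, P i.
Proof.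
move=> P0 P1 [[|[|i]] Hi] //.
- by rewrite (_ : Ordinal Hi = 0) //; exact: val_inj.
- by rewrite (_ : Ordinal Hi = 1) //; exact: val_inj.
Qed.

Lemma mx22_mul (K : pzSemiRingType) (a b c d a' b' c' d' : K) :
  mx22 a b c d *m mx22 a' b' c' d' =
  mx22 (a * a' + b * c') (a * b' + b * d') (c * a' + d * c') (c * b' + d * d').
Proof.
by apply/matrixP; do 2 apply: ord2P; rewrite !mxE !big_ord_recl big_ord0 /= !mxE /= addr0.
Qed.

Lemma mulmx2E (K : pzSemiRingType) (g h : 'M[K]_2) i j :
  (g *m h) i j = g i 0 * h 0 j + g i 1 * h 1 j.
Proof.
by rewrite mxE !big_ord_recl big_ord0 addr0 (_ : lift ord0 ord0 = 1) //; exact: val_inj.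
Qed.

Lemma mx22_det (K : comPzRingType) (a b c d : K) :
  \det (mx22 a b c d) = a * d - b * c.
Proof.
by rewrite (expand_det_row _ 0) !big_ord_recl big_ord0 /cofactor !det_mx11 !mxE /=
  /bump /= !expr0 !expr1; ring.
Qed.

Lemma mx22_map (K L : Type) (f : K -> L) (a b c d : K) :
  map_mx f (mx22 a b c d) = mx22 (f a) (f b) (f c) (f d).
Proof. by apply/matrixP; do 2 apply: ord2P; rewrite !mxE. Qed.

Lemma mx22_1 (K : pzSemiRingType) : (1%:M : 'M[K]_2) = mx22 1 0 0 1.
Proof. by apply/matrixP; do 2 apply: ord2P; rewrite !mxE. Qed.

Lemma mx22_inj (K : Type) (a b c d a' b' c' d' : K) :
  a = a' -> b = b' -> c = c' -> d = d' -> mx22 a b c d = mx22 a' b' c' d'.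
Proof. by move=> -> -> -> ->. Qed.

Lemma mx22_inv (K : comUnitRingType) (a b c d : K) :
  a * d - b * c = 1 -> invmx (mx22 a b c d) = mx22 d (- b) (- c) a.
Proof.
move=> h; have hM : mx22 a b c d *m mx22 d (- b) (- c) a = 1%:M.
  by rewrite mx22_mul mx22_1; apply: mx22_inj; rewrite -?h; ring.
have [u _] := mulmx1_unit hM.
by rewrite -[LHS]mulmx1 -hM mulmxA mulVmx // mul1mx.
Qed.

(** * Integers and rationals inside the p-adic numbers *)

Section Padic.
Variable p : primeT.
Local Notation pn n := ((val p ^ n)%N%:Z).
Local Notation Z_p := (padic_int p).
Local Notation Q_p := (padic p).
Local Notation pgt0 := (prime_gt0 (valP p)).

Lemma residue_int (a : int) n : (a%:~R : Z_p) n = (a %% pn n)%Z.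
Proof.
have hnat (m : nat) : (m%:R : Z_p) n = (m %% pn n)%Z.
  elim: m => [|m IHm] //.
  by rewrite -addn1 natrD /= IHm modzDm -PoszD addn1.
case: a => m; first by rewrite -pmulrn hnat.
by rewrite NegzE mulrNz /= -pmulrn hnat modzNm.
Qed.

Lemma padic_int_inj : injective (fun a : int => a%:~R : Z_p).
Proof.
suff h (a : int) : (a%:~R : Z_p) = 0 -> a = 0.
  by move=> a b /eqP; rewrite -subr_eq0 -intrB => /eqP/h/eqP; rewrite subr_eq0 => /eqP.
move=> /(congr1 (fun z : Z_p => z `|a|%N)); rewrite residue_int /= mod0z.
move/dvdz_mod0P; rewrite dvdzE /= => h.
apply/eqP; rewrite -absz_eq0; apply: contraT; rewrite -lt0n => a0.
have := dvdn_leq a0 h; rewrite leqNgt ltn_expl //; exact: prime_gt1 (valP p).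
Qed.

Lemma padic_int_dvd (a : int) (t : Z_p) : a%:~R = (val p)%:R * t ->
  (val p %| `|a|)%N.
Proof.
move=> /(congr1 (fun z : Z_p => z 1%N)).
rewrite residue_int /= -[(val p)%:R]/((val p)%:Z%:~R) residue_int expn1 modzz mul0r mod0z.
by move/dvdz_mod0P.
Qed.

(** The inverse is assembled from the Bezout coefficients [u n] of a modulo p^n; they are coherent
    because an inverse modulo p^n is unique modulo p^n. *)
Lemma coprime_unit (a : nat) : coprime a (val p) -> (a%:R : Z_p) \is a GRing.unit.
Proof.
move=> co; pose u n := (egcdz a%:Z (pn n)).1.
have hu n : (u n * a%:Z = 1 %[mod pn n])%Z.
  have [c [hb hc]] : exists c, gcdz a%:Z (pn n) = 1 /\ u n * a%:Z + c * pn n = 1.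
    rewrite /u; case: egcdzP => u' v e _; exists v.
    have g1 : gcdz a%:Z (pn n) = 1.
      by rewrite /gcdz /=; congr Posz; apply/eqP; apply: coprimeXr.
    by rewrite e g1.
  by rewrite -[X in (_ = X %[mod _])%Z]hc -modzDmr modzMl addr0.
have uP n : (u n.+1 = u n %[mod pn n])%Z.
  have h1 : (u n.+1 * a%:Z = 1 %[mod pn n])%Z.
    by rewrite -modz_pnS hu modz_pnS.
  have : ((u n.+1 - u n) * a%:Z = 0 %[mod pn n])%Z.
    by rewrite mulrBl -modzDm h1 -modzNm hu modzNm modzDm subrr.
  rewrite mod0z => /dvdz_mod0P; rewrite Gauss_dvdzl.
    by rewrite -eqz_mod_dvd => /eqP.
  by rewrite coprimezE /= coprime_sym coprimeXr.
apply/unitrPr; exists (mk_padic uP); apply: padic_int_ext => n /=.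
by rewrite -[a%:R]/(a%:Z%:~R) residue_int modzMm mulrC hu.
Qed.

Lemma coprime_unitz (a : int) : coprime `|a| (val p) -> (a%:~R : Z_p) \is a GRing.unit.
Proof.
by case: a => a h; rewrite ?NegzE ?mulrNz ?unitrN -pmulrn; apply: coprime_unit.
Qed.

Lemma intr_padic (a : int) : (tofrac (a%:~R : Z_p) : Q_p) = a%:~R.
Proof. by rewrite rmorph_int. Qed.

Lemma intr_padic_eq0 (a : int) : ((a%:~R : Q_p) == 0) = (a == 0).
Proof.
rewrite -intr_padic tofrac_eq0; apply/eqP/eqP => [h|->]; last by rewrite mulr0z.
by apply: padic_int_inj; rewrite h.
Qed.

(** A name of its own for [ratr] into Q_p, to which a ring morphism structure is attached below; the
    morphism laws are checked after clearing denominators, which stay nonzero in Q_p. *)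
Definition rat_padic (x : rat) : Q_p := ratr x.

Lemma rat_padic_num_den (x : rat) : rat_padic x * (denq x)%:~R = (numq x)%:~R.
Proof. by rewrite divfK // intr_padic_eq0 denq_neq0. Qed.

Fact rat_padic_is_zmod_morphism : zmod_morphism rat_padic.
Proof.
have nz_den x : (denq x)%:~R != 0 :> Q_p by rewrite intr_padic_eq0 denq_neq0.
move=> x y; apply: (mulIf (nz_den (x - y))); apply: (mulIf (nz_den x)).
apply: (mulIf (nz_den y)); rewrite rat_padic_num_den.
rewrite [RHS](_ : _ = (rat_padic x * (denq x)%:~R * (denq y)%:~R
   - rat_padic y * (denq y)%:~R * (denq x)%:~R) * (denq (x - y))%:~R); last by ring.
rewrite !rat_padic_num_den -!(intrM, intrB); congr _%:~R.
apply: (@intr_inj rat); rewrite !(rmorphM, rmorphB) /= !numqE; ring.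
Qed.

Fact rat_padic_is_monoid_morphism : monoid_morphism rat_padic.
Proof.
have nz_den x : (denq x)%:~R != 0 :> Q_p by rewrite intr_padic_eq0 denq_neq0.
split=> [|x y]; first by rewrite /rat_padic /ratr divr1.
apply: (mulIf (nz_den (x * y))); apply: (mulIf (nz_den x)).
apply: (mulIf (nz_den y)); rewrite rat_padic_num_den.
rewrite [RHS](_ : _ = (rat_padic x * (denq x)%:~R) * (rat_padic y * (denq y)%:~R)
    * (denq (x * y))%:~R); last by ring.
rewrite !rat_padic_num_den -!intrM; congr _%:~R.
apply: (@intr_inj rat); rewrite !rmorphM /= !numqE; ring.
Qed.

HB.instance Definition _ := GRing.isZmodMorphism.Build rat Q_p rat_padic
  rat_padic_is_zmod_morphism.
HB.instance Definition _ := GRing.isMonoidMorphism.Build rat Q_p rat_padic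
  rat_padic_is_monoid_morphism.

Lemma in_Zp_denq (r : rat) : in_Zp (rat_padic r) -> ~~ (val p %| `|denq r|)%N.
Proof.
case=> a ha; apply/negP => /dvdnP[m hm].
have : (tofrac (numq r)%:~R : Q_p) = tofrac ((denq r)%:~R * a).
  by rewrite rmorphM /= !intr_padic -ha mulrC rat_padic_num_den.
move=> /eqP; rewrite tofrac_eq => /eqP.
have -> : denq r = m%:Z * (val p)%:Z by rewrite -PoszM -hm absz_denq.
rewrite intrM [m%:~R * _]mulrC -mulrA => /padic_int_dvd hn.
have := coprime_num_den r; rewrite /coprime => /eqP hc.
have : (val p %| 1)%N by rewrite -hc dvdn_gcd hn hm dvdn_mull.
by rewrite dvdn1 => /eqP hp; have := valP p; rewrite hp.
Qed.

Lemma rat_padic_unit (r : rat) : coprime `|numq r| (val p) -> coprime `|denq r| (val p) ->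
  exists2 u : Z_p, u \is a GRing.unit & rat_padic r = tofrac u.
Proof.
move=> /coprime_unitz hn /coprime_unitz hd.
exists ((numq r)%:~R / (denq r)%:~R); first by rewrite unitrM hn unitrV.
by rewrite /rat_padic /ratr -!intr_padic -rmorphV // -rmorphM.
Qed.

End Padic.

(** A prime dividing the denominator would put r outside Z_p for that prime. Global integrality is
    recovered from local data in this way. *)
Lemma rat_int_padic (r : rat) : (forall p, in_Zp (rat_padic p r)) -> exists m : int, r = m%:~R.
Proof.
move=> h; exists (numq r); rewrite -[LHS]divq_num_den.
suff -> : denq r = 1 by rewrite divr1.
have d1 : `|denq r|%N = 1%N.
  apply/eqP; apply: contraT => d1.
  have d2 : (1 < `|denq r|)%N by rewrite ltn_neqAle eq_sym d1 absz_gt0 denq_neq0.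
  have := in_Zp_denq (h (exist _ (pdiv `|denq r|) (pdiv_prime d2))).
  by rewrite /= pdiv_dvd.
by rewrite -absz_denq d1.
Qed.

(** * The slash action *)

Section Slash.
Variables (R : realType) (k : int).
Local Notation C := R[i].
Implicit Types (f h : C -> C) (z : C).

Definition autj (g : 'M[R]_2) z : C := (g 1 0)%:C%C * z + (g 1 1)%:C%C.
Definition moebius (g : 'M[R]_2) z : C :=
  ((g 0 0)%:C%C * z + (g 0 1)%:C%C) / autj g z.

Lemma slashE f g z :
  slash k f g z = (autj g z / `|autj g z|) ^ (- k) * f (moebius g z).
Proof. by []. Qed.

Lemma autj_neq0 g z : \det g != 0 -> 0 < complex.Im z -> autj g z != 0.
Proof.
rewrite (mx22_eta g) mx22_det /autj !mx22E => dg; case: z => x y /= y0.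
apply/eqP => /eqP; rewrite eq_complex /= => /andP[/eqP h1 /eqP h2].
have {h2} c0 : g 1 0 = 0.
  by apply: (mulIf (lt0r_neq0 y0)); rewrite mul0r -[RHS]h2; ring.
move: h1; rewrite c0 !mul0r subr0 add0r => d0.
by move: dg; rewrite c0 d0 !mulr0 subrr eqxx.
Qed.

Lemma moebius_Im g z : 0 < \det g -> 0 < complex.Im z -> 0 < complex.Im (moebius g z).
Proof.
move=> dg y0; have := autj_neq0 (lt0r_neq0 dg) y0; move: dg y0.
rewrite /moebius /autj (mx22_eta g) mx22_det !mx22E; case: z => x y /= dg y0.
rewrite eq_complex /= !mul0r !subr0 !addr0 => jn0.
set c := g 1 0 in jn0 dg *; set d := g 1 1 in jn0 dg *.
set a := g 0 0 in jn0 dg *; set b := g 0 1 in jn0 dg *.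
have n0 : 0 < (c * x + d) ^+ 2 + (c * y) ^+ 2.
  move: jn0; rewrite negb_and => /orP[] h.
    by rewrite ltr_pwDl ?sqr_ge0 // exprn_even_gt0.
  by rewrite ltr_wpDl ?sqr_ge0 // exprn_even_gt0.
rewrite (_ : _ + _ = (a * d - b * c) * y / ((c * x + d) ^+ 2 + (c * y) ^+ 2)).
  by rewrite divr_gt0 // mulr_gt0.
by field; rewrite lt0r_neq0.
Qed.

Lemma slash_mul f g g' z : 0 < \det g -> 0 < \det g' -> 0 < complex.Im z ->
  slash k f (g *m g') z = slash k (slash k f g) g' z.
Proof.
move=> dg dg' y0.
have j' := autj_neq0 (lt0r_neq0 dg') y0.
have j := autj_neq0 (lt0r_neq0 dg) (moebius_Im dg' y0).
have e1 : autj (g *m g') z = autj g (moebius g' z) * autj g' z.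
  move: j'; rewrite /moebius /autj !mulmx2E => j'.
  rewrite !(rmorphD, rmorphM) /=; field; exact: j'.
have e2 : moebius (g *m g') z = moebius g (moebius g' z).
  move: j j'; rewrite /(moebius (g *m g')) /(moebius g) e1 => j j'.
  have -> : ((g *m g') 0 0)%:C%C * z + ((g *m g') 0 1)%:C%C =
     ((g 0 0)%:C%C * moebius g' z + (g 0 1)%:C%C) * autj g' z.
    rewrite /moebius; move: j'; rewrite /autj.
    rewrite !mulmx2E => j'.
    rewrite !(rmorphD, rmorphM) /=; field; exact: j'.
  by field; rewrite j j'.
rewrite !slashE e1 e2 normrM invfM mulrACA expfzMl; ring.
Qed.

Lemma slash_ext f h g z : 0 < \det g -> 0 < complex.Im z ->
  (forall w, 0 < complex.Im w -> f w = h w) -> slash k f g z = slash k h g z.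
Proof. by move=> dg y0 fh; rewrite !slashE fh // moebius_Im. Qed.

Lemma slash_lin f h (a b : C) g z :
  slash k (fun w => a * f w + b * h w) g z = a * slash k f g z + b * slash k h g z.
Proof. by rewrite !slashE; ring. Qed.

Lemma slash_unip f (x y : R) (t : R) : 
  slash k f (mx22 y t 0 1) (x +i* 1)%C = f ((y * x + t) +i* y)%C.
Proof.
rewrite slashE /moebius /autj !mx22E.
rewrite rmorph0 mul0r add0r rmorph1 normr1 divr1 exp1rz mul1r divr1.
by congr f; simpc.
Qed.

Lemma Im_addint z (a : int) : complex.Im (z + a%:~R) = complex.Im z.
Proof. by rewrite -(rmorph_int (real_complex R)); case: z => x y; rewrite /= addr0. Qed.

End Slash.

(** * Modular forms modulo invariant functions *)

Section Classical.
Variables (R : realType) (k : int).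
Local Notation C := R[i].
Implicit Types (f h u v : C -> C) (z : C).

Definition low (s : int) : 'M[int]_2 := mx22 1 0 s 1.
Definition upp (x : int) : 'M[int]_2 := mx22 1 x 0 1.

Lemma SL2Z_low s : SL2Z (low s).
Proof. by rewrite /SL2Z mx22_det; ring. Qed.

Lemma SL2Z_upp s : SL2Z (upp s).
Proof. by rewrite /SL2Z mx22_det; ring. Qed.

Lemma SL2Z_mul g g' : SL2Z g -> SL2Z g' -> SL2Z (g *m g').
Proof. by rewrite /SL2Z det_mulmx => -> ->. Qed.

Lemma SL2ZE (g : 'M[int]_2) : SL2Z g <-> g 0 0 * g 1 1 - g 0 1 * g 1 0 = 1.
Proof. by rewrite /SL2Z {1}(mx22_eta g) mx22_det. Qed.

Lemma SL2Z_det (g : 'M[int]_2) : SL2Z g -> 0 < \det (map_mx intr g : 'M[R]_2).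
Proof. by rewrite det_map_mx => ->. Qed.

Lemma low_mul s t : low s *m low t = low (s + t).
Proof. by rewrite mx22_mul; apply: mx22_inj; ring. Qed.

Lemma slashZ_mul f g g' z : SL2Z g -> SL2Z g' -> 0 < complex.Im z ->
  slashZ k f (g *m g') z = slashZ k (slashZ k f g) g' z.
Proof. by move=> sg sg' y0; rewrite /slashZ map_mxM slash_mul // SL2Z_det. Qed.

Lemma slashZ_ext f h g z : SL2Z g -> 0 < complex.Im z ->
  (forall w, 0 < complex.Im w -> f w = h w) -> slashZ k f g z = slashZ k h g z.
Proof. by move=> sg; apply: slash_ext; apply: SL2Z_det. Qed.

Lemma slashZ_lin f h (a b : C) g z :
  slashZ k (fun w => a * f w + b * h w) g z = a * slashZ k f g z + b * slashZ k h g z.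
Proof. exact: slash_lin. Qed.

Lemma slashZ_upp f x z : slashZ k f (upp x) z = f (z + x%:~R).
Proof.
rewrite /slashZ mx22_map slashE /moebius /autj !mx22E.
rewrite !rmorph0 !rmorph1 mul0r add0r normr1 divr1 exp1rz !mul1r divr1.
by rewrite rmorph_int.
Qed.

Lemma slashZ_low0 f z : slashZ k f (low 0) z = f z.
Proof. by rewrite -[low 0]/(upp 0) slashZ_upp addr0. Qed.

Definition SL2Z_invariant h := forall g, SL2Z g -> forall z, 0 < complex.Im z ->
  slashZ k h g z = h z.

Lemma invariant_ext u v : (forall z, 0 < complex.Im z -> u z = v z) ->
  SL2Z_invariant u -> SL2Z_invariant v.
Proof.
move=> uv iu g sg z y0; rewrite -uv // -(iu g sg z y0).
by apply: slashZ_ext => // w w0; rewrite uv.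
Qed.

Lemma invariant_lin u v (a b : C) : SL2Z_invariant u -> SL2Z_invariant v ->
  SL2Z_invariant (fun z => a * u z + b * v z).
Proof. by move=> iu iv g sg z y0; rewrite slashZ_lin iu // iv. Qed.

Lemma invariant_scale u (a : C) : a != 0 -> SL2Z_invariant (fun z => a * u z) ->
  SL2Z_invariant u.
Proof.
move=> a0 iu; apply: (@invariant_ext (fun z => a^-1 * (a * u z) + 0 * (a * u z))).
  by move=> z _; rewrite mul0r addr0 mulKf.
exact: invariant_lin.
Qed.

Variables (N : nat) (chi : int -> C) (f : C -> C) (z0 : C).
Hypothesis N0 : (0 < N)%N.
Hypothesis hchi : dirichlet_character N chi.
Hypothesis hf : automorphic k N f (fun g => chi (g 1 1)).
Hypothesis z00 : 0 < complex.Im z0.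
Hypothesis fz0 : f z0 != 0.
Hypothesis hlev : is_level k f N.

Lemma chi_cong m n : (N%:Z %| m - n)%Z -> chi m = chi n.
Proof.
have [_ _ per _] := hchi.
have pern (j : nat) i : chi (i + j%:Z * N%:Z) = chi i.
  elim: j i => [|j IHj] i; first by rewrite mul0r addr0.
  by rewrite -addn1 PoszD mulrDl mul1r addrA per.
case/dvdzP => a e; have -> : m = n + a * N%:Z by rewrite -e; ring.
case: a {e} => a; first exact: pern.
rewrite -[LHS](pern a.+1); congr chi; rewrite NegzE; ring.
Qed.

Lemma chi1 : chi 1 = 1. Proof. by case: hchi. Qed.

Lemma slash_Gamma0 g z : SL2Z g -> (N%:Z %| g 1%R 0%R)%Z -> 0 < complex.Im z ->
  slashZ k f g z = chi (g 1 1) * f z.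
Proof. by move=> sg dv; apply: hf. Qed.

(** When the lower rows agree modulo N, the matrix [e] = g g'^-1 lies in Gamma_1(N). Later matrix
    identities are therefore checked on lower rows only. *)
Lemma slash_cong g g' z : SL2Z g -> SL2Z g' ->
  (N%:Z %| g 1%R 0%R - g' 1%R 0%R)%Z -> (N%:Z %| g 1%R 1%R - g' 1%R 1%R)%Z ->
  0 < complex.Im z -> slashZ k f g z = slashZ k f g' z.
Proof.
move=> sg sg' /dvdzP[a ea] /dvdzP[b eb] y0.
pose e := g *m mx22 (g' 1 1) (- g' 0 1) (- g' 1 0) (g' 0 0).
have dg' := (SL2ZE g').1 sg'.
have eg : g = e *m g'.
  rewrite /e -mulmxA (_ : _ *m g' = 1%:M) ?mulmx1 //.
  rewrite [X in _ *m X](mx22_eta g') mx22_mul mx22_1.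
  by apply: mx22_inj; rewrite -?dg'; ring.
have se : SL2Z e.
  by apply: SL2Z_mul => //; rewrite /SL2Z mx22_det -dg'; ring.
have e10 : e 1 0 = (a * g' 1 1 - b * g' 1 0) * N%:Z.
  rewrite /e mulmx2E !mx22E.
  rewrite [RHS](_ : _ = (a * N%:Z) * g' 1 1 - (b * N%:Z) * g' 1 0); last by ring.
  by rewrite -ea -eb; ring.
have e11 : e 1 1 - 1 = (b * g' 0 0 - a * g' 0 1) * N%:Z.
  rewrite /e mulmx2E !mx22E.
  rewrite [RHS](_ : _ = (b * N%:Z) * g' 0 0 - (a * N%:Z) * g' 0 1); last by ring.
  by rewrite -ea -eb -dg'; ring.
rewrite [in LHS]eg slashZ_mul //; apply: slashZ_ext => // w w0.
rewrite slash_Gamma0 //; last by rewrite e10 dvdz_mull.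
by rewrite (@chi_cong _ 1) ?e11 ?dvdz_mull // chi1 mul1r.
Qed.

(** An invariant f is automorphic at level 1 with trivial character. Hence [ninv] below is available
    as soon as some prime divides N. *)
Lemma invariant_level1 : SL2Z_invariant f -> N = 1%N.
Proof.
move=> hi; have [_ _ hmin] := hlev; apply/eqP; rewrite eqn_leq N0 andbT.
apply: hmin => //; exists (fun=> 1); first by split=> // *; rewrite mulr1.
by move=> g z [sg _] y0; rewrite mul1r hi.
Qed.

(* [f|g] is proportional to [f] modulo the invariant functions; a Fourier
   expansion determines [f] only up to such functions. *)
Definition eigen_mod g (a : C) := SL2Z_invariant (fun z => slashZ k f g z - a * f z).

(** From f|gg' - ab f = (f|g - a f)|g' + a (f|g' - b f), where the first term is invariant and so
    unaffected by g'. *)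
Lemma eigen_mod_mul g g' a b : SL2Z g -> SL2Z g' ->
  eigen_mod g a -> eigen_mod g' b -> eigen_mod (g *m g') (a * b).
Proof.
move=> sg sg' ig ig'.
apply: (@invariant_ext (fun z => 1 * (slashZ k f g z - a * f z) +
          a * (slashZ k f g' z - b * f z))); last exact: invariant_lin.
move=> z y0 /=; rewrite slashZ_mul // -(ig g' sg' z y0).
rewrite [slashZ k (fun _ => _ - _) _ _](_ : _ =
    slashZ k (fun w => 1 * slashZ k f g w + (- a) * f w) g' z).
  by rewrite slashZ_lin; ring.
by apply: slashZ_ext => // w _; ring.
Qed.

(** Subtracting the two relations leaves (a - b) f. *)
Lemma eigen_mod_uniq g a b : ~ SL2Z_invariant f ->
  eigen_mod g a -> eigen_mod g b -> a = b.
Proof.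
move=> nf ia ib; apply/eqP; rewrite -subr_eq0; apply: contraT => ab.
case: nf; apply: (invariant_scale ab).
apply: (@invariant_ext (fun z => 1 * (slashZ k f g z - b * f z) +
          (-1) * (slashZ k f g z - a * f z))); last exact: invariant_lin.
by move=> z _; ring.
Qed.

Lemma eigen_mod_cong g g' a : SL2Z g -> SL2Z g' ->
  (N%:Z %| g 1%R 0%R - g' 1%R 0%R)%Z -> (N%:Z %| g 1%R 1%R - g' 1%R 1%R)%Z ->
  eigen_mod g a -> eigen_mod g' a.
Proof.
move=> sg sg' h0 h1; apply: invariant_ext => z y0.
by rewrite (slash_cong sg sg' h0 h1).
Qed.

Lemma eigen_mod_exact g a : (forall z, 0 < complex.Im z -> slashZ k f g z = a * f z) ->
  eigen_mod g a.
Proof.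
move=> h; apply: (@invariant_ext (fun=> 0)) => [z y0|g' sg' z y0].
  by rewrite h // subrr.
by rewrite /slashZ slashE mulr0.
Qed.

Lemma eigen_mod_Gamma0 g : SL2Z g -> (N%:Z %| g 1%R 0%R)%Z -> eigen_mod g (chi (g 1 1)).
Proof. by move=> sg dv; apply: eigen_mod_exact => z y0; rewrite slash_Gamma0. Qed.

Lemma eigen_mod_upp x : eigen_mod (upp x) 1.
Proof.
have := @eigen_mod_Gamma0 (upp x) (SL2Z_upp x).
by rewrite !mx22E chi1; apply; rewrite dvdz0.
Qed.

Lemma eigen_mod_pow s a t : eigen_mod (low s) a -> eigen_mod (low (s * t%:Z)) (a ^+ t).
Proof.
move=> h; elim: t => [|t IHt].
  rewrite mulr0 expr0; exact: eigen_mod_upp 0.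
rewrite exprS (_ : s * _ = s + s * t%:Z); last by rewrite -addn1 PoszD; ring.
by rewrite -low_mul; apply: eigen_mod_mul => //; apply: SL2Z_low.
Qed.

(** The error h = f|low s - f is itself invariant, so iterating gives f|low(st) = f + t h. At t = N
    the left side is f, whence N h = 0. *)
Lemma eigen_mod_low1 s : eigen_mod (low s) 1 ->
  forall z, 0 < complex.Im z -> slashZ k f (low s) z = f z.
Proof.
move=> hi; pose h z := slashZ k f (low s) z - 1 * f z.
have step t z : 0 < complex.Im z ->
    slashZ k f (low (s * t%:Z)) z = 1 * f z + t%:R * h z.
  elim: t z => [|t IHt] z y0; first by rewrite mulr0 slashZ_low0 mul0r addr0 mul1r.
  rewrite (_ : s * _ = s * t%:Z + s); last by rewrite -addn1 PoszD; ring.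
  rewrite -low_mul slashZ_mul //; try exact: SL2Z_low.
  rewrite (slashZ_ext (SL2Z_low s) y0 IHt) slashZ_lin hi; last 2 first.
  - exact: SL2Z_low.
  - exact: y0.
  by rewrite -addn1 natrD /h; ring.
move=> z y0; have := step N z y0.
rewrite (@slash_cong _ (low 0)) //; try exact: SL2Z_low; last 2 first.
- by rewrite !mx22E subr0 dvdz_mull.
- by rewrite !mx22E subrr.
rewrite slashZ_low0 mul1r => /eqP; rewrite -subr_eq0 opprD addrA subrr add0r oppr_eq0.
by rewrite mulf_eq0 pnatr_eq0 eqn0Ngt N0 /= => /eqP /subr0_eq ->; rewrite mul1r.
Qed.

(** * Eigenvalues of lower unipotents and the minimality of N *)

Hypothesis ninv : ~ SL2Z_invariant f.
Variables (q n N' : nat).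
Hypothesis q_prime : prime q.
Hypothesis N'q : coprime N' q.
Hypothesis NE : N = (q ^ n * N')%N.
Local Notation T := (q ^ n)%N.

Lemma slash_low_int s : (forall z, 0 < complex.Im z -> slashZ k f (low s) z = f z) ->
  forall (t : int) z, 0 < complex.Im z -> slashZ k f (low (s * t)) z = f z.
Proof.
move=> hs; have hi : eigen_mod (low s) 1.
  by apply: eigen_mod_exact => z y0; rewrite hs // mul1r.
(* Only natural powers are available, so t is replaced by its residue modulo N; [low (s * t)] acts
   through st modulo N. *)
move=> t z y0; have N00 : N%:Z != 0 by rewrite eqz_nat -lt0n.
have /gez0_abs et := modz_ge0 t N00.
have := eigen_mod_pow `|(t %% N)%Z|%N hi; rewrite expr1n et => /eigen_mod_low1 <- //.
apply: slash_cong => //; try exact: SL2Z_low; rewrite !mx22E ?subrr //.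
rewrite -mulrBr dvdz_mull // {1}(divz_eq t N) addrK dvdz_mull //.
Qed.

(** With M = gcd(s, N), every element of Gamma_0(M) is brought into Gamma_0(N) by an upper unipotent
    and a power of [low s], all of which fix f. So f is automorphic at level M, provided that the
    resulting character is trivial on Gamma_1(M), and minimality gives N = M. *)
Lemma level_low s : (N'%:Z %| s)%Z ->
  (forall z, 0 < complex.Im z -> slashZ k f (low s) z = f z) -> (N%:Z %| s)%Z.
Proof.
move=> N's hs; have hst := slash_low_int hs.
pose M := gcdz s N; have M0 : 0 < M.
  by rewrite /M /gcdz ltz_nat gcdn_gt0 orbC N0.
have [u [v]] := Bezoutz s N; rewrite -/M => euv.
have inverse (d : int) : coprimez d N -> exists e w, e * d + w * N%:Z = 1.
  by move=> /coprimezP[[e w] /= h]; exists e, w.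
have N'M : (N'%:Z %| M)%Z by rewrite dvdz_gcd N's NE PoszM dvdz_mull.
have char_triv (d : int) : coprimez d N -> (M %| d - 1)%Z -> chi d = 1.
  move=> cd /dvdzP[m em]; have [e [w ew]] := inverse d cd.
  (* Modulo N these are y' = d - 1 and y = -y'/d, so G has lower row (0, d). It is a product of
     matrices that fix f, yet as an element of Gamma_0(N) it acts by chi(d). *)
  pose y' := s * (m * u); pose y := s * (- m * u * e).
  have ey' : d - (1 + y') = m * v * N%:Z.
    by rewrite opprD addrA em /y' -euv; ring.
  pose G := low y' *m (upp 1 *m low y).
  have sG : SL2Z G.
    by do !apply: SL2Z_mul; (apply: SL2Z_low || apply: SL2Z_upp).
  have G1 : (G 1 0 = y' * (1 + y) + y) * (G 1 1 = 1 + y').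
    by rewrite /G !mulmx2E !mx22E; split; ring.
  have fG z : 0 < complex.Im z -> slashZ k f G z = f z.
    move=> y0; rewrite /G slashZ_mul //; first last.
    - by apply: SL2Z_mul; [exact: SL2Z_upp | exact: SL2Z_low].
    - exact: SL2Z_low.
    have -> : slashZ k (slashZ k f (low y')) (upp 1 *m low y) z = slashZ k f (upp 1 *m low y) z.
      apply: slashZ_ext => //; last exact: hst.
      by apply: SL2Z_mul; [exact: SL2Z_upp | exact: SL2Z_low].
    rewrite slashZ_mul //; try by [exact: SL2Z_low | exact: SL2Z_upp].
    have -> : slashZ k (slashZ k f (upp 1)) (low y) z = slashZ k f (low y) z.
      apply: slashZ_ext => //; first exact: SL2Z_low.
      move=> w' w0; rewrite slash_Gamma0 //; last by rewrite mx22E dvdz0.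
        by rewrite mx22E chi1 mul1r.
      exact: SL2Z_upp.
    exact: hst.
  have dG : (N%:Z %| G 1%R 0%R)%Z.
    rewrite G1; apply/dvdzP; exists (s * m * u * w + s * m * u * e * m * v).
    have -> : y' * (1 + y) + y = y' + y * d - y * (d - (1 + y')) by ring.
    rewrite ey' [LHS](_ : _ = s * m * u * (1 - e * d) - y * (m * v * N%:Z)).
      by rewrite (_ : 1 - e * d = w * N%:Z) -?[X in X - _]ew /y; ring.
    by rewrite /y /y'; ring.
  have := fG z0 z00; rewrite slash_Gamma0 // G1 => /(canRL (mulfK fz0)).
  rewrite divff // => <-; apply: chi_cong; rewrite ey'; exact: dvdz_mull.
have char_cop g : SL2Z g -> (M %| g 1%R 0%R)%Z -> coprimez (g 1 1) N ->
    forall z, 0 < complex.Im z -> slashZ k f g z = chi (g 1 1) * f z.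
  move=> sg /dvdzP[c ec] /inverse[e [w ew]] z y0.
  (* Modulo N this is the quotient of the lower row of g, so [low (- t)] clears the lower-left
     entry. *)
  pose t := s * (c * u * e).
  have -> : slashZ k f g z = slashZ k f ((g *m low (- t)) *m low t) z.
    by rewrite -mulmxA low_mul addNr /low -mx22_1 mulmx1.
  have sg' : SL2Z (g *m low (- t)) by apply: SL2Z_mul => //; exact: SL2Z_low.
  rewrite slashZ_mul //; last exact: SL2Z_low.
  rewrite -(hst (c * u * e) z y0) -/t.
  have g11 : (g *m low (- t)) 1 1 = g 1 1 by rewrite mulmx2E !mx22E; ring.
  have -> : chi (g 1 1) * slashZ k f (low t) z =
      slashZ k (fun z => chi (g 1 1) * f z + 0 * f z) (low t) z.
    by rewrite slashZ_lin; ring.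
  apply: slashZ_ext => //; first exact: SL2Z_low.
  move=> w' w0; rewrite slash_Gamma0 //; first by rewrite g11; ring.
  rewrite mulmx2E !mx22E; apply/dvdzP; exists (c * v + c * u * s * w).
  rewrite [LHS](_ : _ = g 1 0 - c * u * s * (e * g 1 1)); last by rewrite /t; ring.
  rewrite ec -euv (_ : e * g 1 1 = 1 - w * N%:Z); last by rewrite -ew; ring.
  by ring.
have char_gen g : SL2Z g -> (M %| g 1%R 0%R)%Z -> exists2 d : int,
    (M %| d - g 1%R 1%R)%Z /\ coprimez d N &
    forall z, 0 < complex.Im z -> slashZ k f g z = chi d * f z.
  move=> sg dg; have sg1 := (SL2ZE g).1 sg.
  (* The lower-right entry is already prime to N', because N' divides M. Only q remains, and x = 1
     or x = 0 suffices according to whether q divides that entry. *)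
  have [x hx] : exists x, coprimez (g 1 1 + g 1 0 * x) N.
    have cg : coprimez (g 1 0) (g 1 1).
      apply/coprimezP; exists (- g 0 1, g 0 0) => /=; rewrite -sg1; ring.
    have cN' x : coprimez (g 1 1 + g 1 0 * x) N'.
      apply/coprimezP; have /dvdzP[a ea] := dvdz_trans N'M dg.
      exists (g 0 0, - (g 0 0 * x + g 0 1) * a) => /=; rewrite -sg1.
      rewrite [LHS](_ : _ = g 0 0 * (g 1 1 + g 1 0 * x) - (g 0 0 * x + g 0 1) * (a * N'%:Z)); last by ring.
      by rewrite -ea; ring.
    have cop x : coprimez (g 1 1 + g 1 0 * x) q -> coprimez (g 1 1 + g 1 0 * x) N.
      move=> cq; rewrite NE PoszM coprimezMr cN' andbT.
      by move: cq; rewrite !coprimezE /=; apply: coprimeXr.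
    case: (boolP (q%:Z %| g 1%R 1%R)%Z) => [/dvdzP[b eb]|hd].
      exists 1; apply: cop; rewrite mulr1.
      apply/coprimezP; move: sg1; rewrite eb => sg1.
      by exists (- g 0 1, g 0 1 * b + g 0 0 * b) => /=; rewrite -sg1; ring.
    exists 0; apply: cop; rewrite mulr0 addr0.
    by rewrite coprimez_sym coprimezE prime_coprime.
  have fupp y w : 0 < complex.Im w -> f (w + y%:~R) = f w.
    move=> w0; rewrite -slashZ_upp slash_Gamma0 ?mx22E ?dvdz0 //; last exact: SL2Z_upp.
    by rewrite chi1 mul1r.
  have g1 : ((g *m upp x) 1 0 = g 1 0) * ((g *m upp x) 1 1 = g 1 1 + g 1 0 * x).
    by rewrite !mulmx2E !mx22E; split; ring.
  have sgx : SL2Z (g *m upp x) by apply: SL2Z_mul => //; exact: SL2Z_upp.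
  exists (g 1 1 + g 1 0 * x); first by rewrite addrC addrA addNr add0r dvdz_mulr.
  move=> z y0; have yx : 0 < complex.Im (z + (- x)%:~R) by rewrite Im_addint.
  have := char_cop (g *m upp x) sgx _ _ _ yx; rewrite !g1 fupp // => <- //.
  rewrite -slashZ_upp -slashZ_mul //; last exact: SL2Z_upp.
  rewrite -mulmxA (_ : upp x *m _ = 1%:M) ?mulmx1 // mx22_mul mx22_1.
  by apply: mx22_inj; ring.
(* The ratio at [z0] defines the character without choosing among the integers d that [char_gen]
   provides. *)
have [_ _ hmin] := hlev; pose xi g := slashZ k f g z0 / f z0.
have xiE g c : (forall z, 0 < complex.Im z -> slashZ k f g z = c * f z) -> xi g = c.
  by move=> hc; rewrite /xi hc // mulfK.
have absM : `|M|%N%:Z = M by rewrite gez0_abs // ltW.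
suff /hmin : has_automorphy_at k f `|M|%N.
  rewrite absz_gt0 => /(_ (lt0r_neq0 M0)) NM.
  suff -> : N%:Z = M by rewrite dvdz_gcdl.
  apply/eqP; rewrite eq_le -absM !lez_nat NM /= dvdn_leq //.
  by have := dvdz_gcdr s N; rewrite dvdzE.
exists xi.
  split=> [g g'|g [[sg dg] _ h11]].
    rewrite /Gamma0 absM => - [sg dg] [sg' dg']; have [d _ hd] := char_gen g sg dg.
    have [d' _ hd'] := char_gen g' sg' dg'.
    rewrite (xiE g _ hd) (xiE g' _ hd'); apply: xiE => z y0.
    rewrite slashZ_mul // -mulrA -hd' //.
    have -> : chi d * slashZ k f g' z =
      slashZ k (fun z => chi d * f z + 0 * f z) g' z by rewrite slashZ_lin; ring.
    by apply: slashZ_ext => // w w0; rewrite hd //; ring.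
  move: dg h11; rewrite absM => dg h11; have [d [dM cd] hd] := char_gen g sg dg.
  rewrite (xiE g _ hd); apply: char_triv => //.
  rewrite (_ : d - 1 = d - g 1 1 + (g 1 1 - 1)); last by ring.
  exact: rpredD.
move=> g z [sg]; rewrite absM => dg y0; have [d _ hd] := char_gen g sg dg.
by rewrite (xiE g _ hd) hd.
Qed.

Lemma level_eigen s : (N'%:Z %| s)%Z -> eigen_mod (low s) 1 -> (N%:Z %| s)%Z.
Proof. by move=> Ns /eigen_mod_low1; apply: level_low. Qed.

Lemma dvdN (m : int) : (T%:Z %| m)%Z -> (N'%:Z %| m)%Z -> (N%:Z %| m)%Z.
Proof.
move=> hT hN; rewrite NE PoszM Gauss_dvdz ?hT //.
by rewrite coprimezE /= coprime_sym coprimeXr.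
Qed.

Lemma crt (a b : int) : exists c, (T%:Z %| c - a)%Z /\ (N'%:Z %| c - b)%Z.
Proof.
have co : coprimez T%:Z N'%:Z by rewrite coprimezE /= coprime_sym coprimeXr.
exists (zchinese T N' a b); rewrite -!eqz_mod_dvd.
by rewrite zchinese_modl // zchinese_modr // !eqxx.
Qed.

(** N divides sT, so [low (s * T)] acts on f as the identity. *)
Lemma eigen_low_order s a : (N'%:Z %| s)%Z -> eigen_mod (low s) a -> a ^+ T = 1.
Proof.
move=> Ns /(eigen_mod_pow T) h; apply: (eigen_mod_uniq ninv _ (eigen_mod_upp 0)).
apply: eigen_mod_cong h; [exact: SL2Z_low|exact: SL2Z_upp| |]; rewrite !mx22E ?subrr ?dvdz0 //.
by rewrite subr0; apply: dvdN; [exact: dvdz_mull | exact: dvdz_mulr].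
Qed.

Lemma eigen_low_neq0 s a : (N'%:Z %| s)%Z -> eigen_mod (low s) a -> a != 0.
Proof.
move=> Ns h; have := eigen_low_order Ns h; apply: contra_eqN => /eqP ->.
by rewrite expr0n expn_eq0 eqn0Ngt prime_gt0 //= eq_sym oner_eq0.
Qed.

(** For g in Gamma_0(N) with lower-right entry D modulo T and 1 modulo N', the products g low(s) and
    low(s D^2) g have the same lower row modulo N. Comparing eigenvalues, the factor chi(D')
    cancels. *)
Lemma eigen_low_square s a (D : nat) : coprime D q -> (N'%:Z %| s)%Z ->
  eigen_mod (low s) a -> a ^+ (D ^ 2) = a.
Proof.
move=> cD Ns ha; have [D' [hDT hDN]] := crt D 1.
have cD' : coprimez D' N.
  rewrite NE PoszM coprimezMr; apply/andP; split.
    have /dvdzP[m em] := hDT.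
    have /coprimezP[[i j] /= e] : coprimez D T by rewrite coprimezE /= coprimeXr.
    apply/coprimezP; exists (i, j - i * m) => /=; rewrite -e.
    have -> : D' = m * T%:Z + D%:Z by rewrite -em; ring.
    by ring.
  have /dvdzP[m em] := hDN.
  apply/coprimezP; exists (1, - m) => /=.
  have -> : D' = m * N'%:Z + 1 by rewrite -em; ring.
  by ring.
(* Bezout against N^2 leaves a factor N for the upper-right entry of g too, so that left
   multiplication by a lower unipotent keeps the lower-right entry modulo N. *)
have /coprimezP[[A B] /= eAB] : coprimez D' (N%:Z * N%:Z) by rewrite coprimezMr cD'.
pose g := mx22 A (- B * N%:Z) N%:Z D'.
have sg : SL2Z g by rewrite /SL2Z mx22_det -eAB; ring.
have hg : eigen_mod g (chi D').
  by have := eigen_mod_Gamma0 sg; rewrite !mx22E dvdzz; apply.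
have chiD : chi D' != 0 by case: hchi => _ _ _ ->.
have h1 : eigen_mod (g *m low s) (chi D' * a).
  by apply: eigen_mod_mul => //; exact: SL2Z_low.
have h2 : eigen_mod (low (s * (D ^ 2)%N%:Z) *m g) (a ^+ (D ^ 2) * chi D').
  by apply: eigen_mod_mul => //; [exact: SL2Z_low | exact: eigen_mod_pow].
apply: (mulIf chiD); rewrite [RHS]mulrC.
apply: (eigen_mod_uniq ninv h2); apply: eigen_mod_cong h1.
- by apply: SL2Z_mul => //; exact: SL2Z_low.
- by apply: SL2Z_mul => //; exact: SL2Z_low.
- rewrite !mulmx2E !mx22E; apply: dvdN; last first.
    rewrite NE PoszM; case/dvdzP: Ns => m ->.
    by apply/dvdzP; exists (D' * m - m * (D ^ 2)%N%:Z * A); rewrite !PoszM; ring.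
  have /dvdzP[m em] := hDT; have eD : D' = m * T%:Z + D%:Z by rewrite -em; ring.
  apply/dvdzP; exists (s * m + s * D%:Z * A * m + s * D%:Z * B * N'%:Z * N%:Z).
  rewrite expnS expn1 !PoszM.
  rewrite [LHS](_ : _ = s * D' - s * D%:Z * (D' * A) + s * D%:Z * A * (D' - D%:Z)); last by ring.
  rewrite [D' * A](_ : _ = 1 - B * (N%:Z * N%:Z)); last by rewrite -eAB; ring.
  by rewrite em {1}eD NE PoszM; ring.
- rewrite !mulmx2E !mx22E.
  by apply/dvdzP; exists (s * (D ^ 2)%N%:Z * B); ring.
Qed.

Lemma level_low_mul s a (m : nat) : (N'%:Z %| s)%Z -> eigen_mod (low s) a ->
  a ^+ m = 1 -> (N%:Z %| s * m%:Z)%Z.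
Proof.
move=> Ns ha am; apply: level_eigen; first exact: dvdz_mulr.
by rewrite -am; apply: eigen_mod_pow.
Qed.

(** D = 2 gives a^3 = 1, while a^T = 1 with T prime to 3; hence a = 1. *)
Lemma level_gt3 s a : (3 < q)%N -> (N'%:Z %| s)%Z -> eigen_mod (low s) a -> (N%:Z %| s)%Z.
Proof.
move=> q3 Ns ha; rewrite -[s]mulr1; apply: (level_low_mul Ns ha).
have a0 := eigen_low_neq0 Ns ha.
have h3 : a ^+ 3 = 1.
  apply: (mulIf a0); rewrite -exprSr mul1r.
  apply: (@eigen_low_square s a 2) => //.
  by rewrite coprime_sym prime_coprime // gtnNdvd // ltnW.
have hT := eigen_low_order Ns ha.
have /eqP g1 : coprime 3 T.
  by rewrite coprimeXr // prime_coprime // dvdn_prime2 // neq_ltn q3.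
have [u _ /dvdnP[v]] := @Bezoutl 3 T isT; rewrite g1 => uv.
rewrite expr1; have := congr1 (fun j => a ^+ j) uv.
by rewrite exprD expr1 mulnC exprM hT expr1n mulr1 mulnC exprM h3 expr1n.
Qed.

(** D = 2 gives a^3 = 1. *)
Lemma level_3 s a : q = 3%N -> (N'%:Z %| s)%Z -> eigen_mod (low s) a -> (N%:Z %| s * 3)%Z.
Proof.
move=> q3 Ns ha; apply: (level_low_mul (m := 3) Ns ha).
apply: (mulIf (eigen_low_neq0 Ns ha)); rewrite -exprSr mul1r.
by apply: (@eigen_low_square s a 2); rewrite ?q3.
Qed.

(** D = 3 gives a^8 = 1; no other odd D does better, as 8 divides D^2 - 1 for all of them. *)
Lemma level_2 s a : q = 2%N -> (N'%:Z %| s)%Z -> eigen_mod (low s) a -> (N%:Z %| s * 8)%Z.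
Proof.
move=> q2 Ns ha; apply: (level_low_mul (m := 8) Ns ha).
apply: (mulIf (eigen_low_neq0 Ns ha)); rewrite -exprSr mul1r.
by apply: (@eigen_low_square s a 3); rewrite ?q2.
Qed.

(** A Bezout coefficient, reduced modulo T to a natural exponent, turns s into a multiple with any
    prescribed residue in the ideal of Z/T that s generates. *)
Lemma eigen_scale s a r : (N'%:Z %| s)%Z -> eigen_mod (low s) a ->
  (gcdz s T%:Z %| r)%Z -> exists s1 b, [/\ (T%:Z %| s1 - r)%Z, (N'%:Z %| s1)%Z & eigen_mod (low s1) b].
Proof.
move=> Ns ha /dvdzP[m em].
have [i [j ij]] := Bezoutz s T%:Z.
have T0 : T%:Z != 0 by rewrite eqz_nat expn_eq0 eqn0Ngt prime_gt0.
have /gez0_abs et := modz_ge0 (m * i) T0.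
exists (s * `|(m * i %% T)%Z|%N%:Z), (a ^+ `|(m * i %% T)%Z|%N); split.
- rewrite et em -ij; apply/dvdzP; exists (- s * (m * i %/ T)%Z - m * j).
  by rewrite /modz; ring.
- exact: dvdz_mulr.
- exact: eigen_mod_pow.
Qed.

(** With s1 = -1 modulo T, the braid relation between an upper and a lower unipotent holds modulo N
    and yields b = b^2, so b = 1. Then T divides s1 and hence 1. *)
Lemma level_unit s a : (N'%:Z %| s)%Z -> coprimez s q -> eigen_mod (low s) a -> n = 0%N.
Proof.
move=> Ns cs ha.
have [|s1 [b [hT hN hb]]] := eigen_scale (r := -1) Ns ha.
  by have : coprimez s T by [move: cs; rewrite !coprimezE /=; apply: coprimeXr]; move/eqP->.
have b0 := eigen_low_neq0 hN hb.
have sl := SL2Z_low s1; have su := SL2Z_upp (- s1); have hu := eigen_mod_upp (- s1).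
have h1 := eigen_mod_mul su (SL2Z_mul sl su) hu (eigen_mod_mul sl su hb hu).
have h2 := eigen_mod_mul sl (SL2Z_mul su sl) hb (eigen_mod_mul su sl hu hb).
have e1 : b * (1 * b) = 1 * (b * 1).
  apply: (eigen_mod_uniq ninv h2); apply: eigen_mod_cong h1.
  - exact: SL2Z_mul su (SL2Z_mul sl su).
  - exact: SL2Z_mul sl (SL2Z_mul su sl).
  - rewrite !mulmx2E !mx22E; apply: dvdN.
      rewrite [X in (_ %| X)%Z](_ : _ = s1 * (s1 - 1) * (s1 - -1)); last by ring.
      exact: dvdz_mull.
    rewrite [X in (_ %| X)%Z](_ : _ = s1 * ((s1 - 1) * (s1 - -1))); last by ring.
    exact: dvdz_mulr.
  - rewrite !mulmx2E !mx22E [X in (_ %| X)%Z](_ : _ = 0) ?dvdz0 //; ring.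
have b1 : b = 1 by apply: (mulIf b0); move: e1; rewrite mulr1 !mul1r.
rewrite b1 in hb; have NTs : (T%:Z %| s1)%Z.
  by apply: dvdz_trans (level_eigen hN hb); rewrite NE PoszM dvdz_mulr.
have : (T%:Z %| s1 - -1 - s1)%Z by apply: rpredB.
have -> : s1 - -1 - s1 = 1 by ring.
rewrite dvdzE /=; case: (posnP n) => // n0 /(dvdn_trans (dvdn_exp n0 (dvdnn q))).
by rewrite dvdn1 => /eqP q1; move: q_prime; rewrite q1.
Qed.

(** With s1 = -2 modulo T, the matrix w = upp(x) low(s1) has trace 0 and determinant 1 modulo T, so
    w^2 = -1 there, while w = 1 modulo N'. Hence w^4 = 1 modulo N and b^4 = 1. *)
Lemma level_2mod4 s a : (N'%:Z %| s)%Z -> gcdz s T%:Z = 2 ->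
  eigen_mod (low s) a -> (N%:Z %| s * 4)%Z.
Proof.
move=> Ns g2 ha; have [|s1 [b [hT hN hb]]] := eigen_scale (r := - 2) Ns ha.
  by rewrite g2.
have [x [xT xN]] := crt 1 0.
(* [e] is the trace of [w]. *)
pose w := upp x *m low s1; pose e := 2 + x * s1.
have sw : SL2Z w by apply: SL2Z_mul; [exact: SL2Z_upp | exact: SL2Z_low].
have hw : eigen_mod w b.
  rewrite -[b]mul1r; apply: eigen_mod_mul => //; [exact: SL2Z_upp|exact: SL2Z_low|].
  exact: eigen_mod_upp.
have sw2 := SL2Z_mul sw sw; have hw2 := eigen_mod_mul sw sw hw hw.
have sw4 := SL2Z_mul sw2 sw2; have hw4 := eigen_mod_mul sw2 sw2 hw2 hw2.
have eT : (T%:Z %| e)%Z.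
  rewrite (_ : e = s1 * (x - 1) + (s1 - - 2)); last by rewrite /e; ring.
  by apply: rpredD => //; apply: dvdz_mull.
have b4 : b * b * (b * b) = 1.
  apply: (eigen_mod_uniq ninv _ (eigen_mod_upp 0)); apply: eigen_mod_cong hw4 => //.
  - exact: SL2Z_upp.
  - rewrite !mulmx2E !mx22E subr0.
    rewrite [X in (_ %| X)%Z](_ : _ = s1 * (((1 + x * s1) ^+ 2 + x * s1 + s1 * x + 1) * e)).
      by apply: dvdN; [apply/dvdz_mull/dvdz_mull | exact: dvdz_mulr].
    by rewrite /e; ring.
  - rewrite !mulmx2E !mx22E.
    rewrite [X in (_ %| X)%Z](_ : _ = s1 * (x * (e + 1) * e)); last by rewrite /e; ring.
    by apply: dvdN; [apply/dvdz_mull/dvdz_mull | exact: dvdz_mulr].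
have hN4 : (N%:Z %| s1 * 4)%Z.
  by apply: (level_low_mul (m := 4) hN hb); rewrite -b4; ring.
(* As s1 = -2 modulo T, the divisibility N | 4 s1 bounds T itself by 8; since s is even, T then
   divides 4s. *)
have T8 : (T%:Z %| (2 * 4)%R)%Z.
  have h : (T%:Z %| (s1 - - 2) * 4 - s1 * 4)%Z.
    apply: rpredB; first exact: dvdz_mulr.
    by apply: dvdz_trans hN4; rewrite NE PoszM dvdz_mulr.
  by move: h; congr (_ %| _)%Z; ring.
apply: dvdN; last exact: dvdz_mulr.
apply: dvdz_trans T8 _; apply: dvdz_mul => //.
by rewrite -[X in (X %| _)%Z]g2 dvdz_gcdl.
Qed.

End Classical.

(** * Functions invariant under translations *)

Section TranslationInvariance.
Variables (R : realType) (k : int) (H : R[i] -> R[i]) (N : nat).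
Local Notation C := R[i].
Hypothesis N0 : (0 < N)%N.
Hypothesis H_translation : forall (t : R) (z : C), 0 < complex.Im z -> H (z + t%:C%C) = H z.
Hypothesis H_low : forall z : C, 0 < complex.Im z -> slashZ k H (low N) z = H z.

Let stab (g : 'M[R]_2) :=
  \det g = 1 /\ forall z : C, 0 < complex.Im z -> slash k H g z = H z.

Let stab_mul g g' : stab g -> stab g' -> stab (g *m g').
Proof.
move=> [dg hg] [dg' hg']; split; first by rewrite det_mulmx dg dg' mulr1.
move=> z y0; rewrite slash_mul ?dg ?dg' // -hg' //.
by apply: slash_ext; rewrite ?dg'.
Qed.

Let stab_upp (x : R) : stab (mx22 1 x 0 1).
Proof.
split; first by rewrite mx22_det; ring.
move=> z y0; rewrite slashE /moebius /autj !mx22E.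
by rewrite !rmorph0 !rmorph1 mul0r add0r normr1 divr1 exp1rz !mul1r divr1 H_translation.
Qed.

(** [sv] is the matrix (0, -1/N; N, 0), whose fourth power is 1, so its cube is its inverse;
    conjugating upper unipotents by it gives all real lower ones. *)
Let stab_low (t : R) : stab (mx22 1 0 t 1).
Proof.
have n0 : N%:R != 0 :> R by rewrite pnatr_eq0 -lt0n.
have sN : stab (mx22 1 0 N%:R 1).
  by split; [rewrite mx22_det; ring | move=> z /H_low; rewrite /slashZ mx22_map].
have sv := stab_mul (stab_upp (- N%:R^-1)) (stab_mul sN (stab_upp (- N%:R^-1))).
have := stab_mul sv (stab_mul (stab_upp (- t / N%:R ^+ 2)) (stab_mul sv (stab_mul sv sv))).
by congr stab; rewrite !mx22_mul; apply: mx22_inj; field.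
Qed.

(** A matrix with nonzero lower-left entry is a product upper, lower, upper of unipotents; any other
    one enters this big cell after multiplication by a lower unipotent. *)
Lemma translation_invariant (g : 'M[R]_2) (z : C) :
  \det g = 1 -> 0 < complex.Im z -> slash k H g z = H z.
Proof.
have big_cell (e : 'M[R]_2) : \det e = 1 -> e 1 0 != 0 -> stab e.
  rewrite (mx22_eta e) mx22_det !mx22E => de c0.
  have := stab_mul (stab_upp ((e 0 0 - 1) / e 1 0))
    (stab_mul (stab_low (e 1 0)) (stab_upp ((e 1 1 - 1) / e 1 0))).
  congr stab; rewrite !mx22_mul; apply: mx22_inj; try by field.
  apply: (mulIf c0); rewrite [RHS](_ : _ = e 0 0 * e 1 1 - 1); last by rewrite -de; ring.
  by field.
move=> dg; suff [] : stab g by move=> _; apply.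
have [c0|] := eqVneq (g 1 0) 0; last exact: big_cell.
have -> : g = (g *m mx22 1 0 1 1) *m mx22 1 0 (-1) 1.
  by rewrite [in LHS](mx22_eta g) [in RHS](mx22_eta g) !mx22_mul; apply: mx22_inj; ring.
apply: stab_mul (stab_low _); apply: big_cell.
  by rewrite det_mulmx dg mx22_det; ring.
rewrite mulmx2E !mx22E c0 mul0r add0r mulr1.
by apply: contra_eqN dg => /eqP d0; rewrite (mx22_eta g) mx22_det c0 d0 !mulr0 subrr eq_sym oner_eq0.
Qed.

End TranslationInvariance.

(** The hypotheses make h|gam invariant under SL2(R); invariance under gam^-1 then identifies h with
    h|gam. *)
Lemma invariant_of_translation (R : realType) (k : int) (h : R[i] -> R[i]) (gam : 'M[int]_2)
    (N : nat) : (0 < N)%N -> SL2Z gam ->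
  (forall (t : R) (z : R[i]), 0 < complex.Im z ->
     slashZ k h gam (z + t%:C%C) = slashZ k h gam z) ->
  (forall z : R[i], 0 < complex.Im z ->
     slashZ k (slashZ k h gam) (low N) z = slashZ k h gam z) ->
  SL2Z_invariant k h.
Proof.
move=> N0 sg ht hl; have inv := translation_invariant N0 ht hl.
have intr_det (g : 'M[int]_2) : SL2Z g -> \det (map_mx intr g : 'M[R]_2) = 1.
  by rewrite det_map_mx => ->.
have dg := (SL2ZE gam).1 sg.
pose gi := mx22 (gam 1 1) (- gam 0 1) (- gam 1 0) (gam 0 0).
have sgi : SL2Z gi by rewrite /SL2Z mx22_det -dg; ring.
have hE z : 0 < complex.Im z -> h z = slashZ k h gam z.
  move=> y0; rewrite -(inv _ z (intr_det gi sgi) y0) -[slash _ _ _ _]/(slashZ k _ gi z).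
  rewrite -slashZ_mul // (_ : gam *m gi = low 0) ?slashZ_low0 //.
  rewrite [X in X *m _](mx22_eta gam) mx22_mul.
  by apply: mx22_inj; rewrite -?dg; ring.
move=> g sg' z y0; rewrite (slashZ_ext k sg' y0 hE) [RHS]hE //.
exact: inv (intr_det g sg') y0.
Qed.

(** * Primitives *)

Section Primitive.
Variable R : realType.
Local Open Scope classical_set_scope.
Implicit Types (G P : R -> R) (x u v : R).

Definition primitive P G := forall x, is_derive x (1 : R) P (G x).

Lemma continuous_itv_integrable G (a b : R) : continuous G ->
  lebesgue_measure.-integrable `[a, b] (EFin \o G).
Proof.
move=> cG; apply: continuous_compact_integrable; first exact: segment_compact.
exact: continuous_subspaceT.
Qed.

(** By the mean value theorem. It stands in for comparison of integrals, which are evaluated through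
    primitives. *)
Lemma primitive_ge P G (m u v : R) : primitive P G -> u <= v ->
  (forall x, u <= x <= v -> m <= G x) -> m * (v - u) <= P v - P u.
Proof.
move=> hP uv hm.
have [c /andP[uc cv] ->] : exists2 c, u <= c <= v & P v - P u = G c * (v - u).
  have [] // := @MVT_segment R P G u v uv (fun x _ => hP x).
    by apply: derivable_within_continuous => x _; have [] := hP x.
  by move=> c /itvP cuv e; exists c => //; rewrite !cuv.
by rewrite ler_wpM2r ?subr_ge0 // hm // uc.
Qed.

Lemma near_primitive G (x0 a : R) : continuous G -> a < x0 ->
  is_derive x0 (1 : R) (fun x => \int[lebesgue_measure]_(t in `[a, x]) G t) (G x0).
Proof.
move=> cG ax.
have [d1 d2] := @continuous_FTC1_closed R G a x0 (x0 + 1) (ltr_pwDr ltr01 (lexx _))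
   (continuous_itv_integrable _ _ cG) ax (cG x0).
apply: DeriveDef; [exact: d1 | rewrite -derive1E; exact: d2].
Qed.

Lemma int_chasles G (a b x : R) : continuous G -> a <= b -> b <= x ->
  \int[lebesgue_measure]_(t in `[a, x]) G t =
  \int[lebesgue_measure]_(t in `[a, b]) G t + \int[lebesgue_measure]_(t in `[b, x]) G t.
Proof.
move=> cG ab bx; apply/eqP; rewrite addrC -subr_eq; apply/eqP.
rewrite Rintegral_itvB ?bnd_simp //; last exact: continuous_itv_integrable.
rewrite Rintegral_itv_obnd_cbnd //.
apply: integrableS (continuous_itv_integrable b x cG) => //.
by apply: subset_itv; rewrite bnd_simp.
Qed.

Lemma exists_primitive G : continuous G -> exists P, primitive P G.
Proof.
move=> cG; pose I (a x : R) := \int[lebesgue_measure]_(t in `[a, x]) G t.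
(* The base point moves with x so that it lies strictly below both x and 0; by additivity the value
   does not depend on it, and near [x0] the fixed base [a] serves. *)
pose P x := I (- (`|x| + 1)) x - I (- (`|x| + 1)) 0.
exists P => x0; pose a := - (`|x0| + 2).
have ax0 : a < x0 by rewrite /a; case: ger0P => ?; lra.
have a0 : a < 0 by rewrite /a; have := normr_ge0 x0; lra.
have PE x : a <= - (`|x| + 1) -> P x = I a x - I a 0.
  move=> ax; have x1 : - (`|x| + 1) <= x by case: ger0P => ?; lra.
  have x2 : - (`|x| + 1) <= 0 by have := normr_ge0 x; lra.
  by rewrite /P /I (int_chasles cG ax x1) (int_chasles cG ax x2); ring.
have : is_derive x0 (1 : R) (fun x => I a x - I a 0) (G x0).
  have := is_deriveB (near_primitive cG ax0) (is_derive_cst (I a 0) x0 (1 : R)).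
  by rewrite subr0.
apply: near_eq_is_derive.
near=> x; rewrite PE // /a.
have : `|x| <= `|x0| + 1; last by lra.
suff : `|x0 - x| < 1.
  have := ler_normB x0 (x0 - x); rewrite (_ : x0 - (x0 - x) = x); last by ring.
  lra.
by near: x; apply: nbhsx_ballx.
Unshelve. all: by end_near. Qed.

Lemma primitive_int P G u v : continuous G -> primitive P G -> u < v ->
  \int[lebesgue_measure]_(t in `[u, v]) G t = P v - P u.
Proof.
move=> cG hP uv; rewrite /Rintegral (@continuous_FTC2 R G P u v uv) //.
- exact: continuous_subspaceT.
- have cP x : {for x, continuous P}.
    by apply/differentiable_continuous/derivable1_diffP; have [] := hP x.
  split; first by move=> x _; have [] := hP x.
    exact: cvg_at_right_filter (cP u).
  exact: cvg_at_left_filter (cP v).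
- by move=> x _; rewrite derive1E; have [_] := hP x.
Qed.

Lemma primitive_eq P P' G : primitive P G -> primitive P' G ->
  forall x y, P x - P' x = P y - P' y.
Proof.
move=> hP hP' x y; apply: (@is_derive_0_is_cst R (P \- P')) => z.
by have := is_deriveB (hP z) (hP' z); rewrite subrr.
Qed.

Lemma primitive_comp P G (a b : R) : primitive P G ->
  primitive (fun x => P (a * x + b)) (fun x => a * G (a * x + b)).
Proof.
move=> hP x.
have h : is_derive x (1 : R) (fun x => a * x + b) a.
  have := is_deriveD (is_deriveZ a (is_derive_id x (1 : R))) (is_derive_cst b x (1 : R)).
  by rewrite addr0 /GRing.scale /= mulr1.
by have := is_derive1_comp (f := P) (g := fun x => a * x + b) (hP _) h; rewrite mulrC.
Qed.

Lemma primitive_sum (n : nat) (Ps Gs : nat -> R -> R) :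
  (forall j, primitive (Ps j) (Gs j)) ->
  primitive (fun x => \sum_(j < n) Ps j x) (fun x => \sum_(j < n) Gs j x).
Proof.
move=> hP x; elim: n => [|n IHn].
  rewrite big_ord0 (_ : (fun x => _) = cst 0); first exact: is_derive_cst.
  by apply: funext => y; rewrite big_ord0.
rewrite big_ord_recr /=.
rewrite (_ : (fun x => _) = (fun y => \sum_(j < n) Ps j y + Ps n y)).
  have := is_deriveD IHn (hP n x); exact.
by apply: funext => y; rewrite big_ord_recr.
Qed.

Lemma primitive_scale P G (c : R) : primitive P G ->
  primitive (fun x => c * P x) (fun x => c * G x).
Proof. by move=> hP x; apply: is_deriveZ. Qed.

Lemma continuous_affine G (a b : R) : continuous G -> continuous (fun x => G (a * x + b)).
Proof.
move=> cG x; have h : {for x, continuous (fun x => a * x + b)}.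
  apply: (@cvgD _ R^o _ _ _ (fun x => a * x) (cst b)); last exact: cvg_cst.
  by apply: (@cvgM _ _ _ _ (cst a) id); [exact: cvg_cst | exact: cvg_id].
exact: (continuous_comp h (cG _)).
Qed.

Lemma continuous_bigsum (n : nat) (Gs : nat -> R -> R) : (forall j, continuous (Gs j)) ->
  continuous (fun x => \sum_(j < n) Gs j x).
Proof.
move=> cG x; elim: n => [|n IHn].
  rewrite (_ : (fun x => _) = cst 0); first exact: cvg_cst.
  by apply: funext => y; rewrite big_ord0.
rewrite (_ : (fun x => _) = (fun y => \sum_(j < n) Gs j y + Gs n y)).
  by apply: cvgD => //; apply: cG.
by apply: funext => y; rewrite big_ord_recr.
Qed.

Lemma primitive_period P G : primitive P G -> (forall x, G (x + 1) = G x) ->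
  forall (M : int) x, P (x + M%:~R) - P x = M%:~R * (P 1 - P 0).
Proof.
move=> hP per.
have step x : P (x + 1) - P x = P 1 - P 0.
  have h : primitive (fun x => P (1 * x + 1)) G.
    move=> y; have := primitive_comp 1 1 hP y.
    by rewrite !mul1r per.
  by have := primitive_eq h hP x 0; rewrite !mul1r add0r.
have nat_case (n : nat) x : P (x + n%:R) - P x = n%:R * (P 1 - P 0).
  elim: n => [|n IHn]; first by rewrite addr0 subrr mul0r.
  rewrite -addn1 natrD addrA -(subrK (P (x + n%:R)) (P (x + n%:R + 1))) step.
  by rewrite -addrA IHn; ring.
case=> n x; first exact: nat_case.
have -> : (Negz n)%:~R = - n.+1%:R :> R by rewrite NegzE mulrNz.
by have := nat_case n.+1 (x - n.+1%:R); rewrite subrK mulNr => <-; rewrite opprB.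
Qed.

(** In terms of a primitive the sum telescopes to an integral over a range of length m/r, a whole
    number of periods, possibly negative. *)
Lemma average_int G (r : int) (m : nat) : continuous G -> (forall x, G (x + 1) = G x) ->
  r != 0 -> (0 < m)%N -> (r %| m%:Z)%Z ->
  \int[lebesgue_measure]_(x in `[0, 1])
     (m%:R^-1 * \sum_(j < m) G ((x - j%:R) / r%:~R)) =
  \int[lebesgue_measure]_(x in `[0, 1]) G x.
Proof.
move=> cG per r0 m0 /dvdzP[M eM]; have [P hP] := exists_primitive cG.
have r0' : r%:~R != 0 :> R by rewrite intr_eq0.
have m0' : m%:R != 0 :> R by rewrite pnatr_eq0 -lt0n.
pose Gs (j : nat) x := G (r%:~R^-1 * x + (- j%:R / r%:~R)).
pose Ps (j : nat) x := r%:~R * P (r%:~R^-1 * x + (- j%:R / r%:~R)).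
have GE x : m%:R^-1 * \sum_(j < m) G ((x - j%:R) / r%:~R) = m%:R^-1 * \sum_(j < m) Gs j x.
  congr (_ * _); apply: eq_bigr => j _; congr G; field; exact: r0'.
have hPs : primitive (fun x => m%:R^-1 * \sum_(j < m) Ps j x)
                     (fun x => m%:R^-1 * \sum_(j < m) Gs j x).
  apply/primitive_scale/primitive_sum => j x.
  have := primitive_scale r%:~R (primitive_comp r%:~R^-1 (- j%:R / r%:~R) hP) x.
  by rewrite mulVKf.
rewrite (primitive_int cG hP ltr01).
under [LHS]eq_Rintegral => x _ do rewrite GE.
rewrite (primitive_int _ hPs ltr01); last first.
  move=> x; apply: cvgM; first exact: cvg_cst.
  by apply: continuous_bigsum => j; apply: continuous_affine.
rewrite -mulrBr -sumrB.
have -> : \sum_(j < m) (Ps j 1 - Ps j 0) =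
   r%:~R * (P (1 / r%:~R) - P (1 / r%:~R + (- M)%:~R)).
  transitivity (r%:~R * (P (1 / r%:~R) - P ((1 - m%:R) / r%:~R))).
    elim: m {m0 m0' eM GE hPs} => [|m IHm]; first by rewrite big_ord0 subr0 subrr mulr0.
    rewrite big_ord_recr /= IHm /Ps.
    rewrite (_ : r%:~R^-1 * 1 + - m%:R / r%:~R = (1 - m%:R) / r%:~R); last by field; exact: r0'.
    rewrite (_ : r%:~R^-1 * 0 + - m%:R / r%:~R = (1 - m.+1%:R) / r%:~R).
      by ring.
    by rewrite -[m.+1]addn1 natrD; field; exact: r0'.
  congr (_ * (_ - P _)); rewrite -[m%:R]/(m%:Z%:~R) eM intrM mulrNz; field; exact: r0'.
have := primitive_period hP per (- M) (1 / r%:~R); rewrite mulrNz => e.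
rewrite -[P _ - P _]opprB e -[m%:R]/(m%:Z%:~R) eM intrM.
have M0 : M%:~R != 0 :> R.
  by rewrite intr_eq0; apply: contraTneq m0 => M0; move: eM; rewrite M0 mul0r => - [->].
by field; rewrite r0' M0.
Qed.

End Primitive.

(** * Uniqueness of Fourier expansions *)

Section FourierUniqueness.
Variable R : realType.
Local Open Scope classical_set_scope.
Implicit Types (f g h p : R -> R) (x y : R) (r : int).

Definition int0 f := continuous f /\ \int[lebesgue_measure]_(x in `[0, 1]) f x = 0.

Lemma int_lin f h (a b : R) : continuous f -> continuous h ->
  \int[lebesgue_measure]_(x in `[0, 1]) (a * f x + b * h x) =
  a * \int[lebesgue_measure]_(x in `[0, 1]) f x + b * \int[lebesgue_measure]_(x in `[0, 1]) h x.
Proof.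
move=> cf ch; rewrite RintegralD //.
- by rewrite !RintegralZl //; exact: continuous_itv_integrable.
- by apply: continuous_itv_integrable => x; apply: cvgM; [exact: cvg_cst | exact: cf].
- by apply: continuous_itv_integrable => x; apply: cvgM; [exact: cvg_cst | exact: ch].
Qed.

Lemma continuous_lin f h (a b : R) : continuous f -> continuous h ->
  continuous (fun x => a * f x + b * h x).
Proof.
move=> cf ch x; apply: cvgD; apply: cvgM; try exact: cvg_cst.
  exact: cf.
exact: ch.
Qed.

Lemma int0_lin f h (a b : R) : int0 f -> int0 h -> int0 (fun x => a * f x + b * h x).
Proof.
move=> [cf If] [ch Ih]; split; first exact: continuous_lin.
by rewrite int_lin // If Ih !mulr0 addr0.
Qed.

Lemma int0_ext f h : f =1 h -> int0 f -> int0 h.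
Proof. by move=> /funext ->. Qed.

Definition fcos r x : R := cos (2 * pi * (r%:~R * x)).
Definition fsin r x : R := sin (2 * pi * (r%:~R * x)).

Definition fourier0 g := forall r, int0 (fun x => g x * fcos r x) /\ int0 (fun x => g x * fsin r x).

(** By the product formulas, a trigonometric polynomial of degree 1 only mixes the frequencies r -
    1, r and r + 1. *)
Lemma fourier0_mul g (a b c : R) : fourier0 g ->
  fourier0 (fun x => g x * (a + b * fcos 1 x + c * fsin 1 x)).
Proof.
move=> hg r; have [c0 s0] := hg r; have [c1 s1] := hg (r + 1); have [c2 s2] := hg (r - 1).
have e x : 2 * pi * ((r + 1)%:~R * x) = 2 * pi * (r%:~R * x) + 2 * pi * (1%:~R * x) :> R.
  by rewrite intrD; ring.
have e' x : 2 * pi * ((r - 1)%:~R * x) = 2 * pi * (r%:~R * x) - 2 * pi * (1%:~R * x) :> R.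
  by rewrite intrD; ring.
split.
  have := int0_lin 1 1 (int0_lin a (b / 2) c0 c1)
    (int0_lin 1 (- (c / 2)) (int0_lin (b / 2) (c / 2) c2 s1) s2).
  apply: int0_ext => x; rewrite /fcos /fsin e e' !(cosD, sinD, cosN, sinN).
  by field.
have := int0_lin 1 1 (int0_lin a (b / 2) s0 s1)
    (int0_lin 1 (- (c / 2)) (int0_lin (b / 2) (c / 2) s2 c2) c1).
apply: int0_ext => x; rewrite /fcos /fsin e e' !(cosD, sinD, cosN, sinN).
by field.
Qed.

Lemma cos_nonincreasing (a b : R) : 0 <= a -> a <= b -> b <= pi -> cos b <= cos a.
Proof.
move=> a0; rewrite le_eqVlt => /predU1P[-> //|ab] bpi; apply/ltW.
rewrite ltr_cos // in_itv /=; first by rewrite a0 (le_trans (ltW ab)).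
by rewrite bpi (le_trans a0 (ltW ab)).
Qed.

Lemma Bernoulli_inequality (e : R) (n : nat) : 0 <= e -> n%:R * e <= (1 + e) ^+ n.
Proof.
move=> e0; suff : 1 + n%:R * e <= (1 + e) ^+ n by lra.
elim: n => [|n IHn]; first by rewrite mul0r addr0 expr0.
have n0 : 0 <= n%:R * e * e by rewrite !mulr_ge0.
rewrite exprSr; apply: le_trans (ler_wpM2r _ IHn); last by lra.
by rewrite -addn1 natrD; lra.
Qed.

(** If g(x0) > 0, a trigonometric polynomial Q that is at least 1 near x0 and at most 1 in absolute
    value elsewhere makes the integral of g Q^n unbounded in n, although orthogonality makes it
    0. *)
Lemma fourier0_le0 g x0 : continuous g -> fourier0 g -> 0 < x0 < 1 -> g x0 <= 0.
Proof.
move=> cg hg /andP[x00 x01]; rewrite leNgt; apply/negP => gx0.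
set c := g x0 in gx0.
have [e e0 he] : exists2 e : R, 0 < e & forall x, `|x0 - x| < e -> c / 2 < g x.
  have : \forall x \near x0, c / 2 < g x by apply: (cvgr_gt _ (cg x0)); rewrite -/c; lra.
  by move=> /nbhs_ballP[e e0 he]; exists e => // x hx; apply: he.
(* Half of the minimum keeps the window of radius d strictly inside ]0, 1[ and inside the region
   where g > c/2. *)
pose mn := Num.min e (Num.min x0 (1 - x0)); pose d := mn / 2.
have mn0 : 0 < mn by rewrite /mn !lt_min e0 x00 subr_gt0.
have [m1 m2 m3] : [/\ mn <= e, mn <= x0 & mn <= 1 - x0].
  by rewrite /mn; split; rewrite !ge_min lexx ?orbT.
have d0 : 0 < d by rewrite divr_gt0.
have [d1 d2 d3] : [/\ d < e, d < x0 & d < 1 - x0] by rewrite /d; split; lra.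
have pi0 := pi_gt0 R.
have [M hM] : exists M : R, forall x, 0 <= x <= 1 -> `|g x| <= M.
  have [] := @EVT_max R (fun x => `|g x|) 0 1 ler01.
    by apply: continuous_subspaceT => x; apply: cvg_norm; apply: cg.
  by move=> y _ hy; exists `|g y| => x x01'; apply: hy; rewrite in_itv.
have M0 : 0 <= M by apply: le_trans (hM 0 _); rewrite ?lexx ?ler01.
(* Q equals 1 at distance exactly d from x0, exceeds 1 inside the window and stays in [-1, 1] on the
   rest of [0, 1]. *)
pose Q x := 1 - cos (2 * pi * d) + cos (2 * pi * (x - x0)).
have QE x : Q x = (1 - cos (2 * pi * d)) + cos (2 * pi * x0) * fcos 1 x
    + sin (2 * pi * x0) * fsin 1 x.
  by rewrite /Q /fcos /fsin mul1r mulrBr cosB; ring.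
have hQ n : fourier0 (fun x => g x * Q x ^+ n).
  elim: n => [|n IHn]; first by move=> r; have := hg r; congr (int0 _ /\ int0 _);
    apply: funext => x; rewrite expr0 mulr1.
  move=> r; have := fourier0_mul (1 - cos (2 * pi * d)) (cos (2 * pi * x0)) (sin (2 * pi * x0)) IHn r.
  by congr (int0 _ /\ int0 _); apply: funext => x; rewrite -QE exprSr mulrA.
have cos_abs x : cos (2 * pi * (x - x0)) = cos (2 * pi * `|x - x0|).
  case: ger0P => // _; by rewrite mulrN cosN.
have Q_out x : 0 <= x <= 1 -> d <= `|x - x0| -> `|Q x| <= 1.
  move=> /andP[hx0 hx1] hx.
  have hc : cos (2 * pi * (x - x0)) <= cos (2 * pi * d).
    rewrite cos_abs; set y := `|x - x0| in hx *.
    have hy : y <= 1 - d by rewrite /y; case: ger0P => ?; lra.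
    case: (lerP y (1 / 2)) => hy2.
      by apply: cos_nonincreasing; nra.
    have -> : cos (2 * pi * y) = cos (2 * pi * (1 - y)).
      rewrite -[in LHS]cosN -(cosD2pi (- (2 * pi * y))); congr cos.
      by rewrite mulr2n; ring.
    by apply: cos_nonincreasing; nra.
  rewrite ler_norml /Q.
  have := cos_geN1 (2 * pi * (x - x0)); have := cos_le1 (2 * pi * d); lra.
have Q_in x (b : R) : 0 <= b -> b <= d -> `|x - x0| <= b -> 1 + (cos (2 * pi * b) - cos (2 * pi * d)) <= Q x.
  move=> b0 bd hx; rewrite /Q cos_abs.
  have : cos (2 * pi * b) <= cos (2 * pi * `|x - x0|).
    by apply: cos_nonincreasing; have := normr_ge0 (x - x0); nra.
  lra.
pose ep := cos (2 * pi * (d / 2)) - cos (2 * pi * d).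
have ep0 : 0 < ep.
  rewrite subr_gt0 ltr_cos ?in_itv /=; first by nra.
    by apply/andP; split; nra.
  by apply/andP; split; nra.
(* The middle interval, of length d, contributes at least (c/2)(n ep)d by Bernoulli, and the two
   outer ones together at least -M(1 - d); the total is 0. *)
have key n : c / 2 * d * (n%:R * ep) <= M.
  have [cn In] : int0 (fun x => g x * Q x ^+ n).
    have [h _] := hQ n 0; apply: int0_ext h => x.
    by rewrite /fcos mulr0z mul0r mulr0 cos0 mulr1.
  have [P hP] := exists_primitive cn.
  move: In; rewrite (primitive_int cn hP ltr01) => P10.
  have lowb x : 0 <= x <= 1 -> - M <= g x * Q x ^+ n.
    move=> hx; case: (lerP d `|x - x0|) => hd.
      have : `|g x * Q x ^+ n| <= M; last by rewrite ler_norml => /andP[].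
      rewrite normrM -[M]mulr1 ler_pM ?normr_ge0 ?hM //.
      by rewrite normrX exprn_ile1 ?normr_ge0 ?Q_out.
    have gx : c / 2 < g x by apply: he; rewrite distrC; lra.
    have Qx : 1 <= Q x by have := Q_in x d (ltW d0) (lexx _) (ltW hd); lra.
    have : 0 <= g x * Q x ^+ n.
      by rewrite mulr_ge0 ?exprn_ge0 //; lra.
    lra.
  have mid x : x0 - d / 2 <= x <= x0 + d / 2 -> c / 2 * (n%:R * ep) <= g x * Q x ^+ n.
    move=> hx; have hd : `|x - x0| <= d / 2 by case: ger0P => ?; lra.
    have gx : c / 2 < g x by apply: he; rewrite distrC; lra.
    have Qx : 1 + ep <= Q x by apply: Q_in => //; lra.
    have Qn : n%:R * ep <= Q x ^+ n.
      apply: le_trans (Bernoulli_inequality n (ltW ep0)) _.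
      by rewrite lerXn2r // nnegrE; lra.
    have n0 : 0 <= n%:R * ep by rewrite mulr_ge0 // ltW.
    apply: ler_pM => //; lra.
  have p1 := primitive_ge hP (u := 0) (v := x0 - d / 2) (m := - M).
  have p2 := primitive_ge hP (u := x0 - d / 2) (v := x0 + d / 2) (m := c / 2 * (n%:R * ep)).
  have p3 := primitive_ge hP (u := x0 + d / 2) (v := 1) (m := - M).
  have {}p1 : - M * (x0 - d / 2 - 0) <= P (x0 - d / 2) - P 0.
    by apply: p1; [lra | move=> x hx; apply: lowb; lra].
  have {}p2 := p2 ltac:(lra) mid.
  have {}p3 : - M * (1 - (x0 + d / 2)) <= P 1 - P (x0 + d / 2).
    by apply: p3; [lra | move=> x hx; apply: lowb; lra].
  have : c / 2 * (n%:R * ep) * (x0 + d / 2 - (x0 - d / 2)) = c / 2 * d * (n%:R * ep) by field.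
  by nra.
have K0 : 0 < c / 2 * d * ep by rewrite !mulr_gt0 // divr_gt0.
have hb : M / (c / 2 * d * ep) < (Num.bound (M / (c / 2 * d * ep)))%:R.
  by apply: archi_boundP; rewrite divr_ge0 // ltW.
rewrite ltr_pdivrMr // in hb.
have := key (Num.bound (M / (c / 2 * d * ep))).
by rewrite leNgt => /negP; apply; apply: lt_le_trans hb _; rewrite le_eqVlt; apply/orP; left;
  apply/eqP; ring.
Qed.

(** The bound for g and -g gives vanishing away from the integers; a nonzero value anywhere would
    persist at a nearby non-integer by continuity. *)
Lemma fourier0_eq0 g : continuous g -> (forall x, g (x + 1) = g x) -> fourier0 g ->
  forall x, g x = 0.
Proof.
move=> cg per hg.
have hN : fourier0 (fun x => - g x).
  move=> r; have [h1 h2] := hg r; split.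
    by apply: int0_ext (int0_lin (-1) 0 h1 h1) => x; ring.
  by apply: int0_ext (int0_lin (-1) 0 h2 h2) => x; ring.
have cN : continuous (fun x => - g x) by move=> x; apply: cvgN; apply: cg.
have inside x : 0 < x < 1 -> g x = 0.
  move=> hx; apply/eqP; rewrite eq_le (fourier0_le0 cg hg hx) /=.
  by have := fourier0_le0 cN hN hx; lra.
have per_int r x : g (x + r%:~R) = g x.
  have pn (n : nat) y : g (y + n%:R) = g y.
    elim: n => [|n IHn]; first by rewrite addr0.
    by rewrite -addn1 natrD addrA per.
  case: r => n; first exact: pn.
  by rewrite NegzE mulrNz -(pn n.+1) subrK.
move=> x0; apply/eqP; apply: contraT => gx0.
have : \forall x \near x0, 0 < `|g x|.
  by apply: (cvgr_gt _ (cvg_norm (cg x0))); rewrite normr_gt0.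
move=> /nbhs_ballP[e /= e0 he].
pose m := Num.floor x0.
have m1 : m%:~R <= x0 by exact: floor_le_tmp.
have m2 : x0 < (m + 1)%:~R by exact: floorD1_gt.
have [y [y1 y2 y3]] : exists y, [/\ x0 < y, y < x0 + e & y < (m + 1)%:~R].
  have h : x0 < Num.min (x0 + e) (m + 1)%:~R by rewrite lt_min ltrDl e0.
  exists ((x0 + Num.min (x0 + e) (m + 1)%:~R) / 2).
  have := midf_lt h => - [h1]; rewrite lt_min => /andP[h2 h3]; by split.
have := he y; rewrite /ball /= -[y in g y](subrK m%:~R) per_int inside ?normr0 ?ltxx.
  by apply; rewrite ltr_distlC; lra.
by move: y3; rewrite intrD; lra.
Qed.

Lemma sin_cos_period r x : (sin (x + 2 * pi * r%:~R) = sin x) * (cos (x + 2 * pi * r%:~R) = cos x).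
Proof.
have pn (n : nat) y : (sin (y + 2 * pi * n%:R) = sin y) * (cos (y + 2 * pi * n%:R) = cos y).
  elim: n => [|n IHn]; first by rewrite mulr0 addr0.
  have -> : y + 2 * pi * n.+1%:R = (y + 2 * pi * n%:R) + pi *+ 2.
    by rewrite -addn1 natrD mulr2n; ring.
  by rewrite sinD2pi cosD2pi !IHn.
case: r => n; first exact: pn.
have -> : (Negz n)%:~R = - n.+1%:R :> R by rewrite NegzE mulrNz.
have [s1 c1] := pn n.+1 (x + 2 * pi * - n.+1%:R).
by rewrite -s1 -c1 mulrN subrK.
Qed.

Lemma continuous_fcos r : continuous (fcos r).
Proof.
have h := @continuous_affine R (@cos R) (2 * pi * r%:~R) 0 (@continuous_cos R).
by rewrite (_ : fcos r = fun x => cos (2 * pi * r%:~R * x + 0)) // funeqE => x;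
  rewrite /fcos /fsin addr0 mulrA.
Qed.

Lemma continuous_fsin r : continuous (fsin r).
Proof.
have h := @continuous_affine R (@sin R) (2 * pi * r%:~R) 0 (@continuous_sin R).
by rewrite (_ : fsin r = fun x => sin (2 * pi * r%:~R * x + 0)) // funeqE => x;
  rewrite /fcos /fsin addr0 mulrA.
Qed.

Lemma int_fcos r : r != 0 -> \int[lebesgue_measure]_(x in `[0, 1]) fcos r x = 0.
Proof.
move=> r0; have c0 : 2 * pi * r%:~R != 0 :> R.
  by rewrite !mulf_neq0 ?intr_eq0 // lt0r_neq0 // pi_gt0.
have hP : primitive (fun x => (2 * pi * r%:~R)^-1 * sin (2 * pi * r%:~R * x + 0)) (fcos r).
  move=> x; have hs : primitive (@sin R) (@cos R) by move=> y; exact: is_derive_sin.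
  have := primitive_scale (2 * pi * r%:~R)^-1 (primitive_comp (2 * pi * r%:~R) 0 hs) x.
  by rewrite mulKf // addr0 /fcos mulrA.
rewrite (primitive_int (@continuous_fcos r) hP ltr01).
have [s1 _] := sin_cos_period r 0; rewrite add0r in s1.
by rewrite !addr0 mulr1 s1 mulr0 subrr.
Qed.

Lemma int_fsin r : \int[lebesgue_measure]_(x in `[0, 1]) fsin r x = 0.
Proof.
have [->|r0] := eqVneq r 0.
  rewrite (_ : fsin 0 = cst 0) ?Rintegral_cst ?mul0r //.
  by rewrite funeqE => x; rewrite /fsin mulr0z mul0r mulr0 sin0.
have c0 : 2 * pi * r%:~R != 0 :> R.
  by rewrite !mulf_neq0 ?intr_eq0 // lt0r_neq0 // pi_gt0.
have hP : primitive (fun x => - (2 * pi * r%:~R)^-1 * cos (2 * pi * r%:~R * x + 0)) (fsin r).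
  move=> x; have hs : primitive (@cos R) (fun x => - sin x) by move=> y; exact: is_derive_cos.
  have := primitive_scale (- (2 * pi * r%:~R)^-1) (primitive_comp (2 * pi * r%:~R) 0 hs) x.
  by rewrite mulNr mulKf // opprK addr0 /fsin mulrA.
rewrite (primitive_int (@continuous_fsin r) hP ltr01).
have [_ s1] := sin_cos_period r 0; rewrite add0r in s1.
by rewrite !addr0 mulr1 mulr0 s1 subrr.
Qed.

(** Subtracting the mean kills the coefficient at r = 0 and leaves the others unchanged. *)
Lemma fourier_const g : continuous g -> (forall x, g (x + 1) = g x) ->
  (forall r, r != 0 -> \int[lebesgue_measure]_(x in `[0, 1]) (g x * fcos r x) = 0 /\
    \int[lebesgue_measure]_(x in `[0, 1]) (g x * fsin r x) = 0) ->
  forall x y, g x = g y.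
Proof.
move=> cg per hg; pose a := \int[lebesgue_measure]_(x in `[0, 1]) g x.
have ca : continuous (cst a : R -> R) by move=> x; exact: cvg_cst.
have cM f h : continuous f -> continuous h -> continuous (fun x => f x * h x).
  by move=> cf ch x; apply: cvgM; [apply: cf | apply: ch].
have c0 : continuous (fun x => g x - a) by move=> x; apply: cvgB; [apply: cg | apply: cvg_cst].
suff h x : g x - a = 0 by move=> x y; have := h x; have := h y; lra.
apply: (fourier0_eq0 c0) => [{}x|r]; first by rewrite per.
have cc := @continuous_fcos r; have cs := @continuous_fsin r.
split; split; try exact: cM.
- have -> : (fun x => (g x - a) * fcos r x) = (fun x => 1 * (g x * fcos r x) + - a * fcos r x).
    by rewrite funeqE => y; ring.
  rewrite int_lin //; last exact: cM.
  have [->|r0] := eqVneq r 0; last by rewrite (hg r r0).1 int_fcos // !mulr0 addr0.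
  have e y : fcos 0 y = 1 by rewrite /fcos mulr0z mul0r mulr0 cos0.
  under eq_Rintegral => y _ do rewrite e mulr1.
  under [X in _ + _ * X]eq_Rintegral => y _ do rewrite e.
  rewrite Rintegral_cst //= lebesgue_measure_itv /= lte_fin ltr01 /= -/a.
  by ring.
- have -> : (fun x => (g x - a) * fsin r x) = (fun x => 1 * (g x * fsin r x) + - a * fsin r x).
    by rewrite funeqE => y; ring.
  rewrite int_lin // ?int_fsin; last exact: cM.
  have [->|r0] := eqVneq r 0; last by rewrite (hg r r0).2 !mulr0 addr0.
  have e y : fsin 0 y = 0 by rewrite /fsin mulr0z mul0r mulr0 sin0.
  under eq_Rintegral => y _ do rewrite e mulr0.
  by rewrite Rintegral_cst //= mul0r !mulr0 addr0.
Qed.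

End FourierUniqueness.

(** * Complex-valued integrals and Whittaker integrals *)

Section ComplexIntegral.
Variable R : realType.
Local Notation C := R[i].
Local Open Scope classical_set_scope.
Implicit Types (F G : R -> C) (x t : R) (r : int).

Definition ccont F :=
  continuous (fun x => complex.Re (F x)) /\ continuous (fun x => complex.Im (F x)).

Definition cint F : C :=
  ((\int[lebesgue_measure]_(x in `[0, 1]) complex.Re (F x)) +i*
   (\int[lebesgue_measure]_(x in `[0, 1]) complex.Im (F x)))%C.

Lemma ReD (z w : C) : complex.Re (z + w) = complex.Re z + complex.Re w.
Proof. by case: z w => ? ? [? ?]. Qed.
Lemma ImD (z w : C) : complex.Im (z + w) = complex.Im z + complex.Im w.
Proof. by case: z w => ? ? [? ?]. Qed.
Lemma ReM (z w : C) : complex.Re (z * w) =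
  complex.Re z * complex.Re w - complex.Im z * complex.Im w.
Proof. by case: z w => ? ? [? ?]. Qed.
Lemma ImM (z w : C) : complex.Im (z * w) =
  complex.Re z * complex.Im w + complex.Im z * complex.Re w.
Proof. by case: z w => ? ? [? ?]. Qed.

Lemma ccont_cst (c : C) : ccont (fun=> c).
Proof. by split=> x; exact: cvg_cst. Qed.

Lemma ccont_real (f : R -> R) : continuous f -> ccont (fun x => (f x)%:C%C).
Proof. by split=> // x; exact: cvg_cst. Qed.

Lemma ccontD F G : ccont F -> ccont G -> ccont (fun x => F x + G x).
Proof.
move=> [c1 c2] [d1 d2]; split.
  rewrite (_ : (fun x => _) = (fun x => complex.Re (F x) + complex.Re (G x))).
    by move=> x; apply: cvgD; [apply: c1 | apply: d1].
  by rewrite funeqE => x; rewrite ReD.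
rewrite (_ : (fun x => _) = (fun x => complex.Im (F x) + complex.Im (G x))).
  by move=> x; apply: cvgD; [apply: c2 | apply: d2].
by rewrite funeqE => x; rewrite ImD.
Qed.

Lemma ccontM F G : ccont F -> ccont G -> ccont (fun x => F x * G x).
Proof.
move=> [c1 c2] [d1 d2]; split.
  rewrite (_ : (fun x => _) = (fun x => complex.Re (F x) * complex.Re (G x)
     - complex.Im (F x) * complex.Im (G x))).
    move=> x; apply: cvgB; apply: cvgM; [exact: c1 | exact: d1 | exact: c2 | exact: d2].
  by rewrite funeqE => x; rewrite ReM.
rewrite (_ : (fun x => _) = (fun x => complex.Re (F x) * complex.Im (G x)
     + complex.Im (F x) * complex.Re (G x))).
  move=> x; apply: cvgD; apply: cvgM; [exact: c1 | exact: d2 | exact: c2 | exact: d1].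
by rewrite funeqE => x; rewrite ImM.
Qed.

Lemma ccontV F : ccont F -> (forall x, F x != 0) -> ccont (fun x => (F x)^-1).
Proof.
move=> [c1 c2] nz; pose D x := complex.Re (F x) ^+ 2 + complex.Im (F x) ^+ 2.
have D0 x : D x != 0.
  have := nz x; rewrite /D; case: (F x) => a b /=; rewrite eq_complex /= => h.
  rewrite paddr_eq0 ?sqr_ge0 // !sqrf_eq0; exact: h.
have cD : continuous (fun x => (D x)^-1).
  move=> x; apply: cvgV => //; apply: cvgD; rewrite /=.
    by apply: (@cvgM _ _ _ _ (fun x => complex.Re (F x)) (fun x => complex.Re (F x))); apply: c1.
  by apply: (@cvgM _ _ _ _ (fun x => complex.Im (F x)) (fun x => complex.Im (F x))); apply: c2.
split.
  rewrite (_ : (fun x => _) = (fun x => complex.Re (F x) * (D x)^-1)).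
    by move=> x; apply: cvgM; [exact: c1 | exact: cD].
  by rewrite funeqE => x; rewrite /D; case: (F x).
rewrite (_ : (fun x => _) = (fun x => (- complex.Im (F x)) * (D x)^-1)).
  by move=> x; apply: cvgM; [apply: cvgN; exact: c2 | exact: cD].
by rewrite funeqE => x; rewrite /D; case: (F x) => a b /=; rewrite mulNr.
Qed.

Lemma ccontX F n : ccont F -> ccont (fun x => F x ^+ n).
Proof.
move=> cF; elim: n => [|n IHn]; first exact: (ccont_cst 1).
by rewrite (_ : (fun x => _) = (fun x => F x * F x ^+ n)); [exact: ccontM |
  rewrite funeqE => x; rewrite exprS].
Qed.

Lemma ccontXz F (n : int) : ccont F -> (forall x, F x != 0) -> ccont (fun x => F x ^ n).
Proof.
move=> cF nz; case: n => n; first exact: ccontX.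
apply: (ccontV (F := fun x => F x ^+ n.+1)); first exact: ccontX.
by move=> x; rewrite expf_neq0.
Qed.

Lemma ccont_norm F : ccont F -> ccont (fun x => `|F x|).
Proof.
move=> [c1 c2]; rewrite (_ : (fun x => _) =
  (fun x => (Num.sqrt (complex.Re (F x) ^+ 2 + complex.Im (F x) ^+ 2))%:C%C)); last first.
  by rewrite funeqE => x; rewrite normc_def.
apply: ccont_real => x.
apply: (@continuous_comp _ _ _ (fun x => complex.Re (F x) ^+ 2 + complex.Im (F x) ^+ 2) Num.sqrt);
  last exact: sqrt_continuous.
apply: cvgD; rewrite /=.
  by apply: (@cvgM _ _ _ _ (fun x => complex.Re (F x)) (fun x => complex.Re (F x))); apply: c1.
by apply: (@cvgM _ _ _ _ (fun x => complex.Im (F x)) (fun x => complex.Im (F x))); apply: c2.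
Qed.

Lemma ccont_affine F (a b : R) : ccont F -> ccont (fun x => F (a * x + b)).
Proof. by move=> [c1 c2]; split; [exact: (@continuous_affine R _ a b c1) | exact: (@continuous_affine R _ a b c2)]. Qed.

Lemma cint_lin F G (a b : C) : ccont F -> ccont G ->
  cint (fun x => a * F x + b * G x) = a * cint F + b * cint G.
Proof.
move=> [c1 c2] [d1 d2]; case: a b => a1 a2 [b1 b2].
have cl := continuous_lin; rewrite /cint.
have -> : (fun x => complex.Re ((a1 +i* a2)%C * F x + (b1 +i* b2)%C * G x)) =
  (fun x => 1 * (a1 * complex.Re (F x) + (- a2) * complex.Im (F x)) +
            1 * (b1 * complex.Re (G x) + (- b2) * complex.Im (G x))).
  by rewrite funeqE => x; rewrite ReD !ReM /=; ring.
have -> : (fun x => complex.Im ((a1 +i* a2)%C * F x + (b1 +i* b2)%C * G x)) =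
  (fun x => 1 * (a1 * complex.Im (F x) + a2 * complex.Re (F x)) +
            1 * (b1 * complex.Im (G x) + b2 * complex.Re (G x))).
  by rewrite funeqE => x; rewrite ImD !ImM /=; ring.
rewrite !int_lin //; try exact: continuous_lin.
by apply/eqP; rewrite eq_complex /=; apply/andP; split; apply/eqP; ring.
Qed.

Lemma e2piE r t : e2pi (- (r%:~R * t)) = (fcos r t +i* - fsin r t)%C.
Proof. by rewrite /e2pi mulrN cosN sinN. Qed.

Lemma ccont_e2pi r : ccont (fun t => e2pi (- (r%:~R * t))).
Proof.
rewrite (_ : (fun t => _) = (fun t => (fcos r t +i* - fsin r t)%C)).
  split=> x /=; first exact: continuous_fcos.
  by apply: cvgN; exact: continuous_fsin.
by rewrite funeqE => t; rewrite e2piE.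
Qed.

Lemma e2pi_int x (j : int) : e2pi (x + j%:~R) = e2pi x.
Proof. by rewrite /e2pi mulrDr !sin_cos_period. Qed.

(** One complex coefficient mixes the real and imaginary parts of F; the coefficients at r and -r
    together isolate the four real integrals. *)
Lemma cfourier_const F : ccont F -> (forall x, F (x + 1) = F x) ->
  (forall r, r != 0 -> cint (fun t => F t * e2pi (- (r%:~R * t))) = 0) ->
  forall x y, F x = F y.
Proof.
move=> cF per hF; have [c1 c2] := cF.
pose u x := complex.Re (F x); pose v x := complex.Im (F x).
pose I (f : R -> R) := \int[lebesgue_measure]_(x in `[0, 1]) f x.
have cM (f h : R -> R) : continuous f -> continuous h -> continuous (fun x => f x * h x).
  by move=> cf ch x; apply: cvgM; [apply: cf | apply: ch].
have cc := @continuous_fcos R; have cs := @continuous_fsin R.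
have fN r t : (fcos (- r) t = fcos r t) * (fsin (- r) t = - fsin r t).
  by rewrite /fcos /fsin mulrNz !mulNr mulrN cosN sinN.
have eqs r : r != 0 -> I (fun t => u t * fcos r t) + I (fun t => v t * fsin r t) = 0 /\
   I (fun t => v t * fcos r t) - I (fun t => u t * fsin r t) = 0.
  move=> r0; have /eqP := hF r r0; rewrite eq_complex /= => /andP[/eqP e1 /eqP e2].
  split.
    rewrite -[LHS](_ : 1 * I (fun t => u t * fcos r t) + 1 * I (fun t => v t * fsin r t) = _).
      rewrite -int_lin -?[RHS]e1; try exact: cM.
      by congr Rintegral; rewrite funeqE => t; rewrite e2piE ReM /= /u /v; ring.
    by rewrite !mul1r.
  rewrite -[LHS](_ : 1 * I (fun t => v t * fcos r t) + (-1) * I (fun t => u t * fsin r t) = _).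
    rewrite -int_lin -?[RHS]e2; try exact: cM.
    by congr Rintegral; rewrite funeqE => t; rewrite e2piE ImM /= /u /v; ring.
  by rewrite mul1r mulN1r.
have IN (f : R -> R) r : continuous f -> I (fun t => f t * fsin (- r) t) = - I (fun t => f t * fsin r t).
  move=> cf; rewrite -[RHS]mulN1r -[RHS]addr0 -(mul0r (I (fun t => f t * fsin r t))) -int_lin; try exact: cM.
  by congr Rintegral; rewrite funeqE => t; rewrite fN; ring.
have IC (f : R -> R) r : I (fun t => f t * fcos (- r) t) = I (fun t => f t * fcos r t).
  by congr Rintegral; rewrite funeqE => t; rewrite fN.
have all0 r : r != 0 -> [/\ I (fun t => u t * fcos r t) = 0, I (fun t => u t * fsin r t) = 0,
    I (fun t => v t * fcos r t) = 0 & I (fun t => v t * fsin r t) = 0].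
  move=> r0; have [e1 e2] := eqs r r0; have [] := eqs (- r); first by rewrite oppr_eq0.
  by rewrite !IN // !IC => e3 e4; split; lra.
have hu := fourier_const c1; have hv := fourier_const c2.
move=> x y; apply/eqP; rewrite eq_complex; apply/andP; split; apply/eqP.
  by apply: hu => [z|r /all0[]]; rewrite ?per.
by apply: hv => [z|r /all0[]]; rewrite ?per.
Qed.

Lemma Re_scale_nat (m : nat) (z : C) :
  (complex.Re (m%:R^-1 * z) = m%:R^-1 * complex.Re z) *
  (complex.Im (m%:R^-1 * z) = m%:R^-1 * complex.Im z).
Proof.
have -> : (m%:R^-1 : C) = (m%:R^-1)%:C%C by rewrite fmorphV rmorph_nat.
by rewrite ReM ImM /=; split; ring.
Qed.

Lemma sum_part (part : C -> R) (m : nat) (z : nat -> C) : part 0 = 0 ->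
  (forall z w, part (z + w) = part z + part w) ->
  part (\sum_(j < m) z j) = \sum_(j < m) part (z j).
Proof. by move=> p0 pD; apply: (big_morph part pD p0). Qed.

(** Since e2pi has period 1, the whole integrand is a function G of period 1 in (x - j)/r. The
    average over the residues j then unfolds to one period of G. *)
Lemma integral_QA_periodic (Phi : adele R -> C) F r : r != 0 -> ccont F ->
  (forall x, F (x + 1) = F x) ->
  (forall (x : R) (j : nat), Phi (x, fun p => j%:R) = F ((x - j%:R) / r%:~R) * e2pi (- x)) ->
  integral_QA Phi = cint (fun t => F t * e2pi (- (r%:~R * t))).
Proof.
move=> r0 cF per hPhi; pose G t := F t * e2pi (- (r%:~R * t)).
have r0' : r%:~R != 0 :> R by rewrite intr_eq0.
have [g1 g2] : ccont G by apply: ccontM => //; exact: ccont_e2pi.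
have perG x : G (x + 1) = G x.
  by rewrite /G per mulrDr mulr1 opprD -intrN e2pi_int.
have PhiE (x : R) (j : nat) : Phi (x, fun p => j%:R) = G ((x - j%:R) / r%:~R).
  rewrite hPhi /G; congr (_ * _).
  rewrite -(e2pi_int (- x) j); congr e2pi; rewrite -pmulrn; field; exact: r0'.
have main (part : C -> R) : part 0 = 0 -> (forall z w, part (z + w) = part z + part w) ->
    (forall (m : nat) z, part (m%:R^-1 * z) = m%:R^-1 * part z) ->
    continuous (fun x => part (G x)) ->
    limn (fun n => Rintegral lebesgue_measure `[0, 1] (fun x => part (avg Phi n x))) =
    \int[lebesgue_measure]_(x in `[0, 1]) part (G x).
  move=> p0 pD pZ cG; apply: cvg_lim => //; apply: cvg_near_cst.
  (* r divides n! once n >= |r|, so the sequence of integrals is constant from there on. *)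
  exists `|r|%N => // n /= rn.
  rewrite -(@average_int R (fun x => part (G x)) r n`!) //.
  - congr Rintegral; rewrite funeqE => x; rewrite /avg pZ (@sum_part part _ (fun j => Phi (x, fun p => j%:R))) //.
    by congr (_ * _); apply: eq_bigr => j _; rewrite PhiE.
  - by move=> x; rewrite perG.
  - exact: fact_gt0.
  - by rewrite dvdzE /=; apply: dvdn_fact; rewrite absz_gt0 r0.
rewrite /integral_QA /cint; congr Complex.
  by apply: main => //; [exact: ReD | move=> m z; rewrite Re_scale_nat].
by apply: main => //; [exact: ImD | move=> m z; rewrite Re_scale_nat].
Qed.

End ComplexIntegral.

(** * Continuity of f|g along horizontal lines *)

Section SlashContinuity.
Variables (R : realType) (k : int).
Local Notation C := R[i].
Local Open Scope classical_set_scope.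

Lemma ccont_slash (f : C -> C) (g : 'M[R]_2) (y : R) : smooth f -> 0 < \det g -> 0 < y ->
  ccont (fun t => slash k f g (t +i* y)%C).
Proof.
move=> sf dg y0.
have cz : ccont (fun t : R => (t +i* y)%C) by split=> x; [exact: cvg_id | exact: cvg_cst].
have cj : ccont (fun t : R => autj g (t +i* y)%C).
  by apply: ccontD; [apply: ccontM => //; exact: ccont_cst | exact: ccont_cst].
have j0 (t : R) : autj g (t +i* y)%C != 0 by apply: autj_neq0 => //; rewrite lt0r_neq0.
have cm : ccont (fun t : R => moebius g (t +i* y)%C).
  apply: ccontM; last exact: ccontV.
  by apply: ccontD; [apply: ccontM => //; exact: ccont_cst | exact: ccont_cst].
have im (t : R) : 0 < complex.Im (moebius g (t +i* y)%C) by apply: moebius_Im.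
have n0 (t : R) : `|autj g (t +i* y)%C| != 0 by rewrite normr_eq0.
rewrite (_ : (fun t => _) = (fun t : R =>
  (autj g (t +i* y)%C / `|autj g (t +i* y)%C|) ^ (- k) * f (moebius g (t +i* y)%C))) //.
apply: ccontM.
  apply: ccontXz => [|t]; last by rewrite mulf_neq0 ?invr_eq0.
  by apply: ccontM => //; apply: ccontV => //; apply: ccont_norm.
have [[cre _] [cim _]] := sf 0%N; have [m1 m2] := cm.
have fz (z : C) : f z = f (complex.Re z +i* complex.Im z)%C by case: z.
split=> t.
  rewrite (_ : (fun x => _) = (fun w : R * R => re_part f w.1 w.2) \o
    (fun t => (complex.Re (moebius g (t +i* y)%C), complex.Im (moebius g (t +i* y)%C)))).
    apply: continuous_comp; last exact: cre.
    by apply: (@cvg_pair _ _ _ (nbhs t) (nbhs _) (nbhs _)); [exact: m1 | exact: m2].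
  by rewrite funeqE => x; rewrite [in LHS]fz.
rewrite (_ : (fun x => _) = (fun w : R * R => im_part f w.1 w.2) \o
    (fun t => (complex.Re (moebius g (t +i* y)%C), complex.Im (moebius g (t +i* y)%C)))).
  apply: continuous_comp; last exact: cim.
  by apply: (@cvg_pair _ _ _ (nbhs t) (nbhs _) (nbhs _)); [exact: m1 | exact: m2].
by rewrite funeqE => x; rewrite [in LHS]fz.
Qed.

End SlashContinuity.

(** * The adelic lift *)

Lemma in_Zp_sub (p : primeT) (x y : padic p) : in_Zp x -> in_Zp y -> in_Zp (x - y).
Proof. by move=> [a ->] [b ->]; exists (a - b); rewrite rmorphB. Qed.

Lemma in_Zp_int (p : primeT) (m : int) : @in_Zp p m%:~R.
Proof. by exists m%:~R; rewrite intr_padic. Qed.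

Lemma dvdz_padic (N : nat) (a : int) : (0 < N)%N ->
  (forall p : primeT, exists t : padic_int p, a%:~R = N%:R * t) -> (N%:Z %| a)%Z.
Proof.
move=> N0 h; have N0' : N%:Z != 0 by rewrite eqz_nat -lt0n.
have [p|m em] := @rat_int_padic (a%:~R / N%:~R).
  have [t et] := h p; exists t.
  rewrite fmorph_div !rmorph_int -[a%:~R]intr_padic et rmorphM /= -[N%:R]/(N%:Z%:~R).
  by rewrite intr_padic mulrC mulKf // intr_padic_eq0.
apply/dvdzP; exists m; apply: (@intr_inj rat); rewrite intrM -em divfK //.
by rewrite intr_eq0.
Qed.

Lemma map_ratr_padicM (p : primeT) (A B : 'M[rat]_2) :
  map_mx ratr (A *m B) = map_mx ratr A *m map_mx ratr B :> 'M[padic p]_2.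
Proof. exact: (map_mxM (rat_padic p)). Qed.

Lemma map_ratr_padic_int (p : primeT) (A : 'M[int]_2) :
  map_mx ratr (map_mx intr A : 'M[rat]_2) = map_mx intr A :> 'M[padic p]_2.
Proof. by apply/matrixP => i j; rewrite !mxE ratr_int. Qed.

Lemma map_tofrac_int (p : primeT) (A : 'M[int]_2) :
  map_mx (@tofrac _) (map_mx intr A : 'M[padic_int p]_2) = map_mx intr A :> 'M[padic p]_2.
Proof. by apply/matrixP => i j; rewrite !mxE intr_padic. Qed.

Lemma map_tofracM (p : primeT) (A B : 'M[padic_int p]_2) :
  map_mx (@tofrac _) (A *m B) = map_mx (@tofrac _) A *m map_mx (@tofrac _) B :> 'M[padic p]_2.
Proof. exact: (map_mxM (@tofrac (padic_int p))). Qed.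

Lemma unit_int_abs1 (a : int) :
  (forall p : primeT, (a%:~R : padic_int p) \is a GRing.unit) -> `|a|%N = 1%N.
Proof.
move=> h; apply/eqP; apply: contraT => a1.
have [q pq qa] : exists2 q, prime q & (q %| `|a|)%N.
  case: (posnP `|a|) => [->|a0]; first by exists 2%N; rewrite ?dvdn0.
  exists (pdiv `|a|); last exact: pdiv_dvd.
  by apply: pdiv_prime; rewrite ltn_neqAle eq_sym a1.
have /unitrPr[t et] := h (exist _ q pq).
have /dvdzP[m em] : (q%:Z %| a)%Z by rewrite dvdzE.
have : (1%:~R : padic_int (exist _ q pq)) = q%:R * (m%:~R * t).
  by rewrite mulrA [_ * m%:~R]mulrC -[q%:R]/(q%:Z%:~R) -intrM -em et.
move/padic_int_dvd; rewrite dvdn1 => /eqP /= q1.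
by have := pq; rewrite {1}q1.
Qed.

Lemma mulmx4A (K : pzSemiRingType) (m : nat) (A B C D : 'M[K]_m) :
  A *m (B *m (C *m D)) = A *m (B *m C) *m D.
Proof. by rewrite !mulmxA. Qed.

Section AdelicLift.
Variables (R : realType) (k : int) (N : nat) (chi : int -> R[i]) (f : R[i] -> R[i]).
Local Notation C := R[i].
Hypothesis N0 : (0 < N)%N.
Hypothesis hchi : dirichlet_character N chi.
Hypothesis hf : automorphic k N f (fun g => chi (g 1 1)).

Let im_i : 0 < complex.Im (0 +i* 1 : C)%C. Proof. exact: ltr01. Qed.

(** The two decompositions differ by a rational matrix that is integral and invertible at every p
    and has positive determinant, that is by some r in Gamma_0(N). It multiplies the slash by
    chi(r11), and n' = r11 n modulo N makes chi^-1 compensate. *)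
Lemma decomposition_unique (gam gam' : 'M[rat]_2) (goo goo' : 'M[R]_2)
    (kf kf' : forall p : primeT, 'M[padic_int p]_2) (n n' : int) :
  \det gam != 0 -> 0 < \det goo -> K0 N kf ->
  (forall p, exists t, kf p 1 1 - n%:~R = N%:R * t) ->
  \det gam' != 0 -> 0 < \det goo' -> K0 N kf' ->
  (forall p, exists t, kf' p 1 1 - n'%:~R = N%:R * t) ->
  amul (diagQ R gam) (decomp goo kf) = amul (diagQ R gam') (decomp goo' kf') ->
  slash k f goo' (0 +i* 1)%C * (chi n')^-1 = slash k f goo (0 +i* 1)%C * (chi n)^-1.
Proof.
move=> dg dgo hk hn dg' dgo' hk' hn' [eoo ef].
have ugam' : gam' \in unitmx by rewrite unitmxE unitfE.
have [rho egam] : exists rho, gam = gam' *m rho.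
  by exists (invmx gam' *m gam); rewrite mulmxA mulmxV // mul1mx.
have eR : goo' = map_mx ratr rho *m goo.
  have ug : (map_mx ratr gam' : 'M[R]_2) \in unitmx by rewrite map_unitmx.
  apply: (can_inj (mulKmx ug)); rewrite -eoo mulmxA -map_mxM -egam //.
have eP p : map_mx ratr rho = map_mx (@tofrac _) (kf' p *m invmx (kf p)) :> 'M[padic p]_2.
  have ug : (map_mx ratr gam' : 'M[padic p]_2) \in unitmx.
    by rewrite -[ratr]/(rat_padic p) map_unitmx.
  apply: (can_inj (mulKmx ug)); rewrite -map_ratr_padicM -egam.
  rewrite map_tofracM mulmxA.
  have /(congr1 (fun h : forall p, 'M[padic p]_2 => h p)) /= := ef => <-.
  by rewrite -mulmxA -map_tofracM mulmxV ?map_mx1 ?mulmx1 //; have [] := hk p.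
have rhoZ i j : exists m : int, rho i j = m%:~R.
  apply: rat_int_padic => p; exists ((kf' p *m invmx (kf p)) i j).
  by have /matrixP/(_ i j) := eP p; rewrite !mxE.
have [r rhoE] : exists r : 'M[int]_2, rho = map_mx intr r.
  exists (\matrix_(i, j) numq (rho i j)).
  by apply/matrixP => i j; rewrite !mxE; have [m ->] := rhoZ i j; rewrite numq_int.
have eZ p : map_mx intr r = kf' p *m invmx (kf p) :> 'M[padic_int p]_2.
  apply/matrixP => i j; have /matrixP/(_ i j) := eP p.
  by rewrite rhoE map_ratr_padic_int !mxE -intr_padic => /eqP; rewrite tofrac_eq => /eqP.
have kr p : kf' p = map_mx intr r *m kf p.
  by rewrite eZ -mulmxA mulVmx ?mulmx1 //; have [] := hk p.
have {}eR : goo' = map_mx intr r *m goo.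
  by rewrite eR rhoE; congr (_ *m _); apply/matrixP => i j; rewrite !mxE ratr_int.
have dr : \det r = 1.
  have dr0 : 0 < \det r.
    by move: dgo'; rewrite eR det_mulmx det_map_mx pmulr_lgt0 // ltr0z.
  have : `|\det r|%N = 1%N.
    apply: unit_int_abs1 => p; rewrite -det_map_mx eZ det_mulmx det_inv unitrM unitrV.
    by rewrite -!unitmxE; have [-> _] := hk p; have [-> _] := hk' p.
  by move=> d1; rewrite -(gtz0_abs dr0) d1.
have r10 : (N%:Z %| r 1%R 0%R)%Z.
  apply: dvdz_padic => // p.
  have [[_ [t' et']] [u [t et]]] := (hk' p, hk p).
  exists ((t' * kf p 1 1 - kf' p 1 1 * t) * (\det (kf p))^-1).
  have e0 := congr1 (fun A : 'M[padic_int p]_2 => A 1 0) (kr p).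
  have e1 := congr1 (fun A : 'M[padic_int p]_2 => A 1 1) (kr p).
  rewrite mulmx2E !mxE in e0; rewrite mulmx2E !mxE in e1.
  apply: (mulIr (x := \det (kf p))); rewrite -?unitmxE // -!mulrA mulVr -?unitmxE // mulr1.
  rewrite mulrBr mulrA -et' mulrCA -et e0 e1 [in LHS](mx22_eta (kf p)) mx22_det.
  by ring.
have r11 : (N%:Z %| n' - r 1%R 1%R * n)%Z.
  apply: dvdz_padic => // p.
  have [t et] := hn p; have [t' et'] := hn' p; have /dvdzP[m em] := r10.
  exists (m%:~R * kf p 0 1 + (r 1 1)%:~R * t - t').
  have := congr1 (fun A : 'M[padic_int p]_2 => A 1 1) (kr p); rewrite mulmx2E !mxE em => e.
  rewrite rmorphB rmorphM /= mulrBr mulrDr -et' e intrM -[N%:R]/(N%:Z%:~R).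
  rewrite [_ * (_%:~R * t)]mulrCA -[N%:Z%:~R]/(N%:R) -et -[N%:R]/(N%:Z%:~R).
  by ring.
have chin : chi n' = chi (r 1 1) * chi n.
  have [_ cM _ _] := hchi; rewrite -cM.
  exact: (chi_cong hchi).
have chir : chi (r 1 1) != 0.
  have [_ _ _ ->] := hchi; apply/coprimezP.
  have /dvdzP[m em] := r10; have := (SL2ZE r).1 dr; rewrite em => e1.
  by exists (r 0 0, - r 0 1 * m) => /=; rewrite -e1; ring.
have rdet : \det (map_mx intr r : 'M[R]_2) = 1 by rewrite det_map_mx dr.
rewrite eR slash_mul ?rdet //.
rewrite (@slash_ext R k _ (fun z => chi (r 1 1) * f z + 0 * f z) goo) //; last first.
  by move=> w w0; rewrite -[slash _ _ _ _]/(slashZ k f r w) hf //; ring.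
by rewrite slash_lin mul0r addr0 chin invfM mulrACA divff // mul1r.
Qed.

Lemma adelic_lift_value (gam : 'M[rat]_2) (goo : 'M[R]_2)
    (kf : forall p : primeT, 'M[padic_int p]_2) (n : int) :
  \det gam != 0 -> 0 < \det goo -> K0 N kf ->
  (forall p, exists t, kf p 1 1 - n%:~R = N%:R * t) ->
  adelic_lift k N chi f (amul (diagQ R gam) (decomp goo kf)) =
  slash k f goo (0 +i* 1)%C * (chi n)^-1.
Proof.
move=> dg dgo hk hn; apply: xget_unique; first by exists gam, goo, kf, n; split.
move=> w [gam' [goo' [kf' [n' [[dg' dgo'] hk' hn' eg ->]]]]].
exact: decomposition_unique eg.
Qed.

Variables (gam : 'M[int]_2) (kf : forall p : primeT, 'M[padic_int p]_2) (n : int).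
Hypothesis sgam : SL2Z gam.
Hypothesis hk : K0 N kf.
Hypothesis hn : forall p, exists t, kf p 1 1 - n%:~R = N%:R * t.

(** Moving the rational matrix out of the finite places to the real place turns the translation by
    (x, j) into the real translation by (x - j)/al. *)
Lemma adelic_lift_unip (al : rat) (y : R) (g : adele_mx R) (x : R) (j : nat) :
  al != 0 -> 0 < y -> g.1 = mx22 (ratr al * y) 0 0 1 ->
  (forall p, g.2 p = mx22 (ratr al) 0 0 1 *m (map_mx intr (invmx gam) *m map_mx (@tofrac _) (kf p))) ->
  adelic_lift k N chi f (amul (unip (x, fun p => j%:R)) g) =
  slashZ k f gam ((x - j%:R) / ratr al +i* y)%C * (chi n)^-1.
Proof.
move=> al0 y0 g1 g2.
have al0' : ratr al != 0 :> R by rewrite fmorph_eq0.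
have ugam : gam \in unitmx by rewrite unitmxE sgam.
have uM (K : comUnitRingType) : (map_mx intr gam : 'M[K]_2) \in unitmx.
  by rewrite unitmxE det_map_mx sgam unitr1.
pose G : 'M[rat]_2 := mx22 1 j%:R 0 1 *m (mx22 al 0 0 1 *m map_mx intr (invmx gam)).
pose goo := map_mx intr gam *m mx22 y ((x - j%:R) / ratr al) 0 1 : 'M[R]_2.
have dgR : \det (map_mx intr gam : 'M[R]_2) = 1 by rewrite det_map_mx sgam.
have du : \det (mx22 y ((x - j%:R) / ratr al) 0 1) = y :> R by rewrite mx22_det; ring.
have -> : amul (unip (x, fun p => j%:R)) g = amul (diagQ R G) (decomp goo kf).
  rewrite /amul /= g1; congr pair.
    have e : map_mx ratr (map_mx intr (invmx gam) : 'M[rat]_2) *m map_mx intr gam = 1%:M :> 'M[R]_2.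
      rewrite -(map_mx1 (intr : int -> R)) -(mulVmx ugam) map_mxM; congr (_ *m _).
      by apply/matrixP => a b; rewrite !mxE ratr_int.
    rewrite /G /goo !map_mxM -!mulmxA [map_mx ratr (map_mx intr _) *m (_ *m _)]mulmxA e mul1mx.
    rewrite !mx22_map /= !rmorph1 !rmorph0 rmorph_nat !mx22_mul.
    by apply: mx22_inj; field.
  apply: boolp.functional_extensionality_dep => p; rewrite g2 /G !map_ratr_padicM map_ratr_padic_int.
  have -> : map_mx ratr (mx22 1 j%:R 0 1) = mx22 1 j%:R 0 1 :> 'M[padic p]_2.
    by rewrite mx22_map ratr_nat -[ratr 1]/(rat_padic p 1) -[ratr 0]/(rat_padic p 0) rmorph0 rmorph1.
  have -> : map_mx ratr (mx22 al 0 0 1) = mx22 (ratr al) 0 0 1 :> 'M[padic p]_2.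
    by rewrite mx22_map -[ratr 1]/(rat_padic p 1) -[ratr 0]/(rat_padic p 0) rmorph0 rmorph1.
  exact: mulmx4A.
rewrite (@adelic_lift_value G goo kf n) //; last first.
- by rewrite /goo det_mulmx dgR du mul1r.
- rewrite /G !det_mulmx det_map_mx det_inv sgam invr1 rmorph1 !mx22_det.
  by rewrite !mulr1 !mul0r ?mulr0 !subr0 mul1r.
rewrite /goo slash_mul ?dgR ?du // slash_unip.
by rewrite mulr0 add0r.
Qed.

(** Any rational admissible in [psi] is here integral at every p, hence an integer, which e2pi does
    not see. *)
Lemma psi_nat (x : R) (j : nat) : psi (- x, fun p => - j%:R) = e2pi (- x).
Proof.
rewrite /psi /=; set r := xget _ _.
have hr : forall p : primeT, in_Zp (- j%:R - ratr r : padic p).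
  apply: (@xgetPex _ 0 [set r : rat | forall p, in_Zp (- j%:R - ratr r : padic p)]%classic).
  by exists 0 => p; rewrite -[ratr]/(rat_padic p) rmorph0 subr0; exists (- j%:R); rewrite rmorphN rmorph_nat.
have [p|m ->] := @rat_int_padic r.
  have := in_Zp_sub (in_Zp_int p (- j%:Z)) (hr p).
  by rewrite mulrNz -pmulrn opprB addrCA subrr addr0.
by rewrite ratr_int -mulrNz e2pi_int.
Qed.

(** The Whittaker value is the r-th Fourier coefficient of f|gam at height y. The denominator N in
    r/N is there because f|gam has period N, which the substitution N t rescales to 1. *)
Lemma whittaker_value (r : int) (y : R) (g : adele_mx R) : smooth f ->
  r != 0 -> 0 < y -> g.1 = mx22 (ratr (r%:~R / N%:R) * y) 0 0 1 ->
  (forall p, g.2 p = mx22 (ratr (r%:~R / N%:R)) 0 0 1 *m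
     (map_mx intr (invmx gam) *m map_mx (@tofrac _) (kf p))) ->
  whittaker (adelic_lift k N chi f) g =
  (chi n)^-1 * cint (fun t => slashZ k f gam (N%:R * t +i* y)%C * e2pi (- (r%:~R * t))).
Proof.
move=> sf r0 y0 g1 g2.
have N0' : N%:R != 0 :> rat by rewrite pnatr_eq0 -lt0n.
have N0R : N%:R != 0 :> R by rewrite pnatr_eq0 -lt0n.
have r0' : r%:~R != 0 :> R by rewrite intr_eq0.
have al0 : r%:~R / N%:R != 0 :> rat by rewrite mulf_neq0 ?invr_eq0 ?intr_eq0.
have dgR : \det (map_mx intr gam : 'M[R]_2) = 1 by rewrite det_map_mx sgam.
pose F (t : R) := slashZ k f gam (N%:R * t +i* y)%C.
have cF : ccont F.
  have c1 : ccont (fun t : R => slashZ k f gam (t +i* y)%C) by apply: ccont_slash; rewrite ?dgR.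
  have := ccont_affine N%:R 0 c1; congr ccont; rewrite funeqE => t; by rewrite addr0.
have per x : F (x + 1) = F x.
  have y0' : 0 < complex.Im (N%:R * x +i* y : C)%C by [].
  have -> : F (x + 1) = slashZ k (slashZ k f gam) (upp N) (N%:R * x +i* y)%C.
    rewrite slashZ_upp /F; congr (slashZ k f gam _).
    by rewrite -pmulrn -(rmorph_nat (real_complex R)); simpc; rewrite mulrDr mulr1.
  rewrite -slashZ_mul //; last exact: SL2Z_upp.
  apply: (slash_cong hchi hf) => //.
  - by apply: SL2Z_mul => //; exact: SL2Z_upp.
  - by rewrite mulmx2E !mx22E mulr1 mulr0 addr0 subrr dvdz0.
  - by rewrite mulmx2E !mx22E mulr1 addrK dvdz_mull.
rewrite /whittaker (@integral_QA_periodic R _ (fun t => (chi n)^-1 * F t + 0 * F t) r r0).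
- rewrite -[RHS](_ : (chi n)^-1 * cint (fun t => F t * e2pi (- (r%:~R * t))) +
    0 * cint (fun t => F t * e2pi (- (r%:~R * t))) = _); last by rewrite mul0r addr0.
  rewrite -cint_lin; try by apply: ccontM => //; exact: ccont_e2pi.
  by congr cint; rewrite funeqE => t; ring.
- by apply: ccontD; apply: ccontM => //; exact: ccont_cst.
- by move=> x; rewrite per.
- move=> x j; rewrite /= psi_nat (@adelic_lift_unip (r%:~R / N%:R) y) // mul0r addr0.
  have -> : (x - j%:R) / ratr (r%:~R / N%:R) = N%:R * ((x - j%:R) / r%:~R) :> R.
    by rewrite fmorph_div /= ratr_int ratr_nat; field; rewrite N0R r0'.
  by congr (_ * _); exact: mulrC.
Qed.

End AdelicLift.

(** * Euler products and local invariance *)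

Lemma complex_eq0_small (R : realType) (z c : R[i]) : 0 <= c ->
  (forall eps : R, 0 < eps -> `|z| <= eps%:C%C * c) -> z = 0.
Proof.
move=> c0 h; apply/eqP; rewrite -normr_eq0; apply: contraT => z0.
have := h ((complex.Re `|z|) / (complex.Re c + 1)).
have zr : `|z| = (complex.Re `|z|)%:C%C by rewrite normc_def.
have cr : c = (complex.Re c)%:C%C.
  by move: c0; rewrite lecE /= => /andP[/eqP e _]; case: (c) e => a b /= ->.
have rc : 0 <= complex.Re c by move: c0; rewrite lecE /= => /andP[].
have rz : 0 < complex.Re `|z|.
  have : 0 < `|z| by rewrite lt_def z0 normr_ge0.
  by rewrite ltcE /= => /andP[].
have e0 : 0 < complex.Re `|z| / (complex.Re c + 1) by rewrite divr_gt0 //; lra.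
move=> /(_ e0); rewrite [in X in X <= _]zr [in X in _ <= _ * X]cr -rmorphM /= lecR.
rewrite mulrAC ler_pdivlMr; last by lra.
by rewrite mulrDr mulr1 gerDl leNgt rz.
Qed.

Section EulerProduct.
Variables (R : realType) (Woo : 'M[R]_2 -> R[i]) (W : forall p : primeT, 'M[padic p]_2 -> R[i]).
Local Notation C := R[i].
Implicit Types g : adele_mx R.

Definition partial g n := Woo g.1 * \prod_(i < n) at_prime 1 (fun p => W (g.2 p)) i.

Lemma euler_lim g g' (w w' a b : C) (n1 : nat) :
  euler_product Woo W g w -> euler_product Woo W g' w' ->
  (forall n, (n1 <= n)%N -> a * partial g n = b * partial g' n) -> a * w = b * w'.
Proof.
move=> h h' e; apply/eqP; rewrite -subr_eq0; apply/eqP.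
apply: (@complex_eq0_small _ _ (`|a| + `|b|)); first by rewrite addr_ge0.
move=> eps e0; have [n2 h2] := h _ e0; have [n3 h3] := h' _ e0.
pose n := maxn n1 (maxn n2 n3).
have {}h2 : `|partial g n - w| < eps%:C%C by apply: h2; rewrite /n; lia.
have {}h3 : `|partial g' n - w'| < eps%:C%C by apply: h3; rewrite /n; lia.
have {}e := e n (leq_maxl _ _).
have -> : a * w - b * w' = b * (partial g' n - w') - a * (partial g n - w).
  by rewrite !mulrBr e; ring.
apply: le_trans (ler_normB _ _) _; rewrite !normrM.
have -> : eps%:C%C * (`|a| + `|b|) = `|b| * eps%:C%C + `|a| * eps%:C%C by ring.
exact: lerD (ler_wpM2l (normr_ge0 b) (ltW h3)) (ler_wpM2l (normr_ge0 a) (ltW h2)).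
Qed.

Lemma at_prime_val (T : Type) (x0 : T) (F : primeT -> T) (p : primeT) :
  at_prime x0 F (val p) = F p.
Proof. by rewrite /at_prime valK. Qed.

Lemma partial_bigD1 g (p : primeT) n : (val p < n)%N ->
  partial g n = W (g.2 p) *
   (Woo g.1 * \prod_(i < n | i != val p :> nat) at_prime 1 (fun p => W (g.2 p)) i).
Proof.
move=> pn; rewrite /partial (bigD1 (Ordinal pn)) //= at_prime_val mulrCA.
by congr (_ * (_ * _)); apply: eq_bigl => i.
Qed.

Lemma euler_eq0 g w (p : primeT) : euler_product Woo W g w -> W (g.2 p) = 0 -> w = 0.
Proof.
move=> h e; rewrite -[w]mul1r -(mul0r w); apply: (euler_lim (n1 := (val p).+1) h h) => n pn.
by rewrite (partial_bigD1 g pn) e !mul0r mulr0.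
Qed.

(** The factors away from p coincide; the relation is cross-multiplied because either factor at p
    may be 0. *)
Lemma euler_swap g g' w w' (p : primeT) :
  euler_product Woo W g w -> euler_product Woo W g' w' ->
  g.1 = g'.1 -> (forall p' : primeT, p' != p -> g.2 p' = g'.2 p') ->
  W (g'.2 p) * w = W (g.2 p) * w'.
Proof.
move=> h h' e1 e2; apply: (euler_lim (n1 := (val p).+1) h h') => n pn.
rewrite (partial_bigD1 g pn) (partial_bigD1 g' pn) mulrCA e1.
do 3 congr (_ * _); apply: eq_bigr => i ip; rewrite /at_prime; case: insubP => //= u _ ui.
by rewrite e2 //; apply: contraNneq ip => e; rewrite -ui e.
Qed.

End EulerProduct.

(** * Right invariance of the global Whittaker function under K_1(N) *)

Section RightInvariance.
Variables (R : realType) (k : int) (N : nat) (chi : int -> R[i]) (f : R[i] -> R[i]).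

Definition K1 (kf : forall p : primeT, 'M[padic_int p]_2) : Prop :=
  K0 N kf /\ forall p, exists t, kf p 1 1 - 1 = N%:R * t.

Definition rmul (X : adele_mx R) (kf : forall p : primeT, 'M[padic_int p]_2) : adele_mx R :=
  (X.1, fun p => X.2 p *m map_mx (@tofrac _) (kf p)).

Lemma K1_inv kf : K1 kf -> K1 (fun p => invmx (kf p)).
Proof.
move=> [h0 h1].
have inv_entries p : let d := (\det (kf p))^-1 in d * \det (kf p) = 1 /\
    invmx (kf p) = mx22 (d * kf p 1 1) (- d * kf p 0 1) (- d * kf p 1 0) (d * kf p 0 0).
  have [u _] := h0 p; have ud : \det (kf p) \is a GRing.unit by rewrite -unitmxE.
  split; first by rewrite mulVr.
  set d := (\det _)^-1.
  have e : d * \det (kf p) = 1 by rewrite mulVr.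
  apply: (can_inj (mulKmx u)); rewrite mulmxV //.
  rewrite [in RHS](mx22_eta (kf p)) mx22_mul !mx22E mx22_1.
  move: e; rewrite [in \det _](mx22_eta (kf p)) mx22_det => e.
  by apply: mx22_inj; rewrite -?e; ring.
split=> p; have [u [t et]] := h0 p; have [t' et'] := h1 p; have /= [ed ->] := inv_entries p.
  split; first by rewrite -[X in X \in _](inv_entries p).2 unitmx_inv.
  by exists (- (\det (kf p))^-1 * t); rewrite mx22E et; ring.
rewrite mx22E; set d := (\det _)^-1 in ed *.
exists (d * (kf p 0 1 * t - kf p 0 0 * t')).
rewrite -[in LHS]ed [in \det _](mx22_eta (kf p)) mx22_det.
rewrite [RHS](_ : _ = d * (kf p 0 1 * (N%:R * t) - kf p 0 0 * (N%:R * t'))); last by ring.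
by rewrite -et -et'; ring.
Qed.

(** Multiplying by an element of K_1(N) carries decompositions to decompositions with the same n,
    and its inverse carries them back. *)
Lemma adelic_lift_rmul X kf : K1 kf ->
  adelic_lift k N chi f (rmul X kf) = adelic_lift k N chi f X.
Proof.
move=> hk; rewrite /adelic_lift; congr xget.
have inc Y kf1 w : K1 kf1 -> (exists (gam : 'M[rat]_2) (goo : 'M[R]_2)
      (kf : forall p : primeT, 'M[padic_int p]_2) (n : int),
    [/\ \det gam != 0 /\ 0 < \det goo, K0 N kf,
        forall p, exists t, kf p 1 1 - n%:~R = N%:R * t,
        Y = amul (diagQ R gam) (decomp goo kf)
      & w = slash k f goo (0 +i* 1)%C * (chi n)^-1]) ->
    (exists (gam : 'M[rat]_2) (goo : 'M[R]_2)
      (kf : forall p : primeT, 'M[padic_int p]_2) (n : int),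
    [/\ \det gam != 0 /\ 0 < \det goo, K0 N kf,
        forall p, exists t, kf p 1 1 - n%:~R = N%:R * t,
        rmul Y kf1 = amul (diagQ R gam) (decomp goo kf)
      & w = slash k f goo (0 +i* 1)%C * (chi n)^-1]).
  move=> [h0 h1] [gam [goo [kf2 [n [hd hk2 hn -> ->]]]]].
  exists gam, goo, (fun p => kf2 p *m kf1 p), n; split => //.
  - move=> p; have [u [t et]] := h0 p; have [u2 [t2 et2]] := hk2 p.
    split; first by rewrite unitmx_mul u2 u.
    exists (t2 * kf1 p 0 0 + kf2 p 1 1 * t); rewrite mulmx2E et et2; ring.
  - move=> p; have [u2 [t2 et2]] := hk2 p; have [t1 et1] := h1 p; have [t et] := hn p.
    exists (t2 * kf1 p 0 1 + kf2 p 1 1 * t1 + t); rewrite mulmx2E et2 !mulrDr -et.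
    by rewrite [N%:R * (kf2 p 1 1 * t1)]mulrCA -et1; ring.
  - rewrite /rmul /amul /=; congr pair; apply: boolp.functional_extensionality_dep => p.
    by rewrite map_tofracM mulmxA.
have invK Y : rmul (rmul Y kf) (fun p => invmx (kf p)) = Y.
  rewrite /rmul /=; case: Y => Y1 Y2 /=; congr pair; apply: boolp.functional_extensionality_dep => p.
  by rewrite -mulmxA -map_tofracM mulmxV ?map_mx1 ?mulmx1 //; have [h _] := hk; have [] := h p.
rewrite predeqE => w /=; split; last exact: inc.
by move=> h; have := inc _ _ _ (K1_inv hk) h; rewrite invK.
Qed.

Lemma whittaker_rmul X kf : K1 kf ->
  whittaker (adelic_lift k N chi f) (rmul X kf) = whittaker (adelic_lift k N chi f) X.
Proof.
move=> hk; rewrite /whittaker; congr integral_QA; rewrite funeqE => u; congr (_ * _).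
rewrite -(adelic_lift_rmul (amul (unip u) X) hk) /amul /rmul /=; congr adelic_lift.
by congr pair; apply: boolp.functional_extensionality_dep => p; rewrite mulmxA.
Qed.

End RightInvariance.

(** * Right invariance of the local factors *)

Section LocalInvariance.
Variables (R : realType) (N : nat) (whit : adele_mx R -> R[i]).
Variables (Woo : 'M[R]_2 -> R[i]) (W : forall p : primeT, 'M[padic p]_2 -> R[i]).
Hypothesis hW : forall g : adele_mx R, GL2A g -> euler_product Woo W g (whit g).
Hypothesis whit_rmul : forall X kf, K1 N kf -> whit (rmul X kf) = whit X.

Definition upd (g : adele_mx R) (p : primeT) (h : 'M[padic p]_2) : adele_mx R :=
  (g.1, @eqtype.dfwith _ _ g.2 p h).

Lemma upd_in g p h : (@upd g p h).2 p = h.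
Proof. exact: dfwith_in. Qed.

Lemma upd_out g p h p' : p' != p -> (@upd g p h).2 p' = g.2 p'.
Proof. by move=> np; apply: dfwith_out; rewrite eq_sym. Qed.

Lemma GL2A_upd g p h : GL2A g -> h \in unitmx -> GL2A (@upd g p h).
Proof.
move=> [u1 u2 [B hB]] uh; split; first exact: u1.
  move=> p'; have [->|np] := eqVneq p' p; first by rewrite upd_in.
  rewrite upd_out; [exact: u2 | exact: np].
exists (maxn B (val p).+1) => p'; rewrite geq_max => /andP[h1 h2].
rewrite upd_out; first exact: hB.
by rewrite -val_eqE neq_ltn h2 orbT.
Qed.

(** Invariance is known only globally. Placing h at p inside a point [g0] of nonzero Whittaker value
    lets the other factors be cancelled. *)
Lemma local_invariance g0 (p : primeT) (h : 'M[padic p]_2) (kp : 'M[padic_int p]_2) :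
  GL2A g0 -> whit g0 != 0 -> h \in unitmx -> kp \in unitmx ->
  (exists t, kp 1 0 = N%:R * t) -> (exists t, kp 1 1 - 1 = N%:R * t) ->
  W (h *m map_mx (@tofrac _) kp) = W h.
Proof.
move=> G0 w0 uh uk h10 h11.
pose kf : forall p : primeT, 'M[padic_int p]_2 := @eqtype.dfwith _ _ (fun p => 1%:M) p kp.
have hk : K1 N kf.
  split=> p'; rewrite /kf; have [->|np] := eqVneq p' p.
  - by rewrite dfwith_in.
  - rewrite dfwith_out 1?eq_sym //; split; first exact: unitmx1.
    by exists 0; rewrite mx22_1 mx22E mulr0.
  - by rewrite dfwith_in.
  - by rewrite dfwith_out 1?eq_sym //; exists 0; rewrite mx22_1 mx22E mulr0 subrr.
have ukp : map_mx (@tofrac _) kp \in (unitmx : {pred 'M[padic p]_2}).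
  move: uk; rewrite !unitmxE det_map_mx; exact: rmorph_unit.
have G1 := GL2A_upd G0 uh.
have G2 : GL2A (@upd g0 p (h *m map_mx (@tofrac _) kp)).
  by apply: (GL2A_upd G0); rewrite unitmx_mul uh ukp.
have ew : whit (@upd g0 p (h *m map_mx (@tofrac _) kp)) = whit (@upd g0 p h).
  rewrite -(whit_rmul (@upd g0 p h) hk); congr whit.
  rewrite /upd /rmul /=; congr pair; apply: boolp.functional_extensionality_dep => p'.
  rewrite /kf; have [e|np] := eqVneq p p'; first by case: p' / e; rewrite !dfwith_in.
  by rewrite !dfwith_out // map_mx1 mulmx1.
have out h' p' : p' != p -> g0.2 p' = (@upd g0 p h').2 p'.
  by move=> np; rewrite upd_out.
have s1 := euler_swap (hW G0) (hW G1) erefl (out _).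
have s2 := euler_swap (hW G0) (hW G2) erefl (out _).
rewrite upd_in in s1; rewrite upd_in ew in s2.
exact: (mulIf w0 (etrans s2 (esym s1))).
Qed.

End LocalInvariance.

(** * The multiplicativity relation *)

Lemma vQ_muln (p : nat) (al : rat) (m : nat) : al != 0 -> (0 < m)%N ->
  vQ p (al * m%:R) = vQ p al + (logn p m)%:Z.
Proof.
move=> al0 m0; set x := al * m%:R.
have x0 : x != 0 by rewrite mulf_neq0 // pnatr_eq0 -lt0n.
have e : numq x * denq al = numq al * m%:Z * denq x.
  apply: (@intr_inj rat); rewrite !intrM !numqE /x -[m%:~R]/(m%:R); ring.
have := congr1 (fun z : int => logn p `|z|%N) e.
have n0 z : z != 0 -> (0 < `|numq z|)%N by move=> z0; rewrite absz_gt0 numq_eq0.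
have d0 z : (0 < `|denq z|)%N by rewrite absz_gt0 denq_neq0.
rewrite !abszM !lognM ?muln_gt0 ?n0 ?d0 ?m0 //= /vQ /vz; lia.
Qed.

Lemma vQ_coprime (p : nat) (al : rat) : ~~ (p %| `|numq al|)%N -> ~~ (p %| `|denq al|)%N ->
  vQ p al = 0.
Proof.
move=> h1 h2; rewrite /vQ /vz.
have e (a : nat) : ~~ (p %| a)%N -> logn p a = 0%N.
  by move=> pa; apply/eqP; rewrite -leqn0 leqNgt logn_gt0 mem_primes (negbTE pa) !andbF.
by rewrite !e // subrr.
Qed.

(** At primes dividing m both al and be are units, and at the others m is; so multiplication by m
    changes the local factors of h(al) and of h(be) in the same way. *)
Lemma multiplicative_relation (R : realType) (h : rat -> R[i]) (al be : rat) (m : nat) :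
  multiplicative_Qstar h -> al != 0 -> be != 0 -> (0 < m)%N ->
  coprime m (`|numq al| * `|denq al| * (`|numq be| * `|denq be|)) ->
  h (al * m%:R) * h be = h al * h (be * m%:R).
Proof.
move=> [hoo [hp [B [_ hB]]]] al0 be0 m0.
rewrite !coprimeMr => /andP[/andP[c1 c2] /andP[c3 c4]].
have mr0 : m%:R != 0 :> rat by rewrite pnatr_eq0 -lt0n.
pose n := (B + `|numq al| + `|denq al| + `|numq be| + `|denq be| +
  `|numq (al * m%:R)| + `|denq (al * m%:R)| + `|numq (be * m%:R)| + `|denq (be * m%:R)|).+1.
have sg x : sgz (x * m%:R : rat) = sgz x.
  by rewrite sgzM (gtr0_sgz (x := m%:R)) ?mulr1 // ltr0n.
rewrite !(hB _ _ n) ?mulf_neq0 //; try by rewrite /n; lia.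
rewrite !sg mulrACA [RHS]mulrACA -!big_split; congr (_ * _).
apply: eq_bigr => i _; rewrite /at_prime; case: insubP => [p pp pi|] //=.
rewrite !vQ_muln //.
have [pm|pm] := boolP (val p %| m)%N.
  have np a : coprime m a -> ~~ (val p %| a)%N.
    move=> ma; rewrite -prime_coprime; last exact: valP p.
    exact: coprime_dvdl pm ma.
  by rewrite !(vQ_coprime (np _ _)) ?np // mulrC.
have -> : logn (val p) m = 0%N.
  by apply/eqP; rewrite -leqn0 leqNgt logn_gt0 mem_primes (negbTE pm) !andbF.
by rewrite !addr0.
Qed.

Lemma exists_multiplier (q n N' D : nat) : prime q -> coprime N' q -> (0 < N')%N -> (0 < D)%N ->
  exists m : nat, [/\ (0 < m)%N, ((q ^ n)%N%:Z %| m%:Z + 1)%Z, (N'%:Z %| m%:Z - 1)%Z & coprime m (q * N' * D)].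
Proof.
move=> pq cN N0 D0; have [D' cD eD] := pfactor_coprime pq D0.
set e := logn q D in eD.
have D'0 : (0 < D')%N by move: D0; rewrite eD muln_gt0 => /andP[].
(* The exponent is positive even when n = 0, so that m = -1 modulo T already makes m prime to q. *)
pose T := (q ^ (n + e).+1)%N; pose L := (N' * D')%N.
have T0 : (0 < T)%N by rewrite expn_gt0 prime_gt0.
have cTL : coprime T L by rewrite coprimeXl // coprimeMr cD coprime_sym cN.
(* [T - 1] represents -1, and the added T L only guarantees m > 0. *)
pose m := (chinese T L (T - 1) 1 + T * L)%N.
have mT : ((m + 1) %% T = 0)%N.
  have := chinese_modl cTL (T - 1) 1; rewrite -/T => h.
  by rewrite /m -addnA -modnDml h modnDml [(T * L + 1)%N]addnC addnA subnK // addnC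
    -modnDml modnMr add0n modnn.
have mL : (m = 1 %[mod L])%N.
  by rewrite /m -modnDmr modnMl addn0 chinese_modr.
have dT : (T %| m + 1)%N by rewrite /dvdn mT.
have dL : (L%:Z %| m%:Z - 1)%Z.
  by rewrite -eqz_mod_dvd; apply/eqP; rewrite !modz_nat mL.
exists m; split.
- by rewrite /m addn_gt0 muln_gt0 T0 /L muln_gt0 N0 D'0 orbT.
- by rewrite dvdzE /=; apply: dvdn_trans dT; apply: dvdn_exp2l; lia.
- by apply: dvdz_trans dL; rewrite /L PoszM dvdz_mulr.
have cL : coprime m (N' * D') by rewrite -coprime_modl -/L mL coprime_modl coprime1n.
have cq : coprime m q.
  rewrite coprime_sym prime_coprime //; apply/negP => qm.
  have : (q %| m + 1)%N by apply: dvdn_trans dT; rewrite dvdn_exp.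
  by rewrite dvdn_addr // dvdn1 => /eqP q1; move: pq; rewrite q1.
rewrite !coprimeMr cq eD coprimeMr coprimeXr // andbT.
by move: cL; rewrite coprimeMr => /andP[-> ->].
Qed.

Lemma padic_multiple (p : primeT) (N : nat) (a : int) : (0 < N)%N ->
  ((val p ^ logn (val p) N)%N%:Z %| a)%Z -> exists t : padic_int p, a%:~R = N%:R * t.
Proof.
move=> N0 /dvdzP[m ->]; have [N' cN eN] := pfactor_coprime (valP p) N0.
have uN : (N'%:R : padic_int p) \is a GRing.unit by apply: coprime_unit; rewrite coprime_sym.
exists (m%:~R / N'%:R); rewrite [in RHS]eN natrM intrM -[X in _ * X]/((val p ^ logn (val p) N)%:R).
by rewrite mulrC -mulrA [RHS]mulrCA; congr (_ * _); rewrite mulrCA mulrV // mulr1.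
Qed.

Lemma diag_scale (p : primeT) (al : rat) (m : int) (g : 'M[int]_2) :
  mx22 (ratr (al * m%:~R)) 0 0 1 *m map_mx intr g =
  mx22 (ratr al) 0 0 1 *m map_mx intr (mx22 m 0 0 1 *m g) :> 'M[padic p]_2.
Proof.
have e : ratr (al * m%:~R) = ratr al * m%:~R :> padic p.
  by rewrite -(ratr_int (padic p)); apply: (rmorphM (rat_padic p)).
rewrite e map_mxM mulmxA; congr (_ *m _).
by rewrite mx22_map mx22_mul; apply: mx22_inj; rewrite ?mulr0z ?mulr1z; ring.
Qed.

(** Here u, u' are the local values at q for al, -al, and r is the product at the other primes of
    N1. If r or u vanishes, the last four hypotheses take over from division. *)
Lemma cross_relation (K : fieldType) (u u' r B B' w w' : K) : B != 0 ->
  u' * r * B = u * r * B' -> u' * w = u * w' ->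
  (r = 0 -> w = 0) -> (r = 0 -> w' = 0) -> (u = 0 -> w = 0) -> (u' = 0 -> w' = 0) ->
  B * w' = B' * w.
Proof.
move=> B0 rel sw rw rw' uw uw'.
have [r0|r0] := eqVneq r 0; first by rewrite rw // rw' // !mulr0.
have {}rel : u' * B = u * B' by apply: (mulfI r0); rewrite !mulrA ![r * _]mulrC.
have [u0|u0] := eqVneq u 0.
  rewrite (uw u0) mulr0; move/eqP: rel; rewrite u0 mul0r mulf_eq0 (negbTE B0) orbF.
  by move=> /eqP h; rewrite uw' // mulr0.
by apply: (mulfI u0); rewrite mulrCA -sw [RHS]mulrA -rel; ring.
Qed.

(** * Effect on Whittaker values of a change of sign at q alone *)

Section WhittakerRelation.
Variables (R : realType) (N : nat) (whit : adele_mx R -> R[i]).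
Variables (Woo : 'M[R]_2 -> R[i]) (W : forall p : primeT, 'M[padic p]_2 -> R[i]).
Variables (gam : 'M[int]_2) (q : primeT) (N1 : nat).
Local Notation C := R[i].
Hypothesis N0 : (0 < N)%N.
Hypothesis hW : forall g : adele_mx R, GL2A g -> euler_product Woo W g (whit g).
Hypothesis whit_rmul : forall X kf, K1 N kf -> whit (rmul X kf) = whit X.
Hypothesis sgam : SL2Z gam.
Hypothesis hB : multiplicative_Qstar (Bfun W N1 gam).
Hypothesis qN1 : val q \in primes N1.
Hypothesis N1N : {subset primes N1 <= primes N}.
Implicit Types (al be : rat) (p : primeT) (y : R).

Definition locmx p al : 'M[padic p]_2 := mx22 (ratr al) 0 0 1 *m map_mx intr (invmx gam).

Definition locW p al : C := W (locmx p al).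

Definition restW al : C := \prod_(i <- primes N1 | i != val q) at_prime 1 (fun p => locW p al) i.

Lemma BfunE al : Bfun W N1 gam al = locW q al * restW al.
Proof.
rewrite /Bfun (bigD1_seq (val q)) ?primes_uniq //=.
by rewrite -[X in at_prime _ _ X]/(val q) at_prime_val.
Qed.

Lemma locmx_unit p al : al != 0 -> locmx p al \in unitmx.
Proof.
move=> al0; rewrite unitmx_mul; apply/andP; split.
  rewrite unitmxE mx22_det mulr1 mul0r subr0 unitfE.
  by rewrite -[ratr]/(rat_padic p) fmorph_eq0.
by rewrite unitmxE det_map_mx det_inv sgam invr1 rmorph1 unitr1.
Qed.

Lemma GL2A_locmx (G1 : 'M[R]_2) (al be : rat) : G1 \in unitmx -> al != 0 -> be != 0 ->
  GL2A (G1, fun p => locmx p (if p == q then al else be)).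
Proof.
move=> u1 al0 be0; split=> //=; first by move=> p; apply: locmx_unit; case: ifP.
exists (`|numq al| + `|denq al| + `|numq be| + `|denq be|).+1 => p hp.
have co (a : int) : a != 0 -> (`|a| < val p)%N -> coprime `|a| (val p).
  move=> a0 h; rewrite coprime_sym prime_coprime; last exact: valP p.
  by rewrite gtnNdvd // absz_gt0.
have nz z : z != 0 :> rat -> numq z != 0 by rewrite numq_eq0.
have [u hu eu] : exists2 u : padic_int p, u \is a GRing.unit &
    rat_padic p (if p == q then al else be) = tofrac u.
  have [h1 h2 h3 h4] : [/\ (`|numq al| < val p)%N, (`|denq al| < val p)%N,
      (`|numq be| < val p)%N & (`|denq be| < val p)%N].
    have {}hp : (`|numq al| + `|denq al| + `|numq be| + `|denq be| < val p)%N := hp.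
    by move: (val p) hp => P hp; split; lia.
  by case: ifP => _; apply: rat_padic_unit; apply: co; rewrite ?denq_neq0 ?nz.
exists (mx22 u 0 0 1 *m map_mx intr (invmx gam)).
  rewrite unitmx_mul !unitmxE mx22_det mulr1 mul0r subr0 hu det_map_mx det_inv sgam.
  by rewrite invr1 rmorph1 unitr1.
rewrite map_tofracM map_tofrac_int /locmx mx22_map -[ratr _]/(rat_padic p _) eu.
by rewrite rmorph0 rmorph1.
Qed.

(** diag(m, 1) gam^-1 = gam^-1 kap with kap = gam diag(m, 1) gam^-1, and kap is congruent to 1 on
    its lower row when m is 1 modulo the p-part of N. *)
Lemma locW_mul g0 p al (m : int) : GL2A g0 -> whit g0 != 0 -> al != 0 ->
  coprime `|m| (val p) -> ((val p ^ logn (val p) N)%N%:Z %| m - 1)%Z ->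
  locW p (al * m%:~R) = locW p al.
Proof.
move=> G0 w0 al0 cm dm.
pose gi := invmx gam; have ug : gam \in unitmx by rewrite unitmxE sgam.
pose kap := gam *m mx22 m 0 0 1 *m gi.
have giE : gi = mx22 (gam 1 1) (- gam 0 1) (- gam 1 0) (gam 0 0).
  rewrite /gi [in LHS](mx22_eta gam) mx22_inv //; exact: (SL2ZE gam).1.
have sg1 := (SL2ZE gam).1 sgam.
have k10 : kap 1 0 = (m - 1) * (gam 1 0 * gam 1 1).
  by rewrite /kap giE [in LHS](mx22_eta gam) !mx22_mul !mx22E; ring.
have k11 : kap 1 1 = 1 - (m - 1) * (gam 0 1 * gam 1 0).
  have -> : kap 1 1 = (gam 0 0 * gam 1 1 - gam 0 1 * gam 1 0) - (m - 1) * (gam 0 1 * gam 1 0).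
    by rewrite /kap giE [in LHS](mx22_eta gam) !mx22_mul !mx22E; ring.
  by rewrite sg1.
have kdet : \det kap = m.
  by rewrite /kap !det_mulmx mx22_det /gi det_inv sgam invr1; ring.
have ek : gi *m kap = mx22 m 0 0 1 *m gi by rewrite /kap !mulmxA mulVmx // mul1mx.
have [t et] := padic_multiple N0 dm.
rewrite /locW -(local_invariance hW whit_rmul (kp := map_mx intr kap) G0 w0 (locmx_unit p al0)).
- congr W; rewrite map_tofrac_int /locmx.
  by rewrite diag_scale -ek map_mxM mulmxA.
- by rewrite unitmxE det_map_mx kdet; apply: coprime_unitz.
- exists (t * (gam 1 0 * gam 1 1)%:~R); rewrite mxE k10 intrM et; ring.
- by exists (- t * (gam 0 1 * gam 1 0)%:~R); rewrite mxE k11 rmorphB rmorphM /= et; ring.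
Qed.

Lemma locW_relation g0 al be : GL2A g0 -> whit g0 != 0 -> al != 0 -> be != 0 ->
  (locW q (- al) * restW al) * (locW q be * restW be) =
  (locW q al * restW al) * (locW q (- be) * restW be).
Proof.
move=> G0 w0 al0 be0.
have pq : prime (val q) := valP q.
have [N' cN eN] := pfactor_coprime pq N0.
set n := logn _ N in eN.
have N'0 : (0 < N')%N by move: N0; rewrite eN muln_gt0 => /andP[].
have D0 : (0 < `|numq al| * `|denq al| * (`|numq be| * `|denq be|))%N.
  by rewrite !muln_gt0 !absz_gt0 !denq_neq0 !numq_eq0 al0 be0.
have [|m [m0 mT mN cm]] := @exists_multiplier (val q) n N' _ pq _ N'0 D0.
  by rewrite coprime_sym.
move: cm; rewrite coprimeMr [coprime m (val q * N')]coprimeMr => /andP[/andP[cmq cmN] cm].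
(* z m = (-z)(-m), where -m is 1 modulo q^n. *)
have h1 z : z != 0 -> locW q (z * m%:R) = locW q (- z).
  move=> z0; rewrite -[m%:R]/(m%:Z%:~R) -[z * _]mulrNN -intrN.
  apply: (locW_mul G0 w0); rewrite ?oppr_eq0 //.
    by rewrite abszN.
  by rewrite -opprD rpredN.
have h2 z : z != 0 -> restW (z * m%:R) = restW z.
  move=> z0; rewrite /restW big_seq_cond [RHS]big_seq_cond; apply: eq_bigr => i /andP[iN1 iq].
  rewrite /at_prime; case: insubP => [p _ pi|//].
  have {}pi : val p = i := pi.
  have pN : (val p ^ logn (val p) N %| N')%N.
    suff -> : logn (val p) N = logn (val p) N' by rewrite pfactor_dvdnn.
    rewrite eN lognM ?expn_gt0 ?(prime_gt0 pq) //.
    by rewrite lognX (logn_prime _ pq) pi (negbTE iq) muln0 addn0.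
  change (locW p (z * m%:~R) = locW p z).
  apply: (locW_mul G0 w0 z0).
    have : (val p %| N')%N.
      apply: dvdn_trans pN; rewrite dvdn_exp //.
      by rewrite logn_gt0 N1N // pi.
    by move=> h; apply: coprime_dvdr h cmN.
  by apply: dvdz_trans mN; rewrite dvdzE.
have := multiplicative_relation hB al0 be0 m0 cm.
rewrite (BfunE (al * m%:R)) (BfunE be) (BfunE al) (BfunE (be * m%:R)).
by rewrite (h1 _ al0) (h1 _ be0) (h2 _ al0) (h2 _ be0).
Qed.

(** With al = r/N, [gpt al al y] yields a Fourier coefficient of f|gam, and [gpt (- al) al y] its
    twist by the sign at q only. *)
Definition gpt al be y : adele_mx R :=
  (mx22 (ratr be * y) 0 0 1, fun p => locmx p (if p == q then al else be)).

Lemma gpt_oo al be y : (gpt al be y).1 = mx22 (ratr be * y) 0 0 1.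
Proof. exact: (erefl (mx22 (ratr be * y) 0 0 1)). Qed.

Lemma gpt_q al be y : (gpt al be y).2 q = locmx q al.
Proof. by rewrite /= eqxx. Qed.

Lemma gpt_out al be y p : p != q -> (gpt al be y).2 p = locmx p be.
Proof. by move=> pq; rewrite /= (negbTE pq). Qed.

Lemma GL2A_gpt al be y : al != 0 -> be != 0 -> 0 < y -> GL2A (gpt al be y).
Proof.
move=> al0 be0 y0; apply: GL2A_locmx => //.
rewrite unitmxE mx22_det mulr1 mul0r subr0 unitfE; apply: mulf_neq0.
  by rewrite fmorph_eq0.
exact: lt0r_neq0.
Qed.

(* Without this, failing unification attempts unfold rational arithmetic. *)
Local Opaque gpt.

Lemma gpt_euler al be y : al != 0 -> be != 0 -> 0 < y ->
  euler_product Woo W (gpt al be y) (whit (gpt al be y)).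
Proof. by move=> al0 be0 y0; apply: hW; exact: GL2A_gpt. Qed.

Lemma whit_swap al al' y : al != 0 -> al' != 0 -> 0 < y ->
  locW q al' * whit (gpt al al y) = locW q al * whit (gpt al' al y).
Proof.
move=> al0 al0' y0; rewrite /locW -(gpt_q al al y) -(gpt_q al' al y).
apply: (euler_swap (gpt_euler al0 al0 y0) (gpt_euler al0' al0 y0)).
  exact: etrans (gpt_oo _ _ _) (esym (gpt_oo _ _ _)).
by move=> p pq; exact: etrans (gpt_out _ _ _ pq) (esym (gpt_out _ _ _ pq)).
Qed.

Lemma whit_restW0 al be y : al != 0 -> be != 0 -> 0 < y -> restW be = 0 -> whit (gpt al be y) = 0.
Proof.
move=> al0 be0 y0 /eqP; rewrite prodf_seq_eq0 => /hasP[i _ /andP[iq]].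
rewrite /at_prime; case: insubP => [p _ pi|] /=; last by rewrite oner_eq0.
move=> /eqP e; apply: (euler_eq0 (p := p) (gpt_euler al0 be0 y0)).
by rewrite gpt_out // -val_eqE pi.
Qed.

Lemma whit_locW0 al be y : al != 0 -> be != 0 -> 0 < y -> locW q al = 0 -> whit (gpt al be y) = 0.
Proof.
move=> al0 be0 y0 e; apply: (euler_eq0 (p := q) (gpt_euler al0 be0 y0)).
by rewrite gpt_q.
Qed.

(** Fixing one be with B(be) nonzero gives a ratio independent of al and y. It is stated
    projectively, since B or the Whittaker function may vanish identically. *)
Lemma whit_relation : exists th1 th2 : C, ~ (th1 = 0 /\ th2 = 0) /\
  forall al y, al != 0 -> 0 < y -> th1 * whit (gpt (- al) al y) = th2 * whit (gpt al al y).
Proof.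
(* Invariance of the local factors needs a point of nonzero Whittaker value; without one, the
   relation is trivial. *)
have [[g0 [G0 w0]]|no] := pselect (exists g0, GL2A g0 /\ whit g0 != 0); last first.
  exists 1, 0; split; first by move=> [/eqP]; rewrite oner_eq0.
  move=> al y al0 y0; rewrite mul0r; have [//|wn] := eqVneq (whit (gpt (- al) al y)) 0.
    by move=> ->; rewrite mulr0.
  case: no; exists (gpt (- al) al y); split => //.
  by apply: GL2A_gpt; rewrite ?oppr_eq0.
(* If B vanishes identically, for each al one of its factors is 0 and annihilates the Whittaker
   value at [gpt al al y], so (0, 1) works. *)
have [[be [be0 Bbe]]|no] := pselect (exists be, be != 0 /\ locW q be * restW be != 0); last first.
  exists 0, 1; split; first by move=> [_ /eqP]; rewrite oner_eq0.
  move=> al y al0 y0; rewrite mul0r mul1r.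
  have : locW q al * restW al == 0 by apply: contraT => h; case: no; exists al.
  rewrite mulf_eq0 => /orP[/eqP h|/eqP h]; first by rewrite (whit_locW0 al0 al0 y0 h).
  by rewrite (whit_restW0 al0 al0 y0 h).
exists (locW q be * restW be), (locW q (- be) * restW be).
split; first by move=> [e _]; move: Bbe; rewrite e eqxx.
move=> al y al0 y0; have nal0 : - al != 0 by rewrite oppr_eq0.
apply: (cross_relation Bbe (locW_relation G0 w0 al0 be0) (whit_swap al0 nal0 y0)).
- exact: whit_restW0.
- exact: whit_restW0.
- exact: whit_locW0.
- exact: whit_locW0.
Qed.

End WhittakerRelation.

(** * The eigenvalue equation *)

Lemma mem_primes_level_part (N : nat) (c d : int) (q : nat) : c != 0 -> q \in primes N ->
  (vz q c < logn q N)%N -> vz q d != logn q N -> ~~ ((q == 2%N) && ((vz q c).+1 == logn q N)) ->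
  q \in primes (level_part N c d).
Proof.
move=> c0 qN hc hd h2; rewrite /level_part (negbTE c0).
have := qN; rewrite mem_primes => /and3P[pq N0 _]; rewrite mem_primes pq /=.
apply/andP; split.
  rewrite big_seq_cond prodn_cond_gt0 // => i /andP[iN _].
  by rewrite expn_gt0; have := iN; rewrite mem_primes => /and3P[/prime_gt0-> ].
rewrite (Euclid_dvd_prod _ _ _ pq) big_has_cond; apply/hasP; exists q => //.
by rewrite /= (ltn_eqF hc) (negbTE hd) (negbTE h2) /= dvdn_exp ?subn_gt0.
Qed.

Lemma primes_level_part (N : nat) (c d : int) : {subset primes (level_part N c d) <= primes N}.
Proof.
move=> q; rewrite /level_part; case: eqP => [_|c0]; first by rewrite mem_primes dvdn1; case: eqP => [->|]; rewrite ?andbF.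
rewrite mem_primes => /and3P[pq _]; rewrite (Euclid_dvd_prod _ _ _ pq) big_has_cond => /hasP[i iN /andP[_]].
move=> h; have := iN; rewrite mem_primes => /and3P[pi _ _].
have : (q %| i)%N.
  by move: h; rewrite Euclid_dvdX // => /andP[].
by rewrite dvdn_prime2 // => /eqP ->.
Qed.

Section FinalArgument.
Variables (R : realType) (k : int) (N : nat) (chi : int -> R[i]) (f : R[i] -> R[i]).
Local Notation C := R[i].
Hypothesis N0 : (0 < N)%N.
Hypothesis hchi : dirichlet_character N chi.
Hypothesis hf : automorphic k N f (fun g => chi (g 1 1)).
Hypothesis sf : smooth f.

(* Equality of all nonconstant Fourier coefficients at two cusps leaves a
   function invariant under translations and under the principal congruence
   subgroup, hence under SL2(Z). *)
Lemma invariant_of_fourier (gam del : 'M[int]_2) (a b : C) : SL2Z gam -> SL2Z del ->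
  (forall (r : int) (y : R), r != 0 -> 0 < y ->
     a * cint (fun t => slashZ k f (del *m gam) (N%:R * t +i* y)%C * e2pi (- (r%:~R * t))) =
     b * cint (fun t => slashZ k f gam (N%:R * t +i* y)%C * e2pi (- (r%:~R * t)))) ->
  SL2Z_invariant k (fun z => a * slashZ k f del z + (- b) * f z).
Proof.
move=> sg sd hc; have sdg := SL2Z_mul sd sg.
pose h z := a * slashZ k f del z + (- b) * f z.
have hE z : 0 < complex.Im z -> slashZ k h gam z =
    a * slashZ k f (del *m gam) z + (- b) * slashZ k f gam z.
  by move=> y0; rewrite slashZ_lin -slashZ_mul.
have NR0 : N%:R != 0 :> R by rewrite pnatr_eq0 -lt0n.
have cong g g' z : SL2Z g -> SL2Z g' -> 0 < complex.Im z ->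
    g' = g *m low N \/ g' = g *m upp N -> slashZ k f g' z = slashZ k f g z.
  move=> sg1 sg1' y0 [e|e]; apply: (slash_cong hchi hf) => //;
    rewrite e mulmx2E !mx22E ?mulr0 ?mulr1 ?add0r ?subrr ?dvdz0 //.
  - by rewrite addrAC subrr add0r dvdz_mull.
  - by rewrite addr0 subrr dvdz0.
  - by rewrite addrK dvdz_mull.
have ccs g (y : R) : SL2Z g -> 0 < y -> ccont (fun t : R => slashZ k f g (N%:R * t +i* y)%C).
  move=> sg1 y0; have c1 : ccont (fun t : R => slashZ k f g (t +i* y)%C).
    by apply: ccont_slash => //; apply: SL2Z_det.
  have := ccont_affine N%:R 0 c1; congr ccont; rewrite funeqE => t; by rewrite addr0.
have shift g (x y : R) : SL2Z g -> 0 < y ->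
    slashZ k f g (N%:R * (x + 1) +i* y)%C = slashZ k f g (N%:R * x +i* y)%C.
  move=> sg1 y0; rewrite -(cong g (g *m upp N) (N%:R * x +i* y)%C) //; last by right.
    rewrite slashZ_mul //; last exact: SL2Z_upp.
    rewrite slashZ_upp; congr slashZ.
    by rewrite -pmulrn -(rmorph_nat (real_complex R)); simpc; rewrite mulrDr mulr1.
  by apply: SL2Z_mul => //; exact: SL2Z_upp.
apply: (invariant_of_translation N0 sg) => [t z y0|z y0]; last first.
  rewrite -slashZ_mul //; last exact: SL2Z_low.
  have sgl : SL2Z (gam *m low N) by apply: SL2Z_mul => //; exact: SL2Z_low.
  rewrite hE // slashZ_lin -slashZ_mul // mulmxA.
  have sdgl : SL2Z (del *m gam *m low N) by apply: SL2Z_mul => //; exact: SL2Z_low.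
  rewrite (cong (del *m gam) (del *m gam *m low N)) //; last by left.
  by rewrite (cong gam (gam *m low N)) //; left.
case: z y0 => x y /= y0.
have -> : ((x +i* y) + t%:C = (x + t) +i* y)%C by simpc.
rewrite !hE //.
pose F (t : R) := a * slashZ k f (del *m gam) (N%:R * t +i* y)%C +
    (- b) * slashZ k f gam (N%:R * t +i* y)%C.
have Fconst : forall u v, F u = F v.
  apply: cfourier_const.
  - exact: ccontD (ccontM (ccont_cst a) (ccs _ _ sdg y0)) (ccontM (ccont_cst _) (ccs _ _ sg y0)).
  - by move=> u; rewrite /F !shift.
  - move=> r r0.
    rewrite -[LHS](_ : a * cint (fun t => slashZ k f (del *m gam) (N%:R * t +i* y)%C * e2pi (- (r%:~R * t))) +
      (- b) * cint (fun t => slashZ k f gam (N%:R * t +i* y)%C * e2pi (- (r%:~R * t))) = _).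
      by rewrite hc // mulNr subrr.
    rewrite -cint_lin; try by apply: ccontM; [exact: ccs | exact: ccont_e2pi].
    by congr cint; rewrite funeqE => u; rewrite /F; ring.
have := Fconst ((x + t) / N%:R) (x / N%:R).
by rewrite /F !(mulrC N%:R) !divfK.
Qed.


Hypothesis hlev : is_level k f N.
Hypothesis fnz : exists z : C, 0 < complex.Im z /\ f z != 0.
Hypothesis ninv : ~ SL2Z_invariant k f.
Variables (Woo : 'M[R]_2 -> C) (W : forall p : primeT, 'M[padic p]_2 -> C).
Variable gam : 'M[int]_2.
Hypothesis sgam : SL2Z gam.
Hypothesis hW : forall g : adele_mx R, GL2A g ->
  euler_product Woo W g (whittaker (adelic_lift k N chi f) g).
Variable N1 : nat.
Hypothesis hB : multiplicative_Qstar (Bfun W N1 gam).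
Variables (q : primeT) (n N' : nat).
Hypothesis qN1 : val q \in primes N1.
Hypothesis N1N : {subset primes N1 <= primes N}.
Hypothesis N'q : coprime N' (val q).
Hypothesis NE : N = (val q ^ n * N')%N.
Local Notation T := (val q ^ n)%N.
(** [Cq] and [Dq] form the lower row of X = gam diag(-1, 1) gam^-1, which has trace 0 and X^2 =
    1. *)
Local Notation Cq := (- 2 * gam 1 0 * gam 1 1).
Local Notation Dq := (1 + 2 * gam 0 1 * gam 1 0).

(** The row (Cq, Dq) is primitive, so Dq or Dq - Cq is prime to q; i is its inverse modulo T. *)
Lemma exists_unit_shift : exists x i j : int, (Dq - x * Cq) * i + T%:Z * j = 1.
Proof.
have pq : prime (val q) := valP q.
have sg1 := (SL2ZE gam).1 sgam.
have [x cx] : exists x : int, coprimez (Dq - x * Cq) (val q).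
  have cop (a : int) : ~~ ((val q)%:Z %| a)%Z -> coprimez a (val q).
    by move=> h; rewrite coprimez_sym coprimezE prime_coprime.
  have [/dvdzP[m em]|h] := boolP ((val q)%:Z %| Dq)%Z; last first.
    by exists 0; apply: cop; rewrite mul0r subr0.
  exists 1; apply/coprimezP.
  exists (- (2 * gam 0 0 * gam 0 1), (2 * gam 0 0 * gam 0 1 - 1 + 2 * gam 0 0 * gam 1 1) * m) => /=.
  rewrite -[X in _ + X]mulrA -em.
  transitivity (2 * (gam 0 0 * gam 1 1 - gam 0 1 * gam 1 0) - 1); first by ring.
  by rewrite sg1.
have /coprimezP[[i j] /= e] : coprimez (Dq - x * Cq) T.
  by move: cx; rewrite !coprimezE /=; apply: coprimeXr.
by exists x, i, j; rewrite -[RHS]e; ring.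
Qed.

(** An explicit strong approximation: del = low(s) upp(x) is such that del X has lower row (0, i)
    modulo T, and del itself (0, 1) modulo N'. Thus the sign change at q replaces the coefficients
    of f|gam by those of f|(del gam), up to a constant. *)
Lemma exists_eigen_low : exists (s i : int) (th : C),
  [/\ (N'%:Z %| s)%Z, (T%:Z %| s - Cq * i)%Z, coprimez i T & eigen_mod k f (low s) th].
Proof.
have pq : prime (val q) := valP q.
have sg1 := (SL2ZE gam).1 sgam.
have [x [i [j hij]]] := exists_unit_shift.
(* As X has trace 0, del X has lower-left entry Cq - s(Dq - x Cq), which s = Cq i kills modulo T.
   Its lower-right entry is then i, because X^2 = 1; [n0] records it. *)
have [s [sT sN]] := crt n N'q (Cq * i) 0; rewrite subr0 in sN.
have [n0 [n0T n0N]] := crt n N'q i 1.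
pose del := low s *m upp x; pose gam' := del *m gam.
have sdel : SL2Z del by apply: SL2Z_mul; [exact: SL2Z_low | exact: SL2Z_upp].
have sgam' : SL2Z gam' by apply: SL2Z_mul.
(* By construction gam'^-1 kz(p) = diag(eps p, 1) gam^-1. The matrix kz(p) is del X at q and del
   elsewhere. *)
pose eps (p : primeT) : int := if p == q then -1 else 1.
pose kz p := gam' *m mx22 (eps p) 0 0 1 *m invmx gam.
pose kf p : 'M[padic_int p]_2 := map_mx intr (kz p).
have ug : gam \in unitmx by rewrite unitmxE sgam.
have ug' : gam' \in unitmx by rewrite unitmxE sgam'.
have giE : invmx gam = mx22 (gam 1 1) (- gam 0 1) (- gam 1 0) (gam 0 0).
  by rewrite [in LHS](mx22_eta gam) mx22_inv.
have kz_out p : p != q -> kz p = del.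
  by move=> pq'; rewrite /kz /eps (negbTE pq') -mx22_1 mulmx1 /gam' -mulmxA mulmxV // mulmx1.
have kz_q10 : kz q 1 0 = s * (1 - 2 * gam 0 0 * gam 1 1) + (s * x + 1) * Cq.
  rewrite /kz /eps eqxx giE /gam' /del [in LHS](mx22_eta gam) !mx22_mul !mx22E.
  have e : 1 = gam 0 0 * gam 1 1 - gam 0 1 * gam 1 0 by [].
  rewrite [X in _ = s * (X - _) + _]e; ring.
have kz_q11 : kz q 1 1 = s * (2 * gam 0 0 * gam 0 1) + (s * x + 1) * Dq.
  rewrite /kz /eps eqxx giE /gam' /del [in LHS](mx22_eta gam) !mx22_mul !mx22E.
  have e : 1 = gam 0 0 * gam 1 1 - gam 0 1 * gam 1 0 by [].
  rewrite [X in _ = _ + _ * (X + _)]e; ring.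
have dvd_p p a : p != q -> (N'%:Z %| a)%Z -> ((val p ^ logn (val p) N)%N%:Z %| a)%Z.
  move=> pq' h; apply: dvdz_trans h; rewrite dvdzE /=.
  have npq : (val p == val q) = false by apply/negbTE.
  have T0 : (0 < T)%N by rewrite expn_gt0 prime_gt0.
  have N'0 : (0 < N')%N by move: N0; rewrite NE muln_gt0 => /andP[].
  suff -> : logn (val p) N = logn (val p) N' by rewrite pfactor_dvdnn.
  by rewrite NE lognM // lognX (logn_prime _ pq) npq muln0.
have dvd_q a : (T%:Z %| a)%Z -> ((val q ^ logn (val q) N)%N%:Z %| a)%Z.
  have T0 : (0 < T)%N by rewrite expn_gt0 prime_gt0.
  have N'0 : (0 < N')%N by move: N0; rewrite NE muln_gt0 => /andP[].
  have n'0 : logn (val q) N' = 0%N.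
    apply/eqP; rewrite -leqn0 leqNgt logn_gt0 mem_primes pq N'0 /= -prime_coprime //.
    by rewrite coprime_sym N'q.
  by rewrite NE lognM // pfactorK // n'0 addn0.
have sT' : exists u, s = Cq * i + u * T%:Z.
  by case/dvdzP: sT => u eu; exists u; rewrite -eu; ring.
have [v ev] : exists v, n0 = i + v * T%:Z.
  by case/dvdzP: n0T => v ev; exists v; rewrite -ev; ring.
have [u eu] := sT'.
have q10 : (T%:Z %| kz q 1%R 0%R)%Z.
  rewrite kz_q10; apply/dvdzP; exists (Cq * j + u * (1 - 2 * gam 0 0 * gam 1 1 + x * Cq)).
  transitivity (Cq * i * (2 - 2 * (gam 0 0 * gam 1 1 - gam 0 1 * gam 1 0)) +
    Cq * (1 - ((Dq - x * Cq) * i + T%:Z * j)) +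
    (Cq * j + u * (1 - 2 * gam 0 0 * gam 1 1 + x * Cq)) * T%:Z); first by rewrite eu; ring.
  by rewrite sg1 hij; ring.
have q11 : (T%:Z %| kz q 1%R 1%R - n0)%Z.
  rewrite kz_q11; apply/dvdzP; exists (u * (2 * gam 0 0 * gam 0 1 + x * Dq) + Dq * j - v).
  transitivity (i * (4 * gam 0 1 * gam 1 0) * (1 - (gam 0 0 * gam 1 1 - gam 0 1 * gam 1 0)) +
    Dq * (1 - ((Dq - x * Cq) * i + T%:Z * j)) +
    (u * (2 * gam 0 0 * gam 0 1 + x * Dq) + Dq * j - v) * T%:Z); first by rewrite eu ev; ring.
  by rewrite sg1 hij; ring.
have dkz p : \det (kz p) = eps p.
  rewrite /kz det_mulmx det_inv sgam invr1 mulr1 det_mulmx.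
  by have -> : \det gam' = 1 := sgam'; rewrite mx22_det; ring.
have hk : K0 N kf.
  move=> p; split.
    rewrite unitmxE det_map_mx dkz /eps.
    by apply: coprime_unitz; case: ifP => _; rewrite ?abszN coprime1n.
  rewrite mxE; have [->|pq'] := eqVneq p q; apply: padic_multiple => //.
    exact: dvd_q.
  by apply: dvd_p => //; rewrite kz_out // mulmx2E !mx22E mulr0 mulr1 addr0.
have hn p : exists t, kf p 1 1 - n0%:~R = N%:R * t.
  rewrite mxE -intrB; have [->|pq'] := eqVneq p q; apply: padic_multiple => //.
    exact: dvd_q.
  apply: dvd_p => //; rewrite kz_out // mulmx2E !mx22E mulr1.
  rewrite (_ : _ - n0 = s * x - (n0 - 1)); last by ring.
  by apply: rpredB => //; apply: dvdz_mulr.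
have chin0 : chi n0 != 0.
  have [_ _ _ ->] := hchi; rewrite NE PoszM coprimezMr; apply/andP; split.
    apply/coprimezP; exists (Dq - x * Cq, j - (Dq - x * Cq) * v) => /=.
    by rewrite -[RHS]hij ev; ring.
  case/dvdzP: n0N => w ew; apply/coprimezP; exists (1, - w) => /=.
  by rewrite mul1r mulNr -ew; ring.
have [th1 [th2 [thn rel]]] := whit_relation N0 hW (fun X kf => whittaker_rmul k chi f X (kf := kf))
  sgam hB qN1 N1N.
(* The twisted Whittaker value carries the factor chi(n0)^-1 of the adelic lift. *)
pose a := th1 * (chi n0)^-1.
have inv : SL2Z_invariant k (fun z => a * slashZ k f del z + (- th2) * f z).
  apply: invariant_of_fourier sgam sdel _ => r y r0 y0.
  have al0 : r%:~R / N%:R != 0 :> rat by rewrite mulf_neq0 ?invr_eq0 ?intr_eq0 ?pnatr_eq0 -?lt0n.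
  have w1 := whittaker_value N0 hchi hf sgam' hk hn sf r0 y0
    (gpt_oo gam q (- (r%:~R / N%:R)) (r%:~R / N%:R) y).
  match type of w1 with ?A -> _ => have h1 : A end.
    move=> p.
    rewrite /kf map_tofrac_int -map_mxM.
    have -> : invmx gam' *m kz p = mx22 (eps p) 0 0 1 *m invmx gam.
      by rewrite /kz -mulmxA mulKmx.
    rewrite -diag_scale /eps; have [->|pq'] := eqVneq p q; last by rewrite gpt_out // mulr1.
    by rewrite gpt_q mulrN1.
  have hk1 : K0 N (fun p => 1%:M).
    by move=> p; split; [exact: unitmx1 | exists 0; rewrite mx22_1 mx22E mulr0].
  have hn1 (p : primeT) : exists t : padic_int p, (1%:M : 'M[padic_int p]_2) 1 1 - 1%:~R = N%:R * t.
    by exists 0; rewrite mx22_1 mx22E subrr mulr0.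
  have w2 := whittaker_value N0 hchi hf sgam hk1 hn1 sf r0 y0
    (gpt_oo gam q (r%:~R / N%:R) (r%:~R / N%:R) y).
  match type of w2 with ?A -> _ => have h2 : A end.
    move=> p.
    rewrite map_mx1 mulmx1.
    by have [->|pq'] := eqVneq p q; [rewrite gpt_q | rewrite gpt_out].
  apply: etrans (etrans (rel _ y al0 y0) _); first by rewrite (w1 h1) mulrA.
  by rewrite (w2 h2) (chi1 hchi) invr1 mul1r.
(* With a = 0, th2 would be nonzero and f itself invariant. *)
have a0 : a != 0.
  apply: contra_notN ninv => /eqP a0.
  have t1 : th1 = 0 by move/eqP: a0; rewrite mulf_eq0 invr_eq0 (negbTE chin0) orbF => /eqP.
  have t2 : - th2 != 0 by rewrite oppr_eq0; apply/eqP => t2; apply: thn.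
  apply: (invariant_scale t2); apply: invariant_ext inv => z _.
  by rewrite a0 mul0r add0r.
exists s, i, (th2 / a); split => //.
  by apply/coprimezP; exists (Dq - x * Cq, j) => /=; rewrite -[RHS]hij; ring.
have e1 : eigen_mod k f del (th2 / a).
  apply: (invariant_scale a0); apply: invariant_ext inv => z _.
  by field.
(* Upper unipotents have eigenvalue 1, so [del] and [low s] share theirs. *)
have -> : low s = del *m upp (- x).
  by rewrite /del -mulmxA mx22_mul mx22_mul; apply: mx22_inj; ring.
rewrite -[th2 / a]mulr1; apply: (eigen_mod_mul sdel (SL2Z_upp _) e1).
exact: eigen_mod_upp hchi hf _.
Qed.

End FinalArgument.

(** * The theorem *)

Theorem theorem21 (R : realType) (k : int) (N : nat) (chi : int -> R[i])
  (f : R[i] -> R[i])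
  (Woo : 'M[R]_2 -> R[i]) (W : forall p : primeT, 'M[padic p]_2 -> R[i])
  (gam : 'M[int]_2)
  (hN : (1 <= N)%N)
  (hchi : dirichlet_character N chi)
  (hf : maass_form k N chi f)
  (hW : forall g : adele_mx R, GL2A g ->
     euler_product Woo W g (whittaker (adelic_lift k N chi f) g))
  (hgam : SL2Z gam)
  (hB : multiplicative_Qstar
     (Bfun W (level_part N (gam 1 0) (gam 1 1)) gam))
  (q : nat) (hq : prime q) :
  let M := gcdn N `|(2 * gam 1 0 * gam 1 1)%R|%N in
  [/\ ((3 < q)%N \/ logn q M = 0%N) -> logn q (N %/ M) = 0%N,
      q = 3%N -> (0 < logn q M)%N -> (logn q (N %/ M) <= 1)%N,
      q = 2%N -> logn q M = 1%N -> (logn q (N %/ M) <= 2)%N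
    & q = 2%N -> (2 <= logn q M)%N -> (logn q (N %/ M) <= 3)%N].
Proof.
move=> M.
have [hauto [sf [z0 [z00 fz0]] _] hlev] := hf.
set c := gam 1 0 in hB M *; set d := gam 1 1 in hB M *.
pose n := logn q N; pose e := logn q M.
have eNM : logn q (N %/ M) = (n - e)%N by rewrite logn_div // dvdn_gcdl.
(* If v_q(N) <= v_q(M), all four claims hold trivially. Otherwise v_q(M) = v_q(2cd) and cd is
   nonzero, since 2cd = 0 would give M = N. *)
rewrite eNM -/e; have [ne|en] := leqP n e.
  by rewrite (eqP (ne : (n - e)%N == 0%N)).
pose x := `|(2 * c * d)%R|%N.
have x0 : (0 < x)%N.
  by rewrite lt0n; apply: contraTneq en => xz; rewrite /e /M -/x xz gcdn0 ltnn.
have ex : e = logn q x.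
  by move: en; rewrite /e /M -/x logn_gcd // -/n; lia.
have [c0 d0] : c != 0 /\ d != 0.
  by split; apply: contraTneq x0 => z; rewrite /x z ?mulr0 ?mul0r.
have exv : e = (logn q 2 + vz q c + vz q d)%N.
  by rewrite ex /x !abszM !lognM ?muln_gt0 ?absz_gt0 ?c0.
have n0 : (0 < n)%N by apply: leq_ltn_trans en.
have qN : q \in primes N by rewrite -logn_gt0.
have ninv : ~ SL2Z_invariant k f.
  by move=> /(invariant_level1 hN hlev) N1; move: n0; rewrite /n N1 logn1.
(* Each exclusion in the definition of N1 would force v_q(2cd) >= v_q(N). *)
have qN1 : q \in primes (level_part N c d).
  apply: mem_primes_level_part => //; rewrite -/n; first by lia.
    by lia.
  apply/negP => /andP[/eqP q2 /eqP e1].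
  have l2 : logn q 2 = 1%N by rewrite q2.
  by lia.
have [N' cN NE] := pfactor_coprime hq hN; rewrite mulnC -/n in NE.
have N'q : coprime N' q by rewrite coprime_sym.
have [s [i [th [sN sT iT hs]]]] := exists_eigen_low hN hchi hauto sf ninv hgam hW hB
  (q := exist _ q hq) qN1 (@primes_level_part N c d) N'q NE.
move: sT iT; rewrite [val _]/= -/c -/d => sT iT.
have Cx : `|(- 2 * c * d)%R|%N = x by rewrite /x !mulNr abszN.
(* i is prime to q and s = -2cdi modulo q^n, so a power of q up to q^n dividing s divides 2cd. *)
have dvd_trans m : ((q ^ m)%N%:Z %| s)%Z -> (m <= n)%N -> (m <= e)%N.
  move=> hm mn; rewrite ex -pfactor_dvdn // -Cx -[(q ^ m)%N]/(`|(q ^ m)%N%:Z|%N) -dvdzE.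
  have Tm : ((q ^ m)%N%:Z %| (q ^ n)%N%:Z)%Z by rewrite dvdzE /=; apply: dvdn_exp2l.
  rewrite -(@Gauss_dvdzl _ _ i).
    rewrite (_ : _ * i = s - (s - - 2 * c * d * i)); last by ring.
    by apply: rpredB => //; apply: dvdz_trans sT.
  rewrite coprimez_sym; move: iT; rewrite !coprimezE; apply: coprime_dvdr.
  by rewrite -dvdzE.
(* In the same way N | sm gives q^n | 2cdm, which turns each level bound into a bound on n - e. *)
have key (m : nat) : (0 < m)%N -> (N%:Z %| s * m%:Z)%Z -> (n <= e + logn q m)%N.
  move=> m0 hm; have Tm : ((q ^ n)%N%:Z %| s * m%:Z)%Z.
    by apply: dvdz_trans hm; rewrite {1}NE PoszM dvdz_mulr.
  rewrite ex -lognM // -pfactor_dvdn ?muln_gt0 ?x0 // -Cx -[m in (_ * m)%N]/(`|m%:Z|%N) -abszM.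
  rewrite -[(q ^ n)%N]/(`|(q ^ n)%N%:Z|%N) -dvdzE.
  rewrite -(@Gauss_dvdzl _ _ i) 1?coprimez_sym //.
  rewrite (_ : _ * i = s * m%:Z - (s - - 2 * c * d * i) * m%:Z); last by ring.
  by apply: rpredB => //; apply: dvdz_mulr.
split.
- case=> [q3|e0].
    have := level_gt3 hN hchi hauto z00 fz0 hlev ninv hq N'q NE q3 sN hs.
    by rewrite -[s]mulr1 => /(key 1%N isT); rewrite logn1; lia.
  have sq : coprimez s q.
    rewrite coprimez_sym coprimezE prime_coprime //; apply/negP => qs.
    have := dvd_trans 1%N; rewrite expn1 dvdzE /= => /(_ qs n0); lia.
  have := level_unit hN hchi hauto z00 fz0 hlev ninv hq N'q NE sN sq hs; lia.
- move=> q3 _.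
  have := level_3 hN hchi hauto z00 fz0 hlev ninv hq N'q NE q3 sN hs.
  by move=> /(key 3%N isT); rewrite q3 (logn_prime 3) //=; lia.
- move=> q2 e1.
  (* The gcd is a power of 2, with exponent at most v_2(2cd) = 1 and at least 1 because s is
     even. *)
  have g2 : gcdz s (q ^ n)%N = 2.
    have qq : (q%:Z %| (q ^ n)%N%:Z)%Z by rewrite dvdzE /= dvdn_exp.
    have qs : (q%:Z %| s)%Z.
      rewrite (_ : s = (s - - 2 * c * d * i) + 2 * (- c * d * i)); last by ring.
      apply: rpredD; first exact: dvdz_trans sT.
      by rewrite q2; apply: dvdz_mulr.
    have [j jn ej] : exists2 j, (j <= n)%N & gcdn `|s| (q ^ n) = (q ^ j)%N.
      by apply/(dvdn_pfactor _ _ hq); apply: dvdn_gcdr.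
    have j1 : (j <= 1)%N by rewrite -e1; apply: dvd_trans => //; rewrite dvdzE /= -ej dvdn_gcdl.
    have j0 : (q %| q ^ j)%N by rewrite -ej dvdn_gcd; move: qs qq; rewrite !dvdzE /= => -> ->.
    rewrite /gcdz /= ej; case: j j1 j0 {jn ej} => [|[|//]] _.
      by rewrite expn0 dvdn1 => /eqP qe; move: hq; rewrite qe.
    by rewrite expn1 q2.
  have := level_2mod4 hN hchi hauto z00 fz0 hlev ninv hq N'q NE sN g2 hs.
  by move=> /(key 4%N isT); rewrite q2 (_ : logn 2 4 = 2%N) //; lia.
- move=> q2 _.
  have := level_2 hN hchi hauto z00 fz0 hlev ninv hq N'q NE q2 sN hs.
  by move=> /(key 8%N isT); rewrite q2 (_ : logn 2 8 = 3%N) //; lia.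
Qed.
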